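(* Let $k$ be a field and let $C_n$ be the cycle on $n\ge 3$ vertices. Then $C_n$ is sequentially $S_3$ (over $k$) if and only if $n\in\{3,5\}$, i.e., if and only if $C_n$ is Cohen-Macaulay (over $k$).
   Context: A finitely generated graded module $M$ over a Noetherian graded $k$-algebra $R$ satisfies Serre's condition $S_r$ if $\operatorname{depth} M_{\mathfrak p}\ge \min(r,\dim M_{\mathfrak p})$ for all $\mathfrak p\in\operatorname{Spec}(R)$. A finitely generated $\mathbb Z$-graded $R$-module $M$ ($R$ a standard graded $k$-algebra) is sequentially $S_r$ if there is a finite filtration $0=M_0\subset M_1\subset\cdots\subset M_t=M$ by graded submodules such that each quotient $M_i/M_{i-1}$ satisfies $S_r$ and $\dim(M_1/M_0)<\dim(M_2/M_1)<\cdots<\dim(M_t/M_{t-1})$. A simplicial complex $\Delta$ on $[n]=\{1,\dots,n\}$ is sequentially $S_r$ (respectively Cohen-Macaulay) over $k$ if its face ring $k[\Delta]=k[x_1,\dots,x_n]/I_\Delta$ is sequentially $S_r$ as a module over $R=k[x_1,\dots,x_n]$ (respectively is Cohen-Macaulay); here $I_\Delta$ is the Stanley-Reisner ideal, generated by the squarefree monomials $\prod_{j\in F}x_j$ with $F\notin\Delta$. For a finite simple graph $G$, $\Delta_G$ is the simplicial complex on the vertex set of $G$ whose faces are the independent sets of vertices of $G$; $G$ is called sequentially $S_r$ (respectively Cohen-Macaulay) if $\Delta_G$ is. *)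

(* Defs.v *)
From HB Require Import structures.
From mathcomp Require Import all_boot all_order all_algebra.
(* mpoly has to be imported before the classical libraries: in the other order
   their notations clash. *)
From mathcomp Require Import mpoly.
From mathcomp Require Import boolp classical_sets constructive_ereal.

Set Implicit Arguments.
Unset Strict Implicit.
Unset Printing Implicit Defensive.

Import Order.TTheory GRing.Theory Num.Theory.
Local Open Scope ring_scope.
Local Open Scope quotient_scope.
Local Open Scope classical_set_scope.

(* Rings are commutative and possibly zero, so that quotients and localizations
   are always rings. A submodule of M is a term of the library type
   [submodClosed M]; that it is a boolean predicate is no restriction, since
   [boolp] makes every proposition decidable. An ideal of R is a submodule of
   the regular module R^o. *)

Section Submodules.
Variables (R : comPzRingType) (M : lmodType R).
Implicit Types A B : submodClosed M.

(* [submodClosed] only records closure under + and scaling; over a ring this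
   gives closure under opposite, as the instances below require. *)
Definition submod_pred (A : submodClosed M) : {pred M} := fun x => x \in A.

Lemma submod_pred_closed A : submod_closed (submod_pred A).
Proof.
by split=> [|a x y Ax Ay]; [exact: rpred0|apply: rpredD; rewrite ?rpredZ].
Qed.

HB.instance Definition _ A :=
  GRing.isSubmodClosed.Build R M (submod_pred A) (submod_pred_closed A).

Definition submodule_type (A : submodClosed M) := {x : M | x \in submod_pred A}.

HB.instance Definition _ A := SubChoice.on (submodule_type A).
HB.instance Definition _ A :=
  [SubChoice_isSubLmodule of submodule_type A by <:].

Definition restr_submod A B : {pred submodule_type A} :=
  fun x => val x \in B.
Arguments restr_submod : clear implicits.

Lemma restr_submod_closed A B : submod_closed (restr_submod A B).
Proof.
split=> [|a x y Bx By]; first by rewrite unfold_in raddf0 rpred0.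
by rewrite unfold_in linearP /= rpredD ?rpredZ.
Qed.

HB.instance Definition _ A B :=
  GRing.isSubmodClosed.Build R (submodule_type A) (restr_submod A B)
    (restr_submod_closed A B).

Definition quot_mod (N : submodClosed M) := Quotient.quot (submod_pred N).

HB.instance Definition _ (N : submodClosed M) :=
  GRing.Zmodule.on (quot_mod N).

Section QuotScale.
Variable N : submodClosed M.

Definition quot_class (x : M) : quot_mod N :=
  \pi_(Quotient.quot (submod_pred N)) x.

Definition quot_scale (a : R) (x : quot_mod N) : quot_mod N :=
  quot_class (a *: repr (x : Quotient.quot (submod_pred N))).

Lemma quot_classE x y : quot_class x = quot_class y <-> x - y \in N.
Proof.
have e := Quotient.idealrBE (submod_pred N) x y.
by split=> [/eqP|xyN]; [rewrite -e|apply/eqP; rewrite -e].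
Qed.

Lemma quot_class_surj (x : quot_mod N) : exists y, x = quot_class y.
Proof.
exists (repr (x : Quotient.quot (submod_pred N))).
by rewrite /quot_class reprK.
Qed.

Lemma quot_classD x y : quot_class (x + y) = quot_class x + quot_class y.
Proof. by rewrite /quot_class !piE. Qed.

Lemma quot_scaleE a x : quot_scale a (quot_class x) = quot_class (a *: x).
Proof.
apply/quot_classE; rewrite -scalerBr rpredZ//; apply/quot_classE.
by rewrite /quot_class reprK.
Qed.

Lemma quot_scaleA a b x :
  quot_scale a (quot_scale b x) = quot_scale (a * b) x.
Proof.
by have [y ->] := quot_class_surj x; rewrite !quot_scaleE scalerA.
Qed.

Lemma quot_scale1 : left_id 1 quot_scale.
Proof.
by move=> x; have [y ->] := quot_class_surj x; rewrite quot_scaleE scale1r.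
Qed.

Lemma quot_scaleDr : right_distributive quot_scale +%R.
Proof.
move=> a x y; have [x' ->] := quot_class_surj x.
have [y' ->] := quot_class_surj y.
by rewrite -quot_classD !quot_scaleE scalerDr quot_classD.
Qed.

Lemma quot_scaleDl x : {morph quot_scale^~ x : a b / a + b}.
Proof.
move=> a b; have [y ->] := quot_class_surj x.
by rewrite !quot_scaleE scalerDl quot_classD.
Qed.

HB.instance Definition _ := GRing.Zmodule_isLmodule.Build R (quot_mod N)
  quot_scaleA quot_scale1 quot_scaleDr quot_scaleDl.

End QuotScale.

End Submodules.
Arguments restr_submod {R M} A B.

(* This is A / (A :&: B), that is A / B when B is contained in A. *)
Definition subquotient (R : comPzRingType) (M : lmodType R)
  (A B : submodClosed M) := quot_mod (restr_submod A B).

HB.instance Definition _ (R : comPzRingType) (M : lmodType R)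
  (A B : submodClosed M) := GRing.Lmodule.on (subquotient A B).

Section QuotRing.
Variables (R : comPzRingType) (I : submodClosed R^o).

Definition quot_ring := quot_mod I.

HB.instance Definition _ := GRing.Zmodule.on quot_ring.

Definition quot_ring_mul (x y : quot_ring) : quot_ring :=
  (repr (x : Quotient.quot (submod_pred I)) : R) *: (y : quot_mod I).

Lemma quot_ring_mulE (x y : R) :
  quot_ring_mul (quot_class I x) (quot_class I y) = quot_class I (x * y).
Proof.
rewrite /quot_ring_mul [LHS]quot_scaleE; apply/quot_classE.
set r := repr _; have /quot_classE rxI : quot_class I r = quot_class I x.
  by rewrite /quot_class reprK.
have -> : r *: (y : R^o) - (x * y : R^o) = y *: (r - x : R^o).
  by rewrite /GRing.scale/= mulrBr ![y * _]mulrC.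
by rewrite rpredZ.
Qed.

Lemma quot_ring_mulA : associative quot_ring_mul.
Proof.
move=> x y z; have [x' ->] := quot_class_surj x.
have [y' ->] := quot_class_surj y; have [z' ->] := quot_class_surj z.
by rewrite !quot_ring_mulE mulrA.
Qed.

Lemma quot_ring_mulC : commutative quot_ring_mul.
Proof.
move=> x y; have [x' ->] := quot_class_surj x.
by have [y' ->] := quot_class_surj y; rewrite !quot_ring_mulE mulrC.
Qed.

Lemma quot_ring_mul1 : left_id (quot_class I 1 : quot_ring) quot_ring_mul.
Proof.
by move=> x; have [x' ->] := quot_class_surj x; rewrite quot_ring_mulE mul1r.
Qed.

Lemma quot_ring_mulDl : left_distributive quot_ring_mul +%R.
Proof.
move=> x y z; have [x' ->] := quot_class_surj x.
have [y' ->] := quot_class_surj y; have [z' ->] := quot_class_surj z.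
by rewrite -[_ + _]quot_classD !quot_ring_mulE mulrDl quot_classD.
Qed.

HB.instance Definition _ := GRing.Zmodule_isComPzRing.Build quot_ring
  quot_ring_mulA quot_ring_mulC quot_ring_mul1 quot_ring_mulDl.

End QuotRing.

Record prime_ideal (R : comPzRingType) := PrimeIdeal {
  prime_ideal_submod :> submodClosed R^o ;
  prime_ideal1 : 1 \notin prime_ideal_submod ;
  prime_idealM : forall a b : R, a * b \in prime_ideal_submod ->
    a \in prime_ideal_submod \/ b \in prime_ideal_submod }.

Section Localization.
Variables (R : comPzRingType) (p : prime_ideal R).

Definition denom := {s : R | s \notin p}.

Definition denom1 : denom := exist _ 1 (prime_ideal1 p).

Lemma denomM_subproof (s t : denom) : val s * val t \notin p.
Proof.
apply/negP => /prime_idealM [].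
  by apply/negP; exact: (valP s).
by apply/negP; exact: (valP t).
Qed.

Definition denomM (s t : denom) : denom :=
  exist _ (val s * val t) (denomM_subproof s t).

Section LocMod.
Variable M : lmodType R.

(* m / s = m' / s' when u s' m = u s m' for some u outside p. *)
Definition loc_equiv (x y : M * denom) : bool :=
  `[< exists u : denom,
        val u *: (val y.2 *: x.1) = val u *: (val x.2 *: y.1) >].

Lemma loc_equiv_class : equiv_class_of loc_equiv.
Proof.
split=> [x|x y|y x z].
- by apply/asboolP; exists denom1.
- by apply/asboolP/asboolP => -[u e]; exists u.
move=> /asboolP[u e] /asboolP[v f]; apply/asboolP.
exists (denomM y.2 (denomM u v)) => /=.
transitivity ((val z.2 * val v) *: (val u *: (val y.2 *: x.1))).
  by rewrite !scalerA ?mulrA; congr (_ *: _); rewrite [LHS](ACl (4*3*2*1)).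
rewrite e; transitivity ((val x.2 * val u) *: (val v *: (val z.2 *: y.1))).
  by rewrite !scalerA ?mulrA; congr (_ *: _); rewrite [LHS](ACl (4*3*2*1)).
by rewrite f !scalerA ?mulrA; congr (_ *: _); rewrite [LHS](ACl (4*2*3*1)).
Qed.

Canonical loc_equiv_equiv := EquivRelPack loc_equiv_class.
Canonical loc_equiv_encModRel := defaultEncModRel loc_equiv.

Definition loc_quot := {eq_quot loc_equiv}.

HB.instance Definition _ := EqQuotient.on loc_quot.
HB.instance Definition _ := Choice.on loc_quot.

End LocMod.

Definition loc_mod (M : lmodType R) := loc_quot M.

HB.instance Definition _ (M : lmodType R) := Choice.on (loc_mod M).

Section Fractions.
Variable M : lmodType R.
Implicit Types (m : M) (s t : denom) (x y z : loc_mod M).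

Definition frac (m : M) (s : denom) : loc_mod M := \pi_(loc_quot M) (m, s).

Lemma fracP (m m' : M) (s s' : denom) :
  frac m s = frac m' s' <->
  exists u : denom, val u *: (val s' *: m) = val u *: (val s *: m').
Proof.
split=> [/eqP|e]; first by rewrite piE => /asboolP.
by apply/eqP; rewrite piE; apply/asboolP.
Qed.

Lemma frac_surj (x : loc_mod M) : exists m s, x = frac m s.
Proof.
exists (repr (x : loc_quot M)).1, (repr (x : loc_quot M)).2.
by rewrite /frac -surjective_pairing reprK.
Qed.

Definition num (x : loc_mod M) : M := (repr (x : loc_quot M)).1.
Definition den (x : loc_mod M) : denom := (repr (x : loc_quot M)).2.

Lemma frac_num_den x : frac (num x) (den x) = x.
Proof. by rewrite /frac -surjective_pairing reprK. Qed.


Lemma frac_eq (m m' : M) (s s' : denom) :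
  val s' *: m = val s *: m' -> frac m s = frac m' s'.
Proof. by move=> e; apply/fracP; exists denom1; rewrite e. Qed.

Definition loc_zero : loc_mod M := frac 0 denom1.

Definition loc_opp (x : loc_mod M) : loc_mod M := frac (- num x) (den x).

Definition loc_add (x y : loc_mod M) : loc_mod M :=
  frac (val (den y) *: num x + val (den x) *: num y) (denomM (den x) (den y)).

Lemma loc_oppE m s : loc_opp (frac m s) = frac (- m) s.
Proof.
have /fracP[u e] := frac_num_den (frac m s).
by apply/fracP; exists u; rewrite !scalerN e.
Qed.

Lemma loc_addE m s m' s' :
  loc_add (frac m s) (frac m' s') =
  frac (val s' *: m + val s *: m') (denomM s s').
Proof.
have /fracP[u e] := frac_num_den (frac m s).
have /fracP[v f] := frac_num_den (frac m' s').
rewrite /loc_add; move: (num _) (den _) e (num _) (den _) f => n d e n' d' f.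
apply/fracP; exists (denomM u v) => /=; rewrite !scalerDr; congr (_ + _).
  transitivity ((val v * val d' * val s') *: (val u *: (val s *: n))).
    by rewrite !scalerA ?mulrA; congr (_ *: _); rewrite [LHS](ACl (2*5*4*1*3)).
  by rewrite e !scalerA ?mulrA; congr (_ *: _); rewrite [LHS](ACl (4*1*5*2*3)).
transitivity ((val u * val d * val s) *: (val v *: (val s' *: n'))).
  by rewrite !scalerA ?mulrA; congr (_ *: _); rewrite [LHS](ACl (1*5*3*2*4)).
by rewrite f !scalerA ?mulrA; congr (_ *: _); rewrite [LHS](ACl (1*4*2*5*3)).
Qed.

Lemma loc_addC : commutative loc_add.
Proof.
move=> x y; have [m [s ->]] := frac_surj x; have [m' [s' ->]] := frac_surj y.
by rewrite !loc_addE addrC; apply: frac_eq; rewrite /= mulrC.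
Qed.

Lemma loc_addA : associative loc_add.
Proof.
move=> x y z; have [m [s ->]] := frac_surj x; have [m' [s' ->]] := frac_surj y.
have [m'' [s'' ->]] := frac_surj z.
rewrite !loc_addE; apply: frac_eq => /=; rewrite mulrA; congr (_ *: _).
by rewrite !scalerDr !scalerA addrA (mulrC (val s'')) (mulrC (val s'') (val s)).
Qed.

Lemma loc_add0 : left_id loc_zero loc_add.
Proof.
move=> x; have [m [s ->]] := frac_surj x; rewrite loc_addE.
by apply: frac_eq; rewrite /= scaler0 add0r scale1r mul1r.
Qed.

Lemma loc_addN : left_inverse loc_zero loc_opp loc_add.
Proof.
move=> x; have [m [s ->]] := frac_surj x; rewrite loc_oppE loc_addE.
by apply: frac_eq; rewrite /= scalerN addNr !scaler0.
Qed.

HB.instance Definition _ := GRing.isZmodule.Build (loc_mod M)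
  loc_addA loc_addC loc_add0 loc_addN.

Lemma fracD m s m' s' :
  frac m s + frac m' s' = frac (val s' *: m + val s *: m') (denomM s s').
Proof. exact: loc_addE. Qed.

End Fractions.

Definition loc_scale (M : lmodType R) (a : loc_mod R^o) (x : loc_mod M) :
  loc_mod M := frac ((num a : R) *: num x) (denomM (den a) (den x)).

Section ScaleE.
Variable M : lmodType R.
Implicit Types (m : M) (s t : denom) (x y z : loc_mod M).

Lemma loc_scaleE (a : R) s m t :
  loc_scale (frac (a : R^o) s) (frac m t) = frac (a *: m) (denomM s t).
Proof.
have /fracP[u e] := frac_num_den (frac (a : R^o) s).
have /fracP[v f] := frac_num_den (frac m t).
rewrite /loc_scale; move: (num _) (den _) e (num _) (den _) f.
move=> n d + n' d' f; rewrite /GRing.scale/= => e.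
apply/fracP; exists (denomM u v) => /=.
transitivity ((val u * (val s * n)) *: (val v *: (val t *: n'))).
  by rewrite !scalerA ?mulrA; congr (_ *: _); rewrite [LHS](ACl (1*3*5*2*4)).
rewrite e f !scalerA ?mulrA; congr (_ *: _).
by rewrite [LHS](ACl (1*4*2*5*3)).
Qed.

End ScaleE.

Section Scale.
Variable M : lmodType R.
Implicit Types (m : M) (x y : loc_mod M).

Lemma loc_scaleA (a b : loc_mod R^o) x :
  loc_scale a (loc_scale b x) = loc_scale (loc_scale a b) x.
Proof.
have [a' [s ->]] := frac_surj a; have [b' [t ->]] := frac_surj b.
have [m [v ->]] := frac_surj x.
rewrite (loc_scaleE b' t m) (loc_scaleE a' s (_ *: m)).
rewrite (loc_scaleE a' s (b' : R^o)) loc_scaleE.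
by apply: frac_eq; rewrite /= (scalerA a' b') !mulrA.
Qed.

Lemma loc_scale1 : left_id (frac (1 : R^o) denom1) (@loc_scale M).
Proof.
move=> x; have [m [s ->]] := frac_surj x; rewrite loc_scaleE.
by apply: frac_eq; rewrite /= scale1r mul1r.
Qed.

Lemma loc_scaleDr (a : loc_mod R^o) : {morph @loc_scale M a : x y / x + y}.
Proof.
move=> x y; have [a' [r ->]] := frac_surj a; have [m [s ->]] := frac_surj x.
have [n [t ->]] := frac_surj y; rewrite fracD !loc_scaleE fracD.
apply: frac_eq; rewrite /= !scalerDr !scalerA ?mulrA; congr (_ *: _ + _ *: _).
  by rewrite [LHS](ACl (1*2*4*3*6*5)).
by rewrite [LHS](ACl (1*2*4*3*6*5)).
Qed.

Lemma loc_scaleDl x : {morph (@loc_scale M)^~ x : a b / a + b}.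
Proof.
move=> a b; have [a' [r ->]] := frac_surj a; have [b' [s ->]] := frac_surj b.
have [m [t ->]] := frac_surj x; rewrite fracD !loc_scaleE fracD.
apply: frac_eq; rewrite /= scalerDl !scalerDr !scalerA; congr (_ *: _ + _ *: _).
  rewrite /GRing.scale/= !mulrA.
  by rewrite [LHS](ACl (1*3*2*5*4*6)).
rewrite /GRing.scale/= !mulrA.
by rewrite [LHS](ACl (1*3*2*5*4*6)).
Qed.

End Scale.

Definition loc_ring := loc_mod R^o.

HB.instance Definition _ := GRing.Zmodule.on loc_ring.

Lemma loc_mulC : commutative (@loc_scale R^o).
Proof.
move=> x y; have [a [s ->]] := frac_surj x; have [b [t ->]] := frac_surj y.
rewrite !loc_scaleE; apply: frac_eq.
by rewrite /GRing.scale/= (mulrC (val t)) (mulrC a).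
Qed.

Lemma loc_mulA : associative (@loc_scale R^o).
Proof. exact: loc_scaleA. Qed.

Lemma loc_mulDl : left_distributive (@loc_scale R^o) +%R.
Proof. move=> a b x; exact: loc_scaleDl. Qed.

HB.instance Definition _ := GRing.Zmodule_isComPzRing.Build loc_ring
  loc_mulA loc_mulC (@loc_scale1 R^o) loc_mulDl.

HB.instance Definition _ (M : lmodType R) :=
  GRing.Zmodule_isLmodule.Build loc_ring (loc_mod M)
    (@loc_scaleA M) (@loc_scale1 M) (@loc_scaleDr M) (@loc_scaleDl M).

(* The maximal ideal p R_p of the local ring R_p. *)
Definition loc_max : {pred loc_ring} :=
  fun x => `[< exists a s, a \in p /\ x = frac (a : R^o) s >].

End Localization.

Section DimDepth.
Variables (A : comPzRingType) (M : lmodType A).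

Definition annihilates (a : A) : Prop := forall m : M, a *: m = 0.

(* P 0, ..., P l is a strictly increasing chain of primes containing Ann M. *)
Definition prime_chain (l : nat) (P : nat -> prime_ideal A) : Prop :=
  (forall i a, (i <= l)%N -> annihilates a -> a \in P i) /\
  (forall i, (i < l)%N ->
     {subset P i <= P i.+1} /\ exists2 a, a \in P i.+1 & a \notin P i).

(* Krull dimension, that of A / Ann M; it is -oo when M = 0. *)
Definition krull_dim : \bar int :=
  supremum -oo%E [set (Posz l)%:E | l in [set l | exists P, prime_chain l P]].

(* The submodule (s_0, ..., s_r) M. *)
Definition seq_smul (s : seq A) : set M :=
  [set m | exists f : nat -> M, m = \sum_(i < size s) s`_i *: f i].

Definition ideal_smul (J : {pred A}) : set M :=
  [set m | exists s : seq A, all (mem J) s /\ seq_smul s m].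

Definition regular_seq (s : seq A) : Prop :=
  (forall i (m : M), (i < size s)%N ->
     seq_smul (take i s) (s`_i *: m) -> seq_smul (take i s) m) /\
  seq_smul s <> setT.

(* The supremum of the lengths of the M-regular sequences in J, and +oo when
   J M = M; in particular it is +oo when M = 0. *)
Definition depth (J : {pred A}) : \bar int :=
  if `[< ideal_smul J = setT >] then +oo%E
  else supremum -oo%E [set (Posz (size s))%:E | s in
         [set s : seq A | all (mem J) s /\ regular_seq s]].

End DimDepth.
Arguments krull_dim {A} M.
Arguments depth {A} M J.

Section LocalInvariants.
Variables (R : comPzRingType) (M : lmodType R) (p : prime_ideal R).

Definition dim_at : \bar int := krull_dim (loc_mod p M).

Definition depth_at : \bar int := depth (loc_mod p M) (@loc_max R p).

End LocalInvariants.
Arguments dim_at {R} M p.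
Arguments depth_at {R} M p.

Definition serre (R : comPzRingType) (r : nat) (M : lmodType R) : Prop :=
  forall p : prime_ideal R,
    (Order.min (Posz r)%:E (dim_at M p) <= depth_at M p)%E.

Definition maximal_ideal (R : comPzRingType) (m : prime_ideal R) : Prop :=
  forall I : submodClosed R^o,
    {subset m <= I} -> (1 : R^o) \notin I -> {subset I <= m}.

(* A zero localization is excluded: its depth is +oo and its dimension -oo. *)
Definition cohen_macaulay_mod (R : comPzRingType) (M : lmodType R) : Prop :=
  forall m : prime_ideal R, maximal_ideal m ->
    (exists x : loc_mod m M, x <> 0) -> depth_at M m = dim_at M m.

Definition cohen_macaulay_ring (R : comPzRingType) : Prop :=
  cohen_macaulay_mod (R^o : lmodType R).

(* [deg j] is the component M_j of a graded module M. Since M is the direct sum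
   of the M_j, N being spanned by its homogeneous elements says that N is the
   direct sum of the N :&: M_j. *)
Definition graded_submod (R : comPzRingType) (M : lmodType R)
  (deg : int -> set M) (N : submodClosed M) : Prop :=
  forall x, x \in N -> exists s : seq M,
    (forall y, y \in s -> y \in N /\ exists j, deg j y) /\ x = \sum_(y <- s) y.

Definition seq_serre (R : comPzRingType) (r : nat) (M : lmodType R)
  (deg : int -> set M) : Prop :=
  exists (t : nat) (F : nat -> submodClosed M),
    [/\ (forall x, x \in F 0%N <-> x = 0) /\ (forall x, x \in F t),
        forall i, (i <= t)%N -> graded_submod deg (F i),
        forall i, (i < t)%N -> {subset F i <= F i.+1},
        forall i, (i < t)%N -> serre r (subquotient (F i.+1) (F i)) &
        forall i, (i.+1 < t)%N ->
          (krull_dim (subquotient (F i.+1) (F i)) <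
           krull_dim (subquotient (F i.+2) (F i.+1)))%E].

Record simplicial_complex (n : nat) := SimplicialComplex {
  faces :> {set {set 'I_n}} ;
  face0 : finset.set0 \in faces ;
  face_sub : forall F G : {set 'I_n}, G \in faces -> F \subset G ->
    F \in faces }.

Section FaceRing.
Variables (k : fieldType) (n : nat) (D : simplicial_complex n).

Definition squarefree_monomial (F : {set 'I_n}) : {mpoly k[n]} :=
  \prod_(j in F) 'X_j.

Definition SR_ideal : {pred {mpoly k[n]}^o} :=
  fun p => `[< exists c : {set 'I_n} -> {mpoly k[n]},
    p = \sum_(F : {set 'I_n} | F \notin (D : {set {set 'I_n}}))
          c F * squarefree_monomial F >].

Lemma SR_ideal_closed : submod_closed SR_ideal.
Proof.
split=> [|a p q /asboolP[c ->] /asboolP[d ->]]; apply/asboolP.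
  by exists (fun=> 0); rewrite big1 // => F _; rewrite mul0r.
exists (fun F => a * c F + d F).
rewrite [a *: _]mulr_sumr -big_split /=.
by apply: eq_bigr => F _; rewrite mulrDl mulrA.
Qed.

HB.instance Definition _ :=
  GRing.isSubmodClosed.Build {mpoly k[n]} {mpoly k[n]}^o SR_ideal
    SR_ideal_closed.

Definition face_ring : comPzRingType := quot_ring SR_ideal.

Definition face_mod : lmodType {mpoly k[n]} := quot_mod SR_ideal.

(* The standard grading: zero in negative degrees. *)
Definition face_deg (j : int) : set face_mod :=
  [set quot_class SR_ideal p | p in
    [set p : {mpoly k[n]} | if j is Posz d then p \is d.-homog else p = 0]].

Definition complex_seq_serre (r : nat) : Prop := seq_serre r face_deg.

Definition complex_cohen_macaulay : Prop := cohen_macaulay_ring face_ring.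

End FaceRing.

Record simple_graph (n : nat) := SimpleGraph {
  edge :> rel 'I_n ;
  edge_sym : ssrbool.symmetric edge ;
  edge_irr : irreflexive edge }.

Section Independence.
Variables (n : nat) (G : simple_graph n).

Definition independent (S : {set 'I_n}) : bool :=
  [forall i in S, forall j in S, ~~ edge G i j].

Definition independent_sets := [set S | independent S]%SET.

Lemma independent_sets0 : finset.set0 \in independent_sets.
Proof. by rewrite inE; apply/forall_inP => i; rewrite inE. Qed.

Lemma independent_sets_sub (S T : {set 'I_n}) :
  T \in independent_sets -> S \subset T -> S \in independent_sets.
Proof.
rewrite !inE => /forall_inP indT /fintype.subsetP sST.
apply/forall_inP => i /sST /indT /forall_inP indTi.
by apply/forall_inP => j /sST; exact: indTi.
Qed.

Definition independence_complex : simplicial_complex n :=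
  SimplicialComplex independent_sets0 independent_sets_sub.

End Independence.

Definition graph_seq_serre (k : fieldType) (n : nat) (r : nat)
  (G : simple_graph n) : Prop :=
  complex_seq_serre k (independence_complex G) r.

Definition graph_cohen_macaulay (k : fieldType) (n : nat)
  (G : simple_graph n) : Prop :=
  complex_cohen_macaulay k (independence_complex G).

Section Cycle.
Variable n : nat.

(* [i != j] only matters for n = 1, where i = i + 1 modulo n. *)
Definition cycle_edge : rel 'I_n := fun i j =>
  (i != j) && ((val j == i.+1 %% n)%N || (val i == j.+1 %% n)%N).

Lemma cycle_edge_sym : ssrbool.symmetric cycle_edge.
Proof. by move=> i j; rewrite /cycle_edge eq_sym orbC. Qed.

Lemma cycle_edge_irr : irreflexive cycle_edge.
Proof. by move=> i; rewrite /cycle_edge eqxx. Qed.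

Definition cycle_graph : simple_graph n :=
  SimpleGraph cycle_edge_sym cycle_edge_irr.

End Cycle.

(* Main.v *)
(* Localizations of the cyclic modules involved are translated into ideals of
   the polynomial ring R: dimension becomes the length of chains of primes, and
   regular sequences live modulo ideals saturated at a prime.

   n = 3, 5: near every prime the face ring is reduced of dimension at most 2.
   Depth 1 is a non-zero-divisor; depth 2, for the pentagon, is obtained by
   gluing the polynomial rings of its five edges along a path, which is where
   connectedness enters.

   Sequentially S_3 implies n = 3, 5: let R / J be the last quotient of the
   filtration. Comparing dimensions, J is contained in the ideal of the
   subcomplex spanned by the faces of maximal size n/2, and a
   Hartshorne-type connectedness argument for the S_2 module R / J shows that
   the two ideals agree at the origin. That subcomplex is two disjoint simplices
   for n even, and a strip with the homotopy type of a circle for n odd; a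
   nontrivial class in its cohomology of degree 0 or 1 gives a nontrivial Koszul
   cocycle on R / J, which bounds the depth at the origin by 1 or 2.

   Cohen-Macaulay implies n = 3, 5: the depth is at most the dimension of R / p
   for every associated prime p, so all facets have size n/2, and the previous
   obstruction applies to the face ring itself. *)
Require Import Defs.
From HB Require Import structures.
From mathcomp Require Import all_boot all_order all_algebra.
From mathcomp Require Import mpoly.
From mathcomp Require Import boolp classical_sets constructive_ereal.
From mathcomp Require Import ring zify.
(* Imported again because the fraction field library shadows [frac]. *)
Require Import Defs.

Set Implicit Arguments.
Unset Strict Implicit.
Unset Printing Implicit Defensive.

Import Order.TTheory GRing.Theory Num.Theory.
Local Open Scope ring_scope.

(** * Ideals, chains of primes and regular sequences *)

(** The final contradiction uses S_3 only at the origin, as depth at least min(3, n/2). A class of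
    degree 0 refutes depth 2 and one of degree 1 refutes depth 3; this excludes the even n with n/2
    >= 2 and the odd n with n/2 >= 3, and leaves exactly 3 and 5. Unmixedness, in contrast, needs
    S_2 at primes other than the origin, since the primes where it could fail are found only by
    associated prime arguments. Dimensions enter only through chains: S_r is used as the passage
    from a chain of primes of length l <= r below Q to a regular sequence of length l at Q. Upper
    bounds come from counting monomials in algebraic relations. The field may be finite, so
    parameters cannot be chosen generically. The regular elements are either explicit sums of
    variables and of products of variables, or are supplied by the prime itself. *)

Section IntegerSup.
Local Open Scope ereal_scope.

(** [supremum] falls back on its default unless a least upper bound exists: a bounded set of
    naturals has its maximum, an unbounded one has +oo. *)
Lemma int_sup_exists (S : nat -> Prop) :
  (exists l, S l) ->
  classical_sets.nonempty (supremums [set (Posz l)%:E | l in S]%classic).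
Proof.
move=> [l0 Sl0].
have [[N hN]|unb] := pselect (exists N, forall l, S l -> (l <= N)%N).
  have ex : exists l, `[< S l >] by exists l0; apply/asboolP.
  have ub l : `[< S l >] -> (l <= N)%N by move/asboolP/hN.
  case: (ex_maxnP ex ub) => m /asboolP Sm mmax.
  exists (Posz m)%:E; split=> [_ [l Sl <-]|y]; last by apply; exists m.
  by rewrite lee_fin lez_nat; apply: mmax; apply/asboolP.
exists +oo; split=> [_ [l _ <-]|y yub]; first exact: leey.
case: y yub => [z| |] yub //.
- exfalso; apply: unb; exists `|z|%N => l Sl.
  have /= := yub _ (ex_intro2 _ _ l Sl erefl); rewrite lee_fin => h.
  by rewrite -lez_nat (le_trans h) // abszE ler_norm.
- by have := yub _ (ex_intro2 _ _ l0 Sl0 erefl).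
Qed.

Lemma int_sup_ge (S : nat -> Prop) l : S l ->
  (Posz l)%:E <= supremum -oo [set (Posz l)%:E | l in S]%classic.
Proof.
move=> Sl; apply: ge_supremum_Nmem; last by exists l.
by apply: int_sup_exists; exists l.
Qed.

Lemma int_sup_le (S : nat -> Prop) (x : \bar int) :
  (forall l, S l -> (Posz l)%:E <= x) ->
  supremum -oo [set (Posz l)%:E | l in S]%classic <= x.
Proof.
move=> ub; rewrite /supremum; case: ifPn => [_|/set0P[_ [l Sl _]]].
  exact: leNye.
have nS : classical_sets.nonempty (supremums [set (Posz l)%:E | l in S]%classic).
  by apply: int_sup_exists; exists l.
have [_] := xgetPex -oo nS.
by apply=> _ [k Sk <-]; apply: ub.
Qed.

End IntegerSup.

Section Ideals.
Variable R : comPzRingType.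
Implicit Types (I J K Q : R -> Prop) (a b c f u : R).

Definition ideal K : Prop :=
  [/\ K 0, forall a b, K a -> K b -> K (a + b) & forall a b, K b -> K (a * b)].

Definition primep Q : Prop :=
  [/\ ideal Q, ~ Q 1 & forall a b, Q (a * b) -> Q a \/ Q b].

Definition sub_ideal I J : Prop := forall f, I f -> J f.

(* The contraction to R of the extension of K to the localization at Q. *)
Definition sat Q K f : Prop := exists2 u, ~ Q u & K (u * f).

(** For an ideal K this is K + (b). *)
Definition adj K b f : Prop := exists c, K (f - c * b).

Definition ideal_sum I J f : Prop := exists a b, [/\ I a, J b & f = a + b].

Definition colon K f a : Prop := K (a * f).

Lemma ideal0 K : ideal K -> K 0. Proof. by case. Qed.
Lemma idealD K : ideal K -> forall a b, K a -> K b -> K (a + b).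
Proof. by case. Qed.
Lemma idealMl K : ideal K -> forall a b, K b -> K (a * b). Proof. by case. Qed.
Lemma idealMr K : ideal K -> forall a b, K a -> K (a * b).
Proof. by move=> iK a b Ka; rewrite mulrC; exact: idealMl. Qed.
Lemma idealN K : ideal K -> forall a, K a -> K (- a).
Proof. by move=> iK a Ka; rewrite -mulN1r; exact: idealMl. Qed.
Lemma idealB K : ideal K -> forall a b, K a -> K b -> K (a - b).
Proof. by move=> iK a b Ka Kb; apply: idealD => //; exact: idealN. Qed.
Lemma ideal_congr K a b : ideal K -> K (a - b) -> K b -> K a.
Proof. by move=> iK Kab Kb; rewrite -(subrK b a); exact: idealD. Qed.

Lemma ideal_sumr K (T : Type) (r : seq T) (P : pred T) (F : T -> R) : ideal K ->
  (forall i, P i -> K (F i)) -> K (\sum_(i <- r | P i) F i).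
Proof.
by move=> iK KF; elim/big_rec: _ => [|i x Pi Kx];
  [exact: ideal0|apply: idealD => //; exact: KF].
Qed.

Lemma primep_ideal Q : primep Q -> ideal Q. Proof. by case. Qed.
Lemma primep1 Q : primep Q -> ~ Q 1. Proof. by case. Qed.
Lemma primepM Q : primep Q -> forall a b, Q (a * b) -> Q a \/ Q b.
Proof. by case. Qed.
Lemma primepNM Q : primep Q -> forall a b, ~ Q a -> ~ Q b -> ~ Q (a * b).
Proof. by move=> pQ a b nQa nQb /(primepM pQ)[]. Qed.

Lemma primep_prod Q (T : Type) (r : seq T) (P : pred T) (F : T -> R) :
  primep Q -> (forall i, P i -> ~ Q (F i)) -> ~ Q (\prod_(i <- r | P i) F i).
Proof.
move=> pQ nQF; elim/big_rec: _ => [|i x Pi Qx]; first exact: primep1.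
by apply: primepNM => //; exact: nQF.
Qed.

Lemma primepX Q a k : primep Q -> ~ Q a -> ~ Q (a ^+ k).
Proof.
move=> pQ nQa; elim: k => [|k IHk]; first by rewrite expr0; exact: primep1.
by rewrite exprS; exact: primepNM.
Qed.

Lemma sat_ideal Q K : primep Q -> ideal K -> ideal (sat Q K).
Proof.
move=> pQ iK; split=> [|a b [u Qu Ka] [v Qv Kb]|a b [u Qu Kb]].
- by exists 1; [exact: primep1|rewrite mulr0; exact: ideal0].
- exists (u * v); first exact: primepNM.
  rewrite mulrDr; apply: idealD => //.
    by rewrite mulrAC; exact: idealMr.
  by rewrite -mulrA; exact: idealMl.
- by exists u => //; rewrite mulrCA; exact: idealMl.
Qed.

Lemma sub_sat Q K : primep Q -> sub_ideal K (sat Q K).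
Proof. by move=> pQ f Kf; exists 1; [exact: primep1|rewrite mul1r]. Qed.

Lemma sat_sub Q K K' : sub_ideal K K' -> sub_ideal (sat Q K) (sat Q K').
Proof. by move=> KK' f [u Qu Kuf]; exists u => //; exact: KK'. Qed.

Lemma satM Q K u f : primep Q -> ~ Q u -> sat Q K (u * f) -> sat Q K f.
Proof.
move=> pQ Qu [v Qv Kf]; exists (v * u); first exact: primepNM.
by rewrite -mulrA.
Qed.

Lemma sat_idem Q K f : primep Q -> sat Q (sat Q K) f -> sat Q K f.
Proof. by move=> pQ [u Qu]; exact: satM. Qed.

Lemma sat_primep Q p f : primep p -> sub_ideal p Q -> sat Q p f -> p f.
Proof. by move=> pp pQ [u Qu /(primepM pp)[/pQ|]]. Qed.

Lemma sat_self Q f : primep Q -> sat Q Q f -> Q f.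
Proof. by move=> pQ; exact: sat_primep. Qed.

Lemma adj_ideal K b : ideal K -> ideal (adj K b).
Proof.
move=> iK; split=> [|x y [c Kx] [d Ky]|a x [c Kx]].
- by exists 0; rewrite mul0r subr0; exact: ideal0.
- exists (c + d); have -> : x + y - (c + d) * b = (x - c * b) + (y - d * b).
    by ring.
  exact: idealD.
- exists (a * c); have -> : a * x - a * c * b = a * (x - c * b) by ring.
  exact: idealMl.
Qed.

Lemma sub_adj K b : ideal K -> sub_ideal K (adj K b).
Proof. by move=> iK f Kf; exists 0; rewrite mul0r subr0. Qed.

Lemma adj_gen K b c : ideal K -> adj K b (c * b).
Proof. by move=> iK; exists c; rewrite subrr; exact: ideal0. Qed.

Lemma adj_le K Q b : ideal Q -> sub_ideal K Q -> Q b -> sub_ideal (adj K b) Q.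
Proof.
move=> iQ KQ Qb f [c Kf]; apply: (ideal_congr iQ (KQ _ Kf)); exact: idealMl.
Qed.

Lemma sat_le Q K P : primep P -> sub_ideal P Q -> sub_ideal K P ->
  sub_ideal (sat Q K) P.
Proof. by move=> pP PQ KP f /(sat_sub KP) /(sat_primep pP PQ). Qed.

Lemma colon_ideal K f : ideal K -> ideal (colon K f).
Proof.
move=> iK; split=> [|a b Ka Kb|a b Kb]; rewrite /colon.
- by rewrite mul0r; exact: ideal0.
- by rewrite mulrDl; exact: idealD.
- by rewrite -mulrA; exact: idealMl.
Qed.

Lemma ideal_sum_ideal I J : ideal I -> ideal J -> ideal (ideal_sum I J).
Proof.
move=> iI iJ; split=> [|_ _ [a [b [Ia Jb ->]]] [c [d [Ic Jd ->]]]|x _ [a [b [Ia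
  Jb ->]]]].
- by exists 0, 0; split; [exact: ideal0|exact: ideal0|rewrite addr0].
- by exists (a + c), (b + d); split; [exact: idealD|exact: idealD|ring].
- by exists (x * a), (x * b); split; [exact: idealMl|exact: idealMl|ring].
Qed.

Definition chain I Q (l : nat) : Prop := exists q : nat -> R -> Prop,
  (forall i, (i <= l)%N -> [/\ primep (q i), sub_ideal I (q i) & sub_ideal (q i)
    Q]) /\
  (forall i, (i < l)%N -> sub_ideal (q i) (q i.+1) /\ exists2 a, q i.+1 a & ~ q i a).

Definition nzd_mod K b : Prop := forall f, K (b * f) -> K f.

(** Saturating after each element makes [nzd_mod], a statement over R, express regularity on the
    localization. Properness of the final ideal is left to [adj_seq_le]. *)
Fixpoint reg_from Q K (bs : seq R) : Prop :=
  if bs is b :: bs' then [/\ Q b, nzd_mod K b & reg_from Q (sat Q (adj K b)) bs']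
  else True.

(* There is a regular sequence of length r on (R / I)_Q in the maximal ideal. *)
Definition has_reg I Q (r : nat) : Prop :=
  exists bs, size bs = r /\ reg_from Q (sat Q I) bs.

Definition adj_seq Q K (bs : seq R) : R -> Prop :=
  foldl (fun K b => sat Q (adj K b)) K bs.

Lemma reg_from_nth Q K bs : reg_from Q K bs <->
  forall i, (i < size bs)%N ->
    Q bs`_i /\ nzd_mod (adj_seq Q K (take i bs)) bs`_i.
Proof.
elim: bs K => [|b bs IHbs] K /=; first by split.
split=> [[Qb nzb /IHbs reg] [|i] ib|reg] //=; first exact: reg.
by split; [exact: (reg 0%N _).1|exact: (reg 0%N _).2|apply/IHbs => i /(reg i.+1)].
Qed.

Lemma adj_seq_ideal Q K bs : primep Q -> ideal K -> ideal (adj_seq Q K bs).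
Proof.
move=> pQ; elim: bs K => //= b bs IHbs K iK; apply: IHbs.
by apply: sat_ideal => //; exact: adj_ideal.
Qed.

(** Elements of Q never push the ideal beyond Q, and 1 is outside Q: this provides the clause
    [seq_smul s <> setT] of [regular_seq]. *)
Lemma adj_seq_le Q K bs : primep Q -> sub_ideal K Q ->
  (forall i, (i < size bs)%N -> Q bs`_i) -> sub_ideal (adj_seq Q K bs) Q.
Proof.
move=> pQ; elim: bs K => //= b bs IHbs K KQ Qbs; apply: IHbs => [|i ib].
  apply: sat_le => //; apply: adj_le => //; first exact: primep_ideal.
  exact: (Qbs 0%N).
exact: (Qbs i.+1).
Qed.

Lemma reg_from_take Q K bs k : reg_from Q K bs -> reg_from Q K (take k bs).
Proof.
by elim: bs K k => [|b bs IHbs] K [|k] //= [Qb nzb /IHbs reg].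
Qed.

Lemma has_reg_le I Q r s : (s <= r)%N -> has_reg I Q r -> has_reg I Q s.
Proof.
move=> sr [bs [bsr reg]]; exists (take s bs); split; last exact: reg_from_take.
by rewrite size_takel // bsr.
Qed.

Lemma has_reg0 I Q : has_reg I Q 0.
Proof. by exists [::]. Qed.

Lemma chain_le I Q r s : (s <= r)%N -> chain I Q r -> chain I Q s.
Proof.
move=> sr [q [qp qs]]; exists q; split=> [i /leq_trans|i /leq_trans] h.
  by apply: qp; exact: h.
by apply: qs; exact: h.
Qed.

End Ideals.

(** * Depth and dimension of localized cyclic modules *)

Section Localization.
Variables (R B : comPzRingType) (phi : {rmorphism R -> B}).
Hypothesis phi_surj : forall b, exists a, b = phi a.
Variables (M : lmodType B) (e : M).
Hypothesis gen : forall m : M, exists b, m = b *: e.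
Variable P : prime_ideal B.

(** As phi is onto and e generates M, all data descend to R: M becomes R / I and P becomes Q. This
    is applied with B = R to the last quotient of a filtration, and with B the face ring as a module
    over itself. *)
Definition ker_gen : R -> Prop := fun f => phi f *: e = 0.
Definition contraction : R -> Prop := fun f => phi f \in P.

Local Notation I := ker_gen.
Local Notation Q := contraction.

Lemma ker_gen_ideal : ideal I.
Proof.
rewrite /I; split=> [|a b Ia Ib|a b Ib].
- by rewrite rmorph0 scale0r.
- by rewrite rmorphD scalerDl Ia Ib addr0.
- by rewrite rmorphM -scalerA Ib scaler0.
Qed.

Lemma contraction_primep : primep Q.
Proof.
rewrite /Q; split=> [||a b]; last by rewrite rmorphM => /prime_idealM.
- split=> [|a b Qa Qb|a b Qb].
  + by rewrite rmorph0 (rpred0 (prime_ideal_submod P)).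
  + by rewrite rmorphD (rpredD (S := prime_ideal_submod P)).
  + by rewrite rmorphM (rpredZ (s := prime_ideal_submod P)).
- by rewrite rmorph1; apply/negP; exact: prime_ideal1.
Qed.

Definition to_den (u : R) : ~ Q u -> denom P :=
  fun h => exist _ (phi u) (introN idP h).

Lemma den_phi (s : denom P) : exists u, ~ Q u /\ val s = phi u.
Proof.
have [u su] := phi_surj (val s); exists u; split=> //.
by rewrite /Q -su; apply/negP; exact: (valP s).
Qed.

Lemma frac_gen (x : loc_mod P M) : exists f s, x = frac (phi f *: e) s.
Proof.
have [m [s ->]] := frac_surj x; have [b ->] := gen m.
by have [f ->] := phi_surj b; exists f, s.
Qed.

Lemma frac_phi (x : loc_ring P) : exists f s, x = frac (phi f : B^o) s.
Proof.
have [b [s ->]] := frac_surj x; have [f ->] := phi_surj b.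
by exists f, s.
Qed.

Lemma loc_zeroE : (0 : loc_mod P M) = frac 0 (denom1 P).
Proof. by []. Qed.

Lemma frac_eq0 f (s : denom P) : frac (phi f *: e) s = 0 <-> sat Q I f.
Proof.
rewrite loc_zeroE; split=> [/fracP[u]|[u Qu Iuf]].
  rewrite scale1r !scaler0; have [v [Qv ->]] := den_phi u.
  by rewrite scalerA -rmorphM => Ivf; exists v.
apply/fracP; exists (to_den Qu).
by rewrite scale1r !scaler0 /= scalerA -rmorphM.
Qed.

Lemma scale_fracE (a : B) (s t : denom P) (m : M) :
  (frac (a : B^o) s : loc_ring P) *: frac m t = frac (a *: m) (denomM s t).
Proof. exact: loc_scaleE. Qed.

Lemma loc_ring1 : (1 : loc_ring P) = frac (1 : B^o) (denom1 P).
Proof. by []. Qed.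

Lemma loc_ringM (a b : B) (s t : denom P) :
  (frac (a : B^o) s : loc_ring P) * frac (b : B^o) t =
  frac (a * b : B^o) (denomM s t).
Proof. exact: loc_scaleE. Qed.

Lemma frac_subE (f g : R) (s t : denom P) (a b : R) :
  val s = phi a -> val t = phi b ->
  frac (phi f *: e) s - frac (phi g *: e) t =
  frac (phi (b * f - a * g) *: e) (denomM s t).
Proof.
move=> sa tb; have -> : - frac (phi g *: e) t = frac (- (phi g *: e)) t.
  exact: loc_oppE.
rewrite fracD; congr frac; rewrite sa tb.
by rewrite scalerN !scalerA -scalerBl -!rmorphM -rmorphB.
Qed.

Lemma annihilates_phi f : (forall m : M, phi f *: m = 0) <-> I f.
Proof.
split=> [/(_ e)|Ife m] //; have [b ->] := gen m.
by rewrite scalerA mulrC -scalerA Ife scaler0.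
Qed.

(** Contract along f to f/1. A fraction f/s differs from f/1 by a unit, so strict inclusions stay
    strict; an f outside Q becomes a unit, so the contractions lie in Q. *)
Lemma chain_of_loc l (p : nat -> prime_ideal (loc_ring P)) :
  prime_chain (loc_mod P M) l p -> chain I Q l.
Proof.
move=> [pann pstr].
pose i f : loc_ring P := frac (phi f : B^o) (denom1 P).
have iM f g : i (f * g) = i f * i g.
  rewrite /i loc_ringM rmorphM; apply: frac_eq => /=.
  by rewrite mulr1.
have i1 : i 1 = 1 by rewrite /i rmorph1.
have i0 : i 0 = 0 by rewrite /i rmorph0.
have iD f g : i (f + g) = i f + i g.
  rewrite /i [RHS]fracD rmorphD; apply: frac_eq => /=.
  by rewrite mulr1 !scale1r.
exists (fun j f => i f \in p j); split=> [j jl|j jl].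
  split.
  - split=> [||a b]; last by rewrite iM => /prime_idealM.
    + split=> [|a b pa pb|a b pb].
      * by rewrite i0 (rpred0 (prime_ideal_submod (p j))).
      * by rewrite iD (rpredD (S := prime_ideal_submod (p j))).
      * by rewrite iM (rpredZ (s := prime_ideal_submod (p j))).
    + by rewrite i1; apply/negP; exact: prime_ideal1.
  - move=> f If; apply: (pann j _ jl) => x.
    have [m [s ->]] := frac_surj x; rewrite scale_fracE.
    by rewrite (annihilates_phi f).2 //; apply: frac_eq; rewrite !scaler0.
  - move=> f pf; apply: contrapT => Qf.
    move/negP: (prime_ideal1 (p j)); apply.
    have -> : (1 : loc_ring P) = (frac (1 : B^o) (to_den Qf) : loc_ring P) * i f.
      rewrite loc_ringM loc_ring1; apply: frac_eq => /=.
      by rewrite scale1r mul1r mulr1 /GRing.scale/= mulr1.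
    exact: (rpredZ (s := prime_ideal_submod (p j))).
have [psub [x px npx]] := pstr j jl; split=> [f|]; first exact: psub.
have [f [s xE]] := frac_phi x.
have xf : i f = (frac (val s : B^o) (denom1 P) : loc_ring P) * x.
  rewrite xE loc_ringM; apply: frac_eq => /=.
  by rewrite scale1r mul1r.
have fx : x = (frac (1 : B^o) s : loc_ring P) * i f.
  rewrite xE loc_ringM; apply: frac_eq => /=.
  by rewrite mul1r mulr1.
exists f; first by rewrite xf (rpredZ (s := prime_ideal_submod (p j.+1))).
apply: contraNnot npx; rewrite fx => pf.
exact: (rpredZ (s := prime_ideal_submod (p j))).
Qed.

Section Extension.
Variable q : R -> Prop.
Hypotheses (pq : primep q) (Iq : sub_ideal I q) (qQ : sub_ideal q Q).

Definition ext_pred : {pred (loc_ring P)^o} :=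
  fun x => `[< exists f s, q f /\ x = frac (phi f : B^o) s >].

(** Equal fractions agree after multiplication by elements outside Q and modulo the kernel of phi.
    The former are outside q, as q lies in Q, and cancel; the latter lies in I, hence in q. *)
Lemma ext_predE f (s : denom P) :
  (frac (phi f : B^o) s : (loc_ring P)^o) \in ext_pred <-> q f.
Proof.
split=> [/asboolP[g [t [qg /fracP[u]]]]|qf]; last by apply/asboolP; exists f, s.
have [a [Qa ->]] := den_phi u; have [b [Qb ->]] := den_phi s.
have [c [Qc ->]] := den_phi t.
rewrite /GRing.scale/= -!rmorphM => /eqP; rewrite -subr_eq0 -rmorphB => /eqP h.
have /Iq qh : I (a * (c * f) - a * (b * g)) by rewrite /I h scale0r.
have iq := primep_ideal pq.
have : q (a * (c * f)).
  apply: (ideal_congr iq qh); do 2 apply: (idealMl iq); exact: qg.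
case/(primepM pq) => [/qQ//|/(primepM pq)[/qQ//|//]].
Qed.

Lemma ext_pred_closed : submod_closed ext_pred.
Proof.
have iq := primep_ideal pq; split.
  apply/asboolP; exists 0, (denom1 P); split; first exact: ideal0.
  by rewrite rmorph0.
move=> a x y; have [f [s xE]] := frac_phi x; have [g [t yE]] := frac_phi y.
have [h [v aE]] := frac_phi a; rewrite xE yE aE => /ext_predE qf /ext_predE qg.
apply/asboolP; have -> : (frac (phi h : B^o) v : loc_ring P) *: (frac (phi f :
  B^o) s : (loc_ring P)^o) = frac (phi (h * f) : B^o) (denomM v s).
  by rewrite rmorphM; exact: loc_ringM.
have [a1 [_ a1E]] := den_phi t; have [a2 [_ a2E]] := den_phi (denomM v s).
exists (a1 * (h * f) + a2 * g), (denomM (denomM v s) t); split.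
  apply: idealD => //; first by do 2 apply: idealMl => //.
  exact: idealMl.
rewrite [LHS]fracD; congr frac.
by rewrite a1E a2E rmorphD !rmorphM.
Qed.

HB.instance Definition _ := GRing.isSubmodClosed.Build (loc_ring P) (loc_ring P)^o
  ext_pred ext_pred_closed.

Lemma ext_pred1 : 1 \notin ext_pred.
Proof.
apply/negP; have -> : (1 : (loc_ring P)^o) = frac (phi 1 : B^o) (denom1 P).
  by rewrite rmorph1.
by move/ext_predE; exact: primep1.
Qed.

Lemma ext_predM (a b : loc_ring P) : a * b \in ext_pred ->
  a \in ext_pred \/ b \in ext_pred.
Proof.
have [f [s ->]] := frac_phi a; have [g [t ->]] := frac_phi b.
rewrite loc_ringM -rmorphM => /ext_predE /(primepM pq)[qf|qg].
  by left; apply/ext_predE.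
by right; apply/ext_predE.
Qed.

Definition ext_prime : prime_ideal (loc_ring P) :=
  PrimeIdeal (prime_ideal_submod := ext_pred) ext_pred1 ext_predM.

End Extension.

Lemma loc_of_chain l : chain I Q l ->
  exists p, prime_chain (loc_mod P M) l p.
Proof.
move=> [q [qp qstr]].
(* Indices beyond l receive the prime of index 0 as a default. *)
pose p j : prime_ideal (loc_ring P) :=
  if pselect (j <= l)%N is left h then
    let: And3 a b c := qp j h in ext_prime a b c
  else let: And3 a b c := qp 0%N (leq0n l) in ext_prime a b c.
have pE j f s : (j <= l)%N -> (frac (phi f : B^o) s : loc_ring P) \in p j <-> q j f.
  move=> jl; rewrite /p; case: pselect => // h.
  case: (qp j h) => a b c; exact: ext_predE.
exists p; split=> [j x jl xann|j jl].
  have [f [s xE]] := frac_phi x; rewrite xE; apply/pE => //.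
  have := xann (frac e (denom1 P)); rewrite xE scale_fracE => /frac_eq0[u Qu Iuf].
  have [pq Iq qQ] := qp j jl.
  by have /(primepM pq)[/qQ|] := Iq _ Iuf.
have jl' := ltnW jl; have [qq [a qa nqa]] := qstr j jl; split.
  move=> x; have [f [s ->]] := frac_phi x.
  by move=> /(pE _ _ _ jl') /qq qf; apply/pE.
exists (frac (phi a : B^o) (denom1 P)); first by apply/pE.
by apply/negP => /(pE _ _ _ jl').
Qed.

Lemma dim_at_ge l : chain I Q l -> ((Posz l)%:E <= dim_at M P)%E.
Proof. by move=> /loc_of_chain; exact: int_sup_ge. Qed.

Lemma dim_at_le x : (forall l, chain I Q l -> ((Posz l)%:E <= x)%E) ->
  (dim_at M P <= x)%E.
Proof. by move=> h; apply: int_sup_le => l [p /chain_of_loc]; exact: h. Qed.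

Lemma seq_smul_rcons (A : comPzRingType) (N : lmodType A) (s : seq A) a (m : N) :
  seq_smul (rcons s a) m <-> exists m', seq_smul s (m - a *: m').
Proof.
rewrite /seq_smul/= size_rcons; split=> [[f ->]|[m' [f mE]]].
  exists (f (size s)), f; rewrite big_ord_recr /= nth_rcons ltnn eqxx addrK.
  by apply: eq_bigr => i _; rewrite nth_rcons ltn_ord.
exists (fun i => if (i < size s)%N then f i else m').
rewrite big_ord_recr /= nth_rcons ltnn eqxx -(subrK (a *: m') m) mE.
by congr (_ + _); apply: eq_bigr => i _; rewrite nth_rcons ltn_ord.
Qed.

(** Membership is decided on numerators: the last generator is split off, and clearing denominators
    turns its multiples into [adj] followed by [sat]. *)
Lemma seq_smul_lift bs (s : seq (loc_ring P)) : size s = size bs ->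
  (forall i, (i < size bs)%N -> exists t, s`_i = frac (phi bs`_i : B^o) t) ->
  forall f (t : denom P),
    seq_smul s (frac (phi f *: e) t) <-> adj_seq Q (sat Q I) bs f.
Proof.
have pQ := contraction_primep; have iI := ker_gen_ideal.
elim/last_ind: bs s => [|bs b IHbs] s.
  move=> /size0nil -> _ f t; split=> [[g h]|/(frac_eq0 f t) ->].
    by apply/(frac_eq0 f t); rewrite h big_ord0.
  by exists (fun=> 0); rewrite big_ord0.
case/lastP: s => [|s a]; first by rewrite size_rcons.
rewrite !size_rcons => -[ssz] sE f t; rewrite seq_smul_rcons.
have {}IHbs := IHbs s ssz _; have {}IHbs : forall f (t : denom P),
    seq_smul s (frac (phi f *: e) t) <-> adj_seq Q (sat Q I) bs f.
  apply: IHbs => i ib; have := sE i (ltnW ib).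
  by rewrite !nth_rcons ssz ib.
have [w aE] : exists w, a = frac (phi b : B^o) w.
  by have := sE (size bs) (ltnSn _); rewrite !nth_rcons ssz ltnn eqxx.
have iK : ideal (adj_seq Q (sat Q I) bs).
  by apply: adj_seq_ideal => //; exact: sat_ideal.
rewrite {1}/adj_seq foldl_rcons -/(adj_seq Q (sat Q I) bs) aE.
have [t' [Qt' tE]] := den_phi t; have [w' [Qw' wE]] := den_phi w.
split=> [[m']|[u Qu [c Kc]]].
  have [g [v ->]] := frac_gen m'; have [v' [Qv' vE]] := den_phi v.
  rewrite scale_fracE scalerA -rmorphM.
  rewrite (@frac_subE _ _ _ _ t' (w' * v') tE); last by rewrite /= wE vE rmorphM.
  move/IHbs => h; exists (w' * v'); first exact: primepNM.
  by exists (t' * g); have -> : w' * v' * f - t' * g * b = w' * v' * f - t' * (b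
    * g) by ring.
(* With a = b/w and u f - c b in the previous ideal, the coefficient of a has to be w c / (u t), so
   that the difference becomes (u f - c b) / (u t). *)
exists (frac (phi (w' * c) *: e) (denomM (to_den Qu) t)).
rewrite scale_fracE scalerA -rmorphM.
rewrite (@frac_subE _ _ _ _ t' (w' * (u * t')) tE); last first.
  by rewrite /= wE tE !rmorphM.
apply/IHbs; have -> : w' * (u * t') * f - t' * (b * (w' * c)) =
  w' * t' * (u * f - c * b) by ring.
exact: idealMl.
Qed.

Lemma lift_loc_max (x : loc_ring P) : x \in @loc_max B P ->
  exists f s, Q f /\ x = frac (phi f : B^o) s.
Proof.
move=> /asboolP[a [s [aP ->]]]; have [f fE] := phi_surj a.
by exists f, s; rewrite -fE; split; rewrite // /Q -fE.
Qed.

Lemma lift_seq (s : seq (loc_ring P)) : all (mem (@loc_max B P)) s ->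
  exists bs, [/\ size s = size bs, forall i, (i < size bs)%N -> Q bs`_i &
    forall i, (i < size bs)%N -> exists t, s`_i = frac (phi bs`_i : B^o) t].
Proof.
elim: s => [|x s IHs] /=; first by exists [::].
move=> /andP[/lift_loc_max[f [t [Qf xE]]] /IHs[bs [sz Qbs bsE]]].
exists (f :: bs); split=> [|[|i] //= ib|[|i] //= ib]; first by rewrite /= sz.
- exact: Qbs.
- by exists t.
- exact: bsE.
Qed.

Lemma ideal_smul_proper : sub_ideal I Q ->
  ideal_smul (M := loc_mod P M) (@loc_max B P) <> setT.
Proof.
move=> IQ h; have pQ := contraction_primep.
have : setT (frac (phi 1 *: e) (denom1 P)) by [].
rewrite -h => -[s [/lift_seq[bs [sz Qbs bsE]]]].
move/(seq_smul_lift sz bsE); apply: contra_not (primep1 pQ).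
by apply: adj_seq_le => //; apply: sat_le.
Qed.

(** An element of I outside Q is a unit that kills the localization, which is therefore zero. This
    is the case of depth +oo. *)
Lemma ideal_smul_full : ~ sub_ideal I Q ->
  ideal_smul (M := loc_mod P M) (@loc_max B P) = setT.
Proof.
move=> IQ; rewrite predeqE => m; split=> // _.
have [f If Qf] : exists2 f, I f & ~ Q f.
  apply: contrapT => h; apply: IQ => f If; apply: contrapT => Qf; apply: h.
  by exists f.
exists [::]; split=> //; exists (fun=> 0); rewrite big_ord0.
have [g [s ->]] := frac_gen m; apply/frac_eq0; exists f => //.
by rewrite mulrC; exact: (idealMl ker_gen_ideal).
Qed.

Lemma reg_lift bs (s : seq (loc_ring P)) : size s = size bs ->
  (forall i, (i < size bs)%N -> Q bs`_i) ->
  (forall i, (i < size bs)%N -> exists t, s`_i = frac (phi bs`_i : B^o) t) ->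
  (forall i (m : loc_mod P M), (i < size s)%N ->
     seq_smul (take i s) (s`_i *: m) -> seq_smul (take i s) m) <->
  reg_from Q (sat Q I) bs.
Proof.
move=> sz Qbs bsE; have tE i : (i < size bs)%N -> forall f (t : denom P),
    seq_smul (take i s) (frac (phi f *: e) t) <->
    adj_seq Q (sat Q I) (take i bs) f.
  move=> ib; apply: seq_smul_lift; first by rewrite !size_take sz.
  move=> j; rewrite size_takel ?(ltnW ib) // => ji.
  by rewrite !nth_take //; apply: bsE; exact: ltn_trans ib.
split=> [reg|/reg_from_nth reg i m].
  apply/reg_from_nth => i ib; split=> [|f Kf]; first exact: Qbs.
  apply/(tE i ib f (denom1 P))/reg; first by rewrite sz.
  have [t ->] := bsE i ib; rewrite scale_fracE scalerA -rmorphM.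
  exact/(tE i ib).
rewrite sz => ib; have [f [t ->]] := frac_gen m; have [v ->] := bsE i ib.
rewrite scale_fracE scalerA -rmorphM => /(tE i ib) h; apply/(tE i ib).
exact: (reg i ib).2.
Qed.

Lemma depth_sup : sub_ideal I Q -> depth_at M P =
  supremum -oo%E [set (Posz r)%:E | r in has_reg I Q]%classic.
Proof.
move=> IQ; have pQ := contraction_primep.
rewrite /depth_at /depth; case: asboolP => [/ideal_smul_proper//|_].
congr supremum; rewrite predeqE => x; split=> [[s [sQ [reg _]] <-]|].
  have [bs [sz Qbs bsE]] := lift_seq sQ.
  by exists (size s) => //; exists bs; split=> //; apply/reg_lift; eassumption.
move=> [r [bs [<- reg]] <-].
pose s := [seq (frac (phi b : B^o) (denom1 P) : loc_ring P) | b <- bs].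
have sz : size s = size bs by rewrite size_map.
have Qbs i : (i < size bs)%N -> Q bs`_i by move=> ib;
  apply: ((reg_from_nth _ _ _).1 reg i ib).1.
have bsE i : (i < size bs)%N -> exists t, s`_i = frac (phi bs`_i : B^o) t.
  by move=> ib; exists (denom1 P); rewrite (nth_map 0).
exists s; last by rewrite sz.
split; last split.
- apply/(all_nthP 0) => i; rewrite sz => ib; rewrite (nth_map 0) //.
  by apply/asboolP; exists (phi bs`_i), (denom1 P); split=> //; exact: Qbs.
- exact: (reg_lift sz Qbs bsE).2.
- move=> h; have : setT (frac (phi 1 *: e) (denom1 P)) by [].
  rewrite -h => /(seq_smul_lift sz bsE); apply: contra_not (primep1 pQ).
  by apply: adj_seq_le => //; apply: sat_le.
Qed.

Lemma depth_at_oo : ~ sub_ideal I Q -> depth_at M P = +oo%E.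
Proof.
by move=> /ideal_smul_full h; rewrite /depth_at /depth; case: asboolP.
Qed.

Lemma depth_at_ge r : has_reg I Q r -> ((Posz r)%:E <= depth_at M P)%E.
Proof.
have [IQ|/depth_at_oo ->] := pselect (sub_ideal I Q); last by rewrite leey.
by rewrite depth_sup //; exact: int_sup_ge.
Qed.

Lemma depth_at_le x : sub_ideal I Q ->
  (forall r, has_reg I Q r -> ((Posz r)%:E <= x)%E) -> (depth_at M P <= x)%E.
Proof. by move=> IQ h; rewrite depth_sup //; exact: int_sup_le. Qed.

(** If no sequence of length r existed, truncation would bound all lengths by r - 1, and with them
    the supremum. *)
Lemma has_reg_of_depth r : sub_ideal I Q ->
  ((Posz r)%:E <= depth_at M P)%E -> has_reg I Q r.
Proof.
move=> IQ rd; apply: contrapT => nreg.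
case: r => [|r] in rd nreg; first by apply: nreg; exact: has_reg0.
have : (depth_at M P <= (Posz r)%:E)%E.
  apply: depth_at_le => // s sreg; rewrite lee_fin lez_nat leqNgt.
  by apply/negP => rs; apply: nreg; exact: has_reg_le rs sreg.
by move/(le_trans rd); rewrite lee_fin lez_nat ltnn.
Qed.

End Localization.

(** * Noetherian rings *)

Section Noetherian.

(** The maximum condition is the form in use: primes and denominators are obtained below from
    maximal members of families of ideals. *)
Definition noetherian_ring (R : comPzRingType) : Prop :=
  forall S : (R -> Prop) -> Prop, (exists K, S K) -> (forall K, S K -> ideal K) ->
  exists2 K, S K & forall K', S K' -> sub_ideal K K' -> sub_ideal K' K.

(** Jump from one index minimizing f on a tail to the next such index; minima over shrinking tails
    cannot decrease. *)
Lemma nondecreasing_subseq (f : nat -> nat) : exists g : nat -> nat,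
  (forall i, (g i < g i.+1)%N) /\ forall i, (f (g i) <= f (g i.+1))%N.
Proof.
have minP N : exists i, (N <= i)%N /\ forall j, (N <= j)%N -> (f i <= f j)%N.
  have ex : exists v, `[< exists2 i, (N <= i)%N & f i = v >].
    by exists (f N); apply/asboolP; exists N.
  case: (ex_minnP ex) => v /asboolP[i Ni <-] vmin; exists i; split=> // j Nj.
  by apply: vmin; apply/asboolP; exists j.
have [h hP] := choice minP.
exists (fun i => iter i (fun a => h a.+1) (h 0%N)); split=> i; rewrite iterS.
  exact: (hP _).1.
set a := iter i _ _; case: i @a => [|i] a; first exact: (hP 0%N).2.
by rewrite /a iterS; apply: (hP _).2; apply: leq_trans (hP _).1;
  rewrite ltnW // ltnS; exact: (hP _).1.
Qed.

Lemma homo_ltn_nat (g : nat -> nat) : (forall i, (g i < g i.+1)%N) ->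
  {homo g : i j / (i < j)%N}.
Proof. by move=> gS; apply: homo_ltn => //; exact: ltn_trans. Qed.

(** Dickson's lemma: subsequences are refined one coordinate at a time until every coordinate is
    nondecreasing. *)
Lemma dickson n (u : nat -> 'X_{1..n}) :
  exists i j, (i < j)%N /\ (u i <= u j)%MM.
Proof.
suff H m : exists g : nat -> nat, (forall i, (g i < g i.+1)%N) /\
    forall (c : 'I_n) i, (c < m)%N -> (u (g i) c <= u (g i.+1) c)%N.
  have [g [gS gu]] := H n; exists (g 0%N), (g 1%N); split=> //.
  by apply/mnm_lepP => c; exact: gu.
elim: m => [|m [g [gS gu]]]; first by exists id.
have [mn|nm] := ltnP m n; last first.
  exists g; split=> // c i _; apply: gu.
  exact: leq_trans (ltn_ord c) nm.
have [h [hS hu]] := nondecreasing_subseq (fun i => u (g i) (Ordinal mn)).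
exists (g \o h); split=> [i|c i] /=; first exact: homo_ltn_nat.
rewrite ltnS leq_eqVlt => /orP[/eqP cm|cm].
  by have -> : c = Ordinal mn by apply: val_inj.
have mono : {homo (fun j => u (g j) c) : i j / (i <= j)%N}.
  by apply: homo_leq => // [|j]; [exact: leq_trans|exact: gu].
by apply: mono; exact: ltnW.
Qed.

Lemma ltm_minimal n (k : fieldType) (A : {mpoly k[n]} -> Prop) :
  (exists f, A f) -> exists2 f, A f & forall g, A g -> ~~ (mlead g < mlead f)%O.
Proof.
move=> [f Af]; move: {2}(mlead f) (erefl (mlead f)) => m.
elim/(well_founded_ind (@ltom_wf n)): m f Af => m IH f Af fm.
have [[g Ag gf]|no] := pselect (exists2 g, A g & (mlead g < mlead f)%O).
  by apply: (IH (mlead g)) (erefl _) => //; rewrite -fm.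
by exists f => // g Ag; apply/negP => gf; apply: no; exists g.
Qed.

Lemma mlead_reduce n (k : fieldType) (f g : {mpoly k[n]}) :
  f != 0 -> (mlead f <= mlead g)%MM ->
  let h := g - (mleadc g / mleadc f) *: 'X_[mlead g - mlead f] * f in
  h != 0 -> (mlead h < mlead g)%O.
Proof.
move=> f0 fg h h0; have lf0 : mleadc f != 0 by rewrite mleadc_eq0.
have le : (mlead h <= mlead g)%O.
  apply: le_trans (mleadB_le _ _) _; rewrite leUx lexx /=.
  apply: le_trans (mleadM_le _ _) _.
  rewrite -[leRHS](submK fg) lemc_add2l.
  by apply: le_trans (mleadZ_le _ _) _; rewrite mleadXm.
rewrite lt_neqAle le andbT; apply/eqP => hg.
have : h@_(mlead h) != 0 by rewrite mleadc_eq0.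
have E : ('X_[mlead g - mlead f] * f)@_(mlead g) = mleadc f.
  by rewrite mulrC -[X in _@_X](submK fg) mcoeffMX.
by rewrite hg /h mcoeffB -scalerAl mcoeffZ E divfK // subrr eqxx.
Qed.

(** In a strictly increasing sequence of ideals, let f_i have minimal leading monomial among the new
    elements at stage i. Dickson's lemma gives i < j with the leading monomial of f_i dividing that
    of f_j; reducing f_j by f_i yields a new element at stage j with a smaller one. *)
Theorem noetherian_mpoly (k : fieldType) n : noetherian_ring {mpoly k[n]}.
Proof.
move=> S [K0 SK0] Sid; apply: contrapT => nomax.
have /choice[next nextP] : forall K, exists K', S K -> S K' /\
    (sub_ideal K K' /\ exists f, K' f /\ ~ K f).
  move=> K; have [SK|] := pselect (S K); last by exists K.
  apply: contrapT => h; apply: nomax; exists K => // K' SK' KK' f K'f.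
  by apply: contrapT => Kf; apply: h; exists K' => _; split=> //; split=> //;
    exists f.
pose K_ i := iter i next K0.
have SK i : S (K_ i) by elim: i => //= i /nextP[].
have Kmono i j : (i <= j)%N -> sub_ideal (K_ i) (K_ j).
  elim: j => [|j IHj]; first by rewrite leqn0 => /eqP ->.
  rewrite leq_eqVlt => /orP[/eqP -> //|/IHj h f /h Kf].
  by have [_ [+ _]] := nextP _ (SK j); apply.
have /choice[f fP] : forall i, exists f, (K_ i.+1 f /\ ~ K_ i f) /\
    forall g, K_ i.+1 g /\ ~ K_ i g -> ~~ (mlead g < mlead f)%O.
  move=> i; have [_ [_ ex]] := nextP _ (SK i).
  by have [f Af fmin] := ltm_minimal ex; exists f.
have [i [j [ij uij]]] := dickson (fun i => mlead (f i)).
have [[fi nfi] _] := fP i; have [[fj nfj] fjmin] := fP j.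
have fi0 : f i != 0 by apply: contra_notN nfi => /eqP ->;
  exact: ideal0 (Sid _ (SK i)).
have := mlead_reduce fi0 uij; set h := _ - _ => /= hlt.
have Kji : K_ j (f i) by apply: Kmono fi.
have iKj := Sid _ (SK j); have iKj1 := Sid _ (SK j.+1).
have nh : ~ K_ j h.
  move=> Kh; apply: nfj;
    rewrite -(subrK ((mleadc (f j) / mleadc (f i)) *: 'X_[mlead (f j) - mlead (f
    i)] * f i) (f j)).
  by apply: idealD => //; exact: idealMl.
have hh : K_ j.+1 h by apply: idealB => //; apply: idealMl => //; exact: Kmono Kji.
have h0 : h != 0 by apply: contra_notN nh => /eqP ->; exact: ideal0.
by have /negP := fjmin h (conj hh nh); apply; exact: hlt.
Qed.

Variable R : comPzRingType.
Hypothesis noethR : noetherian_ring R.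
Implicit Types (K Q p : R -> Prop) (E : R -> Prop).

(** A maximal annihilator is prime. The set E of admissible elements is a parameter because
    annihilators of elements with additional properties are needed; it has to be stable under the
    multiples that stay outside K. *)
Lemma colon_prime K E : ideal K -> (exists f, E f) -> (forall f, E f -> ~ K f) ->
  (forall a f, E f -> ~ K (a * f) -> E (a * f)) ->
  exists2 f, E f & primep (colon K f).
Proof.
move=> iK [f0 Ef0] EK EM.
have [_ [f Ef ->] fmax] := noethR (S := fun C => exists2 f, E f & C = colon K f)
  (ex_intro _ _ (ex_intro2 _ _ f0 Ef0 erefl))
  ltac:(by move=> _ [f _ ->]; exact: colon_ideal).
exists f => //; split; first exact: colon_ideal.
  by rewrite /colon mul1r; exact: EK.
move=> a b abf; have [af|naf] := pselect (K (a * f)); [by left|right].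
have Eaf := EM _ _ Ef naf.
apply: (fmax _ (ex_intro2 _ _ _ Eaf erefl)); rewrite /colon.
  by move=> c cf; rewrite mulrCA; exact: idealMl.
by rewrite mulrA (mulrC b).
Qed.

(* By the ascending chain condition a single denominator suffices. *)
Lemma sat_colon Q K : primep Q -> ideal K ->
  exists2 u, ~ Q u & forall f, sat Q K f -> K (u * f).
Proof.
move=> pQ iK.
have [_ [u Qu ->] umax] := noethR (S := fun C => exists2 u, ~ Q u & C = colon K u)
  (ex_intro _ _ (ex_intro2 _ _ 1 (primep1 pQ) erefl))
  ltac:(by move=> _ [f _ ->]; exact: colon_ideal).
exists u => // f [v Qv Kvf]; rewrite mulrC.
apply: (umax (colon K (u * v))); rewrite /colon.
- by exists (u * v) => //; exact: primepNM.
- by move=> c cu; rewrite mulrA; exact: idealMr.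
- by rewrite mulrC -mulrA; exact: idealMl.
Qed.

End Noetherian.

(** * Associated primes and Koszul cocycles *)

Section AssociatedPrimes.
Variable R : comPzRingType.
Hypothesis noethR : noetherian_ring R.
Implicit Types (K P p : R -> Prop).

Definition assp K p : Prop := primep p /\ exists z, forall a, p a <-> K (a * z).

(** Among the elements killed by p take z with K + (z) maximal, locally at P. If z were in K + (a),
    it would be a z1 up to a unit, with z1 again killed by p because a is regular; maximality makes
    z1 a multiple of z, and Nakayama gives z = 0. So z survives modulo a. *)
Lemma assp_step P K p a : primep P -> ideal K -> sub_ideal (sat P K) K ->
    assp K p -> P a -> nzd_mod K a ->
  exists p', [/\ assp (sat P (adj K a)) p', sub_ideal p p', p' a, ~ p a &
    sub_ideal p' P].
Proof.
move=> pP iK satK [pp [z0 z0E]] Pa nza; set K' := sat P (adj K a).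
have iK' : ideal K' by apply: sat_ideal => //; exact: adj_ideal.
have KK' : sub_ideal K K'.
  by move=> f Kf; apply: sub_sat => //; exact: sub_adj.
have nK0 : ~ K z0 by move=> Kz; apply: (primep1 pp); apply/z0E; rewrite mul1r.
pose E z := ~ K z /\ forall c, p c -> K (c * z).
have Ez0 : E z0 by split=> // c /z0E.
have [_ [z [nKz pz] ->] zmax] := noethR
  (S := fun C => exists2 z, E z & C = sat P (adj K z))
  (ex_intro _ _ (ex_intro2 _ _ z0 Ez0 erefl))
  ltac:(by move=> _ [f _ ->]; apply: sat_ideal => //; exact: adj_ideal).
have adjP w f : sat P (adj K w) f -> exists u c, ~ P u /\ K (u * f - c * w).
  by case=> u Qu [c Kc]; exists u, c.
have nK'z : ~ K' z.
  move=> /adjP[u [z1 [Pu Kz1]]].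
  have Ez1 : E z1.
    split=> [Kz1'|c pc].
      apply: nKz; apply: satK; exists u => //; apply: (ideal_congr iK Kz1).
      exact: idealMr.
    apply: nza; have -> : a * (c * z1) = u * (c * z) - c * (u * z - z1 * a) by ring.
    by apply: idealB => //; apply: idealMl => //; exact: pz.
  have /adjP[u' [c [Pu' Kc]]] : sat P (adj K z) z1.
    apply: (zmax _ (ex_intro2 _ _ z1 Ez1 erefl)); last first.
      by exists 1; [exact: primep1|exists 1; rewrite !mul1r subrr; exact: ideal0].
    have Kz : sat P (adj K z1) z.
      exists u => //; exists a; apply: (ideal_congr iK _ Kz1).
      have -> : u * z - a * z1 - (u * z - z1 * a) = 0 by ring.
      exact: ideal0.
    move=> f [v Pv [d Kd]]; have [w [d' [Pw Kd']]] := adjP _ _ Kz.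
    exists (v * w); first exact: primepNM.
    exists (d * d'); have -> : v * w * f - d * d' * z1 =
      w * (v * f - d * z) + d * (w * z - d' * z1) by ring.
    by apply: idealD => //; exact: idealMl.
  (* Nakayama for one element: u u' - c a is outside P because a is inside. *)
  apply: nKz; apply: satK; exists (u * u' - c * a).
    move=> h; have : P (u * u').
      by apply: (ideal_congr (primep_ideal pP) h);
        exact: idealMl (primep_ideal pP) _ _ Pa.
    exact: primepNM.
  have -> : (u * u' - c * a) * z = u' * (u * z - z1 * a) + a * (u' * z1 - c * z)
    by ring.
  by apply: idealD => //; exact: idealMl.
(* The admissible elements are those outside K' that p multiplies into K', such as z; the resulting
   prime contains p by construction. *)
have [w [nKw pw] pw'] := colon_prime noethR
  (E := fun w => ~ K' w /\ forall c, p c -> K' (c * w)) iK'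
  (ex_intro _ z (conj nK'z (fun c pc => KK' _ (pz c pc))))
  ltac:(by move=> f [])
  ltac:(by move=> b f [_ pf] nKf; split=> // c pc; rewrite mulrCA;
    apply: idealMl => //; exact: pf).
exists (colon K' w); split=> //.
- by split=> //; exists w.
- by apply: sub_sat => //; rewrite mulrC; exact: adj_gen.
- by move/z0E/nza.
- move=> c cw; apply: contrapT => Pc; apply: nKw.
  by apply: sat_idem => //; exists c.
Qed.

Lemma chain_cons p p' P l a : primep p -> sub_ideal p P -> sub_ideal p p' ->
  p' a -> ~ p a -> chain p' P l -> chain p P l.+1.
Proof.
move=> pp pP pp' p'a npa [q [qp qs]].
exists (fun i => if i is i'.+1 then q i' else p); split=> [[|i]|[|i]] /=.
- by move=> _; split=> //; move=> f.
- by rewrite ltnS => /qp[? p'q ?]; split=> // f /pp'/p'q.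
- move=> _; have [_ p'q _] := qp 0%N isT; split=> [f /pp'/p'q //|].
  by exists a => //; exact: p'q.
- by rewrite ltnS => /qs.
Qed.

Lemma chain0 p P : primep p -> sub_ideal p P -> chain p P 0.
Proof. by move=> pp pP; exists (fun=> p); split=> // i _; split=> // f. Qed.

Lemma reg_from_chain P K p bs : primep P -> ideal K -> sub_ideal (sat P K) K ->
  assp K p -> sub_ideal p P -> reg_from P K bs -> chain p P (size bs).
Proof.
move=> pP; elim: bs K p => [|b bs IHbs] K p iK satK Kp subp /=.
  by move=> _; apply: chain0 => //; exact: Kp.1.
move=> [Pb nzb reg].
have [p' [Kp' pp' p'b npb p'P]] := assp_step pP iK satK Kp Pb nzb.
apply: (chain_cons (a := b) Kp.1 subp pp' p'b npb).
apply: IHbs reg => //; last by move=> f; exact: sat_idem.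
by apply: sat_ideal => //; exact: adj_ideal.
Qed.

(* Depth is at most the dimension of R / p for every associated prime p. *)
Lemma has_reg_chain I P p r : primep P -> ideal I -> assp (sat P I) p ->
  sub_ideal p P -> has_reg I P r -> chain p P r.
Proof.
move=> pP iI Ip pP' [bs [<- reg]]; apply: reg_from_chain reg => //.
  exact: sat_ideal.
by move=> f; exact: sat_idem.
Qed.

End AssociatedPrimes.

(* If P is generated by the x i, regular sequences on a module make the Koszul
   cohomology of x vanish: writing the first element as a combination of the x i
   and contracting a cocycle with it lowers the degree of the cocycle. *)
Section Koszul.
Variables (R : comPzRingType) (T : finType) (x : T -> R) (P : R -> Prop).
Hypotheses (noethR : noetherian_ring R) (pP : primep P).
Hypothesis Pgen : forall a, P a -> exists al : T -> R, a = \sum_i al i * x i.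
Implicit Type K : R -> Prop.

Lemma koszul0 K c z : ideal K -> P c -> nzd_mod K c ->
  (forall i, K (x i * z)) -> K z.
Proof.
move=> iK /Pgen[al ->] nzc Kz; apply: nzc; rewrite mulr_suml.
by apply: ideal_sumr => // i _; rewrite -mulrA; exact: idealMl.
Qed.

(** Contracting z with b = sum of al_i x_i gives w with x_j w = b z_j modulo K. So every x_j kills w
    modulo b; [koszul0] turns this into w = t b up to a unit, and cancelling b gives z_j = x_j t. *)
Lemma koszul1 K b c z : ideal K -> reg_from P K [:: b; c] ->
  (forall i j, K (x i * z j - x j * z i)) ->
  exists u t, ~ P u /\ forall j, K (u * z j - x j * t).
Proof.
move=> iK /= [Pb nzb [Pc nzc _]] Kz; have [al bE] := Pgen Pb.
pose w := \sum_i al i * z i.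
have iK' : ideal (sat P (adj K b)) by apply: sat_ideal => //; exact: adj_ideal.
have wE j : K (x j * w - z j * b).
  rewrite bE /w !mulr_sumr -sumrB; apply: ideal_sumr => // i _.
  have -> : x j * (al i * z i) - z j * (al i * x i) = - al i * (x i * z j - x j
    * z i) by ring.
  exact: idealMl.
have [u Pu [t Kt]] : sat P (adj K b) w.
  apply: koszul0 nzc _ => // j; apply: sub_sat => //; exists (z j); exact: wE.
exists u, t; split=> // j; apply: nzb.
have -> : b * (u * z j - x j * t) = x j * (u * w - t * b) - u * (x j * w - z j *
  b) by ring.
by apply: idealB => //; exact: idealMl.
Qed.

Lemma koszul2 K a b c m : ideal K -> reg_from P K [:: a; b; c] ->
  (forall i j, m i j = - m j i) ->
  (forall i j l, K (x i * m j l + x j * m l i + x l * m i j)) ->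
  exists u n, ~ P u /\ forall j l, K (u * m j l - (x j * n l - x l * n j)).
Proof.
move=> iK reg mN Km; have /= [Pa nza reg'] := reg.
have [al aE] := Pgen Pa.
pose w j := \sum_i al i * m i j.
have iaK := adj_ideal a iK.
have iK' : ideal (sat P (adj K a)) by exact: sat_ideal.
have wE j l : K (x l * w j - x j * w l + m j l * a).
  rewrite aE /w !mulr_sumr -sumrB -big_split; apply: ideal_sumr => // i _ /=.
  have -> : x l * (al i * m i j) - x j * (al i * m i l) + m j l * (al i * x i) =
     al i * (x i * m j l + x j * m l i + x l * m i j).
    by rewrite (mN l i); ring.
  exact: idealMl.
have w1 i j : sat P (adj K a) (x i * w j - x j * w i).
  by apply: sub_sat => //; exists (- m j i); rewrite mulNr opprK; exact: wE.
have [u [t [Pu Kt]]] := koszul1 iK' reg' w1.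
(* A common denominator v for the whole saturation allows the n j to be chosen with one
   multiplier. *)
have [v Pv Kv] := sat_colon noethR pP iaK.
have /choice[n nP] : forall j, exists n, K (v * (u * w j - x j * t) - n * a).
  by move=> j; exact: Kv.
exists (v * u), n; split; first exact: primepNM.
move=> j l; apply: nza.
have -> : a * (v * u * m j l - (x j * n l - x l * n j)) =
  v * u * (x l * w j - x j * w l + m j l * a)
  - x l * (v * (u * w j - x j * t) - n j * a)
  + x j * (v * (u * w l - x l * t) - n l * a) by ring.
apply: idealD => //; last exact: idealMl.
by apply: idealB => //; exact: idealMl.
Qed.

End Koszul.

(** * Primes and ideals of faces *)

Section MonomialPrimes.
Variables (k : fieldType) (n : nat).
Implicit Types (F G T : {set 'I_n}) (f g : {mpoly k[n]}) (m : 'X_{1..n}).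
Implicit Types (Q : {mpoly k[n]} -> Prop).

Definition rho F : {mpoly k[n]} -> {mpoly k[n]} :=
  comp_mpoly [tuple (if i \in F then 'X_i else 0 : {mpoly k[n]}) | i < n].

HB.instance Definition _ F := GRing.RMorphism.on (rho F).

Definition msupport m : {set 'I_n} := [set i | m i != 0%N].

Lemma rhoX F i : rho F 'X_i = if i \in F then 'X_i else 0.
Proof. by rewrite /rho comp_mpolyXU (nth_map i) ?size_enum_ord // nth_ord_enum. Qed.

Lemma rhoC F c : rho F c%:MP = c%:MP.
Proof. exact: comp_mpolyC. Qed.

Lemma rhoZ F c f : rho F (c *: f) = c *: rho F f.
Proof. exact: comp_mpolyZ. Qed.

Lemma rho_mono F m : rho F 'X_[m] = if msupport m \subset F then 'X_[m] else 0.
Proof.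
rewrite {1}mpolyXE_id rmorph_prod; case: ifPn => [/fintype.subsetP mF|/subsetPn[i]].
  rewrite [RHS]mpolyXE_id; apply: eq_bigr => i _; rewrite rmorphXn /= rhoX.
  case: ifPn => // iF; suff -> : m i = 0%N by rewrite !expr0.
  by apply/eqP; apply: contraNT iF => mi; apply: mF; rewrite inE.
rewrite inE => mi iF; rewrite (bigD1 i) //= rmorphXn /= rhoX (negbTE iF).
by rewrite expr0n (negbTE mi) mul0r.
Qed.

Lemma mcoeff_rho F f m : (rho F f)@_m = if msupport m \subset F then f@_m else 0.
Proof.
rewrite {1}[f]mpolyE rmorph_sum raddf_sum /=.
transitivity (\sum_(m' <- msupp f) (if msupport m \subset F then f@_m' *:
  'X_[m'] else 0)@_m).
  apply: eq_bigr => m' _; rewrite rhoZ rho_mono.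
  have [->//|m'm] := eqVneq m' m; first by case: ifP; rewrite ?scaler0.
  do 2 case: ifP => _; rewrite ?scaler0 ?mcoeffZ ?mcoeff0 ?mcoeffX ?(negbTE m'm)
    ?mulr0 //.
case: ifP => _; last by rewrite big1 // => *; rewrite mcoeff0.
by rewrite -raddf_sum -mpolyE.
Qed.

Lemma rho_rho F G f : rho F (rho G f) = rho (F :&: G) f.
Proof.
apply/mpolyP => m; rewrite !mcoeff_rho finset.subsetI.
by case: (msupport m \subset F).
Qed.

(** The prime generated by the variables outside F. As the kernel of a substitution into a domain it
    is visibly prime, and membership is read off from coefficients. *)
Definition face_prime F f : Prop := rho F f = 0.

Lemma face_primeP F f : face_prime F f <-> forall m, msupport m \subset F ->
  f@_m = 0.
Proof.
split=> [fF m mF|h]; first by have := mcoeff_rho F f m; rewrite fF mcoeff0 mF.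
by apply/mpolyP => m; rewrite mcoeff_rho mcoeff0; case: ifP => // /h.
Qed.

Lemma face_prime_primep F : primep (face_prime F).
Proof.
rewrite /face_prime; split=> [||f g]; last first.
- by rewrite rmorphM /= => /eqP; rewrite mulf_eq0 => /orP[]/eqP; [left|right].
- by rewrite rmorph1 => /eqP; rewrite oner_eq0.
split=> [|f g Ff Fg|f g Fg]; first by rewrite rmorph0.
  by rewrite rmorphD /= Ff Fg addr0.
by rewrite rmorphM /= Fg mulr0.
Qed.

Lemma face_prime_ideal F : ideal (face_prime F).
Proof. exact: primep_ideal (face_prime_primep F). Qed.

Lemma face_prime_sub F G : F \subset G -> sub_ideal (face_prime G) (face_prime F).
Proof.
move=> FG f Gf; rewrite /face_prime.
by have <- := finset.setIidPl FG; rewrite -rho_rho Gf rmorph0.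
Qed.

Lemma mpolyX_neq0 i : ('X_i : {mpoly k[n]}) != 0.
Proof. by apply/eqP => /(congr1 (mcoeff U_(i))) /eqP;
  rewrite mcoeffXU eqxx mcoeff0 oner_eq0. Qed.

Lemma face_primeX F i : face_prime F 'X_i <-> i \notin F.
Proof.
rewrite /face_prime rhoX; case: ifP => // iF; split=> // /eqP.
by rewrite (negbTE (mpolyX_neq0 i)).
Qed.

Lemma sub_rho F f : face_prime F (f - rho F f).
Proof. by rewrite /face_prime rmorphB /= rho_rho finset.setIid subrr. Qed.

(** Every monomial of the difference involves a variable outside F. Hence an ideal containing these
    variables contains the kernel of [rho F]. *)
Lemma ideal_sub_rho Q F f : ideal Q -> (forall i, i \notin F -> Q 'X_i) ->
  Q (f - rho F f).
Proof.
move=> iQ QX; rewrite {1 2}[f]mpolyE rmorph_sum /= -sumrB.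
apply: ideal_sumr => // m _; rewrite rhoZ -scalerBr -mul_mpolyC.
apply: idealMl => //; rewrite rho_mono; case: ifPn => [_|/subsetPn[i]].
  by rewrite subrr; exact: ideal0.
rewrite inE subr0 => mi iF.
have /submK <- : (U_(i) <= m)%MM by rewrite lep1mP.
by rewrite mpolyXD; apply: idealMl => //; exact: QX.
Qed.

(** The variables that are units at Q. By [face_prime_alive], only the faces containing this set are
    visible near Q. *)
Definition alive Q : {set 'I_n} := [set i | `[< ~ Q 'X_i >]].

Lemma aliveP Q i : i \in alive Q <-> ~ Q 'X_i.
Proof. by rewrite inE; split=> /asboolP. Qed.

Lemma notin_alive Q i : i \notin alive Q -> Q 'X_i.
Proof. by move=> iQ; apply: contrapT => /aliveP; exact/negP. Qed.

Lemma face_prime_alive Q F : ideal Q ->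
  sub_ideal (face_prime F) Q <-> alive Q \subset F.
Proof.
move=> iQ; split=> [FQ|/fintype.subsetP QF f fF].
  apply/fintype.subsetP => i /aliveP Qi; apply: contrapT => /negP iF.
  by apply: Qi; apply: FQ; apply/face_primeX.
rewrite -(subr0 f) -fF; apply: ideal_sub_rho => // i iF.
by apply: notin_alive; apply: contra iF => /QF.
Qed.

Lemma alive_face_prime F : alive (face_prime F) = F.
Proof.
apply/setP => i; apply/idP/idP => [/aliveP h|iF].
  by apply: contrapT => /negP /face_primeX.
by apply/aliveP => /face_primeX; rewrite iF.
Qed.

Lemma alive_sub P Q : sub_ideal Q P -> alive P \subset alive Q.
Proof. by move=> QP; apply/fintype.subsetP => i /aliveP h; apply/aliveP => /QP. Qed.

Local Notation sqf := (squarefree_monomial k).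

Lemma sqf_alive Q : primep Q -> ~ Q (sqf (alive Q)).
Proof. by move=> pQ; apply: primep_prod => // i /aliveP. Qed.

Lemma face_prime_sqf F G : ~~ (G \subset F) -> face_prime F (sqf G).
Proof.
case/subsetPn => i iG iF; rewrite /squarefree_monomial (bigD1 i) //=.
by apply: (idealMr (face_prime_ideal F)); apply/face_primeX.
Qed.

Lemma face_prime_sqfN F : ~ face_prime F (sqf F).
Proof.
by have := sqf_alive (face_prime_primep F); rewrite alive_face_prime.
Qed.

Lemma face_prime_sum_neq0 F (P : pred 'I_n) j : j \in F -> P j ->
  ~ face_prime F (\sum_(i | P i) 'X_i).
Proof.
move=> jF Pj /face_primeP/(_ U_(j)%MM) h; have : (1 : k) = 0.
  rewrite -[RHS]h; last first.
    by apply/fintype.subsetP => i; rewrite !inE mnm1E; have [<-|] := eqVneq j i.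
  rewrite raddf_sum (bigD1 j) //= mcoeffXU eqxx big1 ?addr0 // => i /andP[_ ij].
  by rewrite mcoeffXU (negbTE ij).
by move/eqP; rewrite oner_eq0.
Qed.

Definition faces_ideal (S : {set {set 'I_n}}) f : Prop :=
  forall F, F \in S -> face_prime F f.

Lemma faces_ideal_ideal S : ideal (faces_ideal S).
Proof.
split=> [F _|f g Sf Sg F FS|f g Sg F FS].
- exact: ideal0 (face_prime_ideal F).
- by apply: (idealD (face_prime_ideal F)); [exact: Sf|exact: Sg].
- by apply: (idealMl (face_prime_ideal F)); exact: Sg.
Qed.

(** The product of the alive variables is outside Q, but it vanishes on every face that does not
    contain [alive Q]. *)
Lemma faces_ideal_alive S Q : primep Q -> sub_ideal (faces_ideal S) Q ->
  exists2 F, F \in S & alive Q \subset F.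
Proof.
move=> pQ SQ; apply: contrapT => h; apply: (sqf_alive pQ); apply: SQ => F FS.
by apply: face_prime_sqf; apply/negP => QF; apply: h; exists F.
Qed.

Lemma faces_ideal_sat (S : {set {set 'I_n}}) Q f :
  (forall F, F \in S -> alive Q \subset F -> face_prime F f) ->
  faces_ideal S (sqf (alive Q) * f).
Proof.
move=> h F FS; have [QF|QF] := boolP (alive Q \subset F).
  by apply: (idealMl (face_prime_ideal F)); exact: h.
by apply: (idealMr (face_prime_ideal F)); exact: face_prime_sqf.
Qed.

(** If f vanishes on all faces, each monomial of f has a nonface as its support, since on a face its
    coefficient would be visible. Sorting f by supports writes it in the generators. *)
Lemma SR_idealP (D : simplicial_complex n) f :
  f \in @SR_ideal k n D <-> faces_ideal D f.
Proof.
split=> [/asboolP[c ->] F FD|Df].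
  apply: ideal_sumr => [|G GD]; first exact: face_prime_ideal.
  apply: (idealMl (face_prime_ideal F)); apply: face_prime_sqf.
  by apply: contra GD => /(face_sub FD).
have mD m : m \in msupp f -> msupport m \notin (D : {set {set 'I_n}}).
  rewrite mcoeff_msupp; apply: contra => mD.
  by have /face_primeP/(_ m (subxx _))-> := Df _ mD.
pose one F : 'X_{1..n} := [multinom (i \in F : nat) | i < n].
have sqfE F : sqf F = 'X_[one F].
  rewrite mpolyXE_id /squarefree_monomial big_mkcond; apply: eq_bigr => i _.
  by rewrite mnmE; case: (i \in F).
apply/asboolP; exists (fun F => \sum_(m <- msupp f | msupport m == F)
  f@_m *: 'X_[(m - one F)]).
rewrite {1}[f]mpolyE big_seq.
rewrite (partition_big msupport (fun F => F \notin (D : {set {set 'I_n}})));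
  last exact: mD.
apply: eq_bigr => F _; rewrite mulr_suml big_seq_cond [RHS]big_seq_cond /=.
apply: eq_big => m; first by rewrite andbA andbb.
move=> /and3P[_ _ /eqP mF]; rewrite sqfE -scalerAl -mpolyXD submK //.
apply/mnm_lepP => i; by rewrite mnmE -mF inE; case: (m i).
Qed.

End MonomialPrimes.

(** * Dimension of polynomial rings *)

Section Dimension.
Variables (k : fieldType) (n : nat).
Implicit Types (F G T : {set 'I_n}) (f g : {mpoly k[n]}) (m : 'X_{1..n}).

Lemma msizeM_leS f g a b : (msize f <= a.+1)%N -> (msize g <= b.+1)%N ->
  (msize (f * g) <= (a + b).+1)%N.
Proof.
have [->|f0] := eqVneq f 0; first by rewrite mul0r msize0.
have [->|g0] := eqVneq g 0; first by rewrite mulr0 msize0.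
move=> fa gb; rewrite msizeM //;
  move: (mmeasure _ f) (mmeasure _ g) fa gb => x y; lia.
Qed.

Lemma msizeX_leS f a e : (msize f <= a.+1)%N -> (msize (f ^+ e) <= (e * a).+1)%N.
Proof.
move=> fa; elim: e => [|e IHe]; first by rewrite expr0 msize1.
by rewrite exprS mulSn; exact: msizeM_leS.
Qed.

Lemma msize_prod_leS (I : finType) (f : I -> {mpoly k[n]}) (d : I -> nat) a :
  (forall i, (msize (f i) <= a.+1)%N) ->
  (msize (\prod_i f i ^+ d i) <= (\sum_i d i * a).+1)%N.
Proof.
move=> fa; elim/big_rec2: _ => [|i p g _]; first by rewrite msize1.
by move=> gp; apply: msizeM_leS => //; exact: msizeX_leS.
Qed.

Lemma row_kernel (m1 m2 : nat) (A : 'M[k]_(m1, m2)) : (m2 < m1)%N ->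
  exists2 v : 'rV_m1, v != 0 & v *m A = 0.
Proof.
move=> m21; exists (nz_row (kermx A)).
  rewrite nz_row_eq0 -mxrank_eq0 mxrank_ker -lt0n subn_gt0.
  exact: leq_ltn_trans (rank_leq_col A) m21.
by apply/sub_kermxP; exact: nz_row_sub.
Qed.

(** On the left, monomials in r variables with exponents up to a degree bound; on the right,
    products of r + 1 polynomials with exponents at most N. *)
Lemma count_exponents r D : exists N, (((r.+1 * (N * D)).+1) ^ r < N.+1 ^ r.+1)%N.
Proof.
(* For N = C^r the bound (C (N + 1))^r equals N (N + 1)^r. *)
pose C := (r.+1 * D).+1; exists (C ^ r)%N; set N := (C ^ r)%N.
have le : (((r.+1 * (N * D)).+1) ^ r <= (C * N.+1) ^ r)%N.
  case: r @C @N => [|r] C N; first by rewrite !expn0.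
  by rewrite leq_exp2r // /C; nia.
apply: leq_ltn_trans le _; rewrite expnMn expnS -/N ltn_pmul2r //.
by rewrite expn_gt0.
Qed.

(** By [count_exponents] there are more products than monomials on F that can occur in them, so the
    coefficient vectors modulo the prime of F are linearly dependent. *)
Lemma algebraic_dependence F (a : 'I_#|F|.+1 -> {mpoly k[n]}) :
  exists N (phi : {ffun 'I_#|F|.+1 -> 'I_N.+1} -> k),
    (exists e, phi e != 0) /\
    face_prime F (\sum_e phi e *: \prod_j a j ^+ e j).
Proof.
pose D := (\max_j msize (a j))%N.
have aD j : (msize (a j) <= D.+1)%N.
  by apply: leq_trans (leqnSn _); exact: (leq_bigmax (F := fun j => msize (a j))).
have [N hN] := count_exponents #|F| D; exists N.
set B := (#|F|.+1 * (N * D)).+1 in hN.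
pose E := {ffun 'I_#|F|.+1 -> 'I_N.+1}.
pose C := {ffun {i | i \in F} -> 'I_B}.
pose mono (h : C) : 'X_{1..n} :=
  [multinom (if insub i is Some i' then val (h i') else 0%N) | i < n].
pose mon (e : E) := \prod_j a j ^+ e j.
have sz (e : E) : (msize (mon e) <= B)%N.
  apply: leq_trans (msize_prod_leS (fun j => e j : nat) aD) _; rewrite ltnS.
  apply: leq_trans (_ : \sum_(j < #|F|.+1) N * D <= _)%N.
    by apply: leq_sum => j _; rewrite leq_mul2r -ltnS ltn_ord orbT.
  by rewrite sum_nat_const card_ord.
have cards : (#|C| < #|E|)%N.
  by rewrite !card_ffun !card_ord card_sig.
have [v v0 vA] := row_kernel (\matrix_(i < #|E|, j < #|C|)
  (rho F (mon (enum_val i)))@_(mono (enum_val j))) cards.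
exists (fun e => v 0 (enum_rank e)); split.
  have [j vj] : exists j, v 0 j != 0.
    by apply/existsP; apply: contraNT v0 => /existsPn h; apply/eqP/rowP => j;
      rewrite mxE; apply/eqP; move: (h j); rewrite negbK.
  by exists (enum_val j); rewrite enum_valK.
apply/face_primeP => m mF; rewrite raddf_sum /=.
have [mB|mB] := leqP B (mdeg m).
  rewrite big1 // => e _; rewrite mcoeffZ memN_msupp_eq0 ?mulr0 //.
  by apply: msize_mdeg_ge; exact: leq_trans (sz e) mB.
have miB i : (m i < B)%N.
  by apply: leq_ltn_trans mB; rewrite mdegE (bigD1 i) //= leq_addr.
pose h : C := [ffun i => Ordinal (miB (val i))].
have mE : m = mono h.
  apply/mnmP => i; rewrite mnmE; case: insubP => [i' _ <-|iF];
    first by rewrite /h ffunE.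
  apply/eqP; apply: contraNT iF => mi; apply: (fintype.subsetP mF); by rewrite inE.
have := congr1 (fun w : 'rV_ _ => w 0 (enum_rank h)) vA; rewrite !mxE => E0;
  rewrite -[RHS]E0.
rewrite (reindex (fun i : 'I_#|E| => enum_val i : E)) /=; last first.
  by exists enum_rank => ? _; rewrite ?enum_valK ?enum_rankK.
apply: eq_bigr => i _; rewrite !mxE enum_valK enum_rankK mcoeffZ -mE.
by rewrite mcoeff_rho mF.
Qed.

Variables (q : nat -> {mpoly k[n]} -> Prop) (F : {set 'I_n}).
Hypothesis qP : forall i, (i <= #|F|)%N -> primep (q i).
Hypothesis q_sub : forall i, (i < #|F|)%N -> sub_ideal (q i) (q i.+1).
Hypothesis q0 : sub_ideal (face_prime F) (q 0%N).

(** The relation is carried up the chain. Modulo q_i the least power of a_i divides out, as a_i is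
    outside q_i; modulo q_{i+1} only the terms with this least exponent remain. Their exponents
    agree in all treated places, so no two terms merge. *)
Lemma eliminate (N : nat) (a : 'I_#|F|.+1 -> {mpoly k[n]})
    (phi : {ffun 'I_#|F|.+1 -> 'I_N.+1} -> k) :
  (exists e, phi e != 0) -> face_prime F (\sum_e phi e *: \prod_j a j ^+ e j) ->
  (forall i : 'I_#|F|.+1, (i < #|F|)%N -> q i.+1 (a i) /\ ~ q i (a i)) ->
  forall i, (i <= #|F|)%N -> exists psi : {ffun 'I_#|F|.+1 -> 'I_N.+1} -> k,
    [/\ exists e, psi e != 0,
        forall e e' : {ffun 'I_#|F|.+1 -> 'I_N.+1}, psi e != 0 -> psi e' != 0 ->
          forall j : 'I_#|F|.+1, (j < i)%N -> e j = e' j &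
        q i (\sum_e psi e *: \prod_(j : 'I_#|F|.+1 | (i <= j)%N) a j ^+ e j)].
Proof.
move=> phi0 phiF aq; elim=> [|i IHi] iF; first by exists phi; split=> //; exact: q0.
have [psi [[e1 psi1] psiE qpsi]] := IHi (ltnW iF).
pose i0 := Ordinal (leqW iF : (i < #|F|.+1)%N).
have [qa nqa] := aq i0 iF.
case: (arg_minnP (fun e : {ffun 'I_#|F|.+1 -> 'I_N.+1} =>
  e i0 : nat) (P := fun e => psi e != 0) psi1) => e0 psi0 e0min.
have pi := qP (ltnW iF); have pi1 := qP iF; have ii := primep_ideal pi1.
exists (fun e : {ffun 'I_#|F|.+1 -> 'I_N.+1} =>
  if e i0 == e0 i0 then psi e else 0); split.
- by exists e0; rewrite eqxx.
- move=> e e'; case: ifP => [/eqP ee0 psie|_]; last by rewrite eqxx.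
  case: ifP => [/eqP e'e0 psie'|_]; last by rewrite eqxx.
  move=> j; rewrite ltnS leq_eqVlt => /orP[/eqP ji|ji]; last exact: psiE.
  by have -> : j = i0 by [exact: val_inj]; rewrite ee0 e'e0.
move: qpsi.
have -> : \sum_e psi e *: \prod_(j : 'I_#|F|.+1 | (i <= j)%N) a j ^+ e j =
    a i0 ^+ e0 i0 * \sum_e psi e *: (a i0 ^+ (e i0 - e0 i0) *
      \prod_(j : 'I_#|F|.+1 | (i.+1 <= j)%N) a j ^+ e j).
  rewrite mulr_sumr; apply: eq_bigr => e _.
  have [->|psie] := eqVneq (psi e) 0; first by rewrite !scale0r mulr0.
  rewrite -scalerAr mulrA -exprD subnKC; last exact: e0min.
  congr (_ *: _); rewrite (bigD1 i0) //=; congr (_ * _); apply: eq_bigl => j.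
  by rewrite ltn_neqAle eq_sym andbC.
move=> /(primepM pi)[/(primepX pi nqa)//|/(q_sub iF) qs].
apply: (ideal_congr ii _ qs); rewrite -sumrB; apply: ideal_sumr => // e _.
have [ee0|ee0] := eqVneq (e i0) (e0 i0).
  by rewrite ee0 subnn expr0 mul1r subrr; exact: ideal0.
rewrite scale0r sub0r; apply: (idealN ii); have [->|psie] := eqVneq (psi e) 0.
  by rewrite scale0r; exact: ideal0.
rewrite -mul_mpolyC; apply: idealMl => //; apply: idealMr => //.
have : (0 < e i0 - e0 i0)%N.
  by rewrite subn_gt0 ltn_neqAle eq_sym e0min // andbT.
by case: (e i0 - e0 i0)%N => // d _; rewrite exprS; exact: idealMr.
Qed.

(* R / q_r is algebraic over k. *)
Lemma algebraic_over_chain (c : {mpoly k[n]}) :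
  (forall i, (i < #|F|)%N -> exists2 a, q i.+1 a & ~ q i a) ->
  exists2 g : {poly k}, g != 0 & q #|F| (map_poly (@mpolyC n k) g).[c].
Proof.
move=> q_strict.
have /choice[a aP] : forall i, exists a, (i < #|F|)%N -> q i.+1 a /\ ~ q i a.
  move=> i; have [iF|_] := boolP (i < #|F|)%N; last by exists 0.
  by have [a ? ?] := q_strict i iF; exists a.
(* One element for each strict inclusion, and c in the last place: after the elimination the
   relation is a polynomial in c alone. *)
pose b (i : 'I_#|F|.+1) := if (i < #|F|)%N then a i else c.
have [N [phi [phi0 phiF]]] := algebraic_dependence b.
have [i iF|psi [[e0 psi0] psiE qpsi]] := eliminate phi0 phiF _ (leqnn _).
  by rewrite /b iF; exact: aP.
have psiI e : psi e != 0 -> e ord_max = e0 ord_max -> e = e0.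
  move=> psie ee0; apply/ffunP => j; have [jF|jF] := ltnP j #|F|.
    exact: psiE.
  by have -> : j = ord_max by apply/val_inj/eqP; rewrite eqn_leq jF -ltnS ltn_ord.
exists (\sum_e psi e *: 'X^(e ord_max)).
  apply: contra_neq psi0 => /(congr1 (fun p : {poly k} => p`_(e0 ord_max))).
  rewrite coef0 coef_sum (bigD1 e0) //= coefZ coefXn eqxx mulr1 big1 ?addr0 //
    => e ee0.
  rewrite coefZ coefXn; have [->|psie] := eqVneq (psi e) 0; first by rewrite mul0r.
  case: eqP => [/val_inj/esym/(psiI _ psie)|]; last by rewrite mulr0.
  by move/eqP; rewrite (negbTE ee0).
rewrite rmorph_sum horner_sum /=; move: qpsi; congr (q _ _).
apply: eq_bigr => e _; rewrite map_polyZ map_polyXn hornerZ hornerXn.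
rewrite (big_pred1 ord_max) => [|j]; last first.
  by rewrite [RHS]eqn_leq -(ltnS j) ltn_ord.
by rewrite /b /= ltnn mul_mpolyC.
Qed.

End Dimension.

Section DimensionBound.
Variables (k : fieldType) (n : nat).

Lemma chain_algebraic (F : {set 'I_n}) Q (q : nat -> {mpoly k[n]} -> Prop) r c :
  (forall i, (i <= r)%N ->
     [/\ primep (q i), sub_ideal (face_prime F) (q i) & sub_ideal (q i) Q]) ->
  (forall i, (i < r)%N -> sub_ideal (q i) (q i.+1) /\ exists2 a, q i.+1 a & ~ q
    i a) ->
  (#|F| <= r)%N ->
  exists2 g : {poly k}, g != 0 & q #|F| (map_poly (@mpolyC n k) g).[c].
Proof.
move=> qP qS Fr; apply: algebraic_over_chain => [i iF|i iF||i iF].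
- by have [] := qP i (leq_trans iF Fr).
- by have [] := qS i (leq_trans iF Fr).
- by have [] := qP 0%N isT.
- by have [] := qS i (leq_trans iF Fr).
Qed.

(** In a longer chain take c in q_{r+1} outside q_r, where r is the size of F. It satisfies g(c) in
    q_r for some nonzero g; the constant term of g lies in q_{r+1}, so it is 0, and g can be divided
    by the variable again and again. *)
Lemma chain_face_prime_le (F : {set 'I_n}) (Q : {mpoly k[n]} -> Prop) l :
  chain (face_prime F) Q l -> (l <= #|F|)%N.
Proof.
move=> [q [qP qS]]; rewrite leqNgt; apply/negP => Fl.
have [_ [c qc nqc]] := qS _ Fl.
have [g g0] := chain_algebraic c qP qS (ltnW Fl).
have [pF _ _] := qP _ (ltnW Fl); have [pF1 _ _] := qP _ Fl.
have [subF _] := qS _ Fl; move: g0; elim/poly_ind: g => [|g a IHg];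
  first by rewrite eqxx.
move=> g0; rewrite rmorphD rmorphM /= map_polyX map_polyC /= hornerMXaddC => qg.
have a0 : a = 0.
  apply: contrapT => /eqP a0; apply: (primep1 pF1).
  have -> : 1 = a^-1%:MP * a%:MP :> {mpoly k[n]} by rewrite -mpolyCM mulVf.
  have i1 := primep_ideal pF1; apply: (idealMl i1).
  have := subF _ qg; move/(ideal_congr i1 (a := a%:MP)); apply.
  by rewrite opprD addrCA subrr addr0; apply: (idealN i1); exact: idealMl.
move: qg g0; rewrite a0 mpolyC0 addr0 => /(primepM pF)[qg|//] g0.
apply: IHg qg; apply: contra_neq g0 => ->; by rewrite mul0r add0r.
Qed.

End DimensionBound.

(** * Transport of chains of primes *)

Section PrimeIdealOfPredicate.
Variables (R : comPzRingType) (q : R -> Prop).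
Hypothesis pq : primep q.

Definition prime_pred : {pred R^o} := fun x => `[< q x >].

Lemma prime_pred_closed : submod_closed prime_pred.
Proof.
have iq := primep_ideal pq.
split=> [|a x y /asboolP qx /asboolP qy]; apply/asboolP; first exact: ideal0.
by apply: idealD => //; exact: idealMl.
Qed.

HB.instance Definition _ := GRing.isSubmodClosed.Build R R^o
  prime_pred prime_pred_closed.

Lemma prime_pred1 : 1 \notin prime_pred.
Proof. by apply/negP => /asboolP; exact: primep1. Qed.

Lemma prime_predM (a b : R) : a * b \in prime_pred ->
  a \in prime_pred \/ b \in prime_pred.
Proof. by move=> /asboolP/(primepM pq)[]; [left|right]; apply/asboolP. Qed.

Definition prime_of : prime_ideal R :=
  PrimeIdeal (prime_ideal_submod := prime_pred) prime_pred1 prime_predM.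

Lemma prime_ofE a : a \in prime_of <-> q a.
Proof. by split=> /asboolP. Qed.

End PrimeIdealOfPredicate.

Lemma prime_ideal_primep (R : comPzRingType) (p : prime_ideal R) :
  primep (fun a => a \in p).
Proof.
split=> [||a b]; last exact: prime_idealM; last exact/negP/prime_ideal1.
split=> [|a b pa pb|a b pb].
- exact: (rpred0 (prime_ideal_submod p)).
- exact: (rpredD (S := prime_ideal_submod p)).
- exact: (rpredZ (s := prime_ideal_submod p)).
Qed.

Section ChainTransport.
Variables (k : fieldType) (n : nat).
Local Notation R := {mpoly k[n]}.

Lemma mpoly_morph_eq (S : comPzRingType) (u v : {rmorphism R -> S}) :
  (forall c, u c%:MP = v c%:MP) -> (forall i, u 'X_i = v 'X_i) -> u =1 v.
Proof.
move=> uvC uvX f; rewrite [f]mpolyE !rmorph_sum; apply: eq_bigr => m _.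
rewrite -mul_mpolyC !rmorphM uvC mpolyXE_id !rmorph_prod; congr (_ * _).
by apply: eq_bigr => i _; rewrite !rmorphXn uvX.
Qed.

Lemma comp_mpoly_var (h : 'I_n -> R) i : 'X_i \mPo [tuple h i | i < n] = h i.
Proof. by rewrite comp_mpolyXU (nth_map i) ?size_enum_ord // nth_ord_enum. Qed.

Variables (F G : {set 'I_n}).
Hypothesis GF : (#|G| <= #|F|)%N.

Definition face_map (A B : {set 'I_n}) (i : 'I_n) : R :=
  if (i \in A) && (index i (enum A) < #|B|)%N
  then 'X_(nth i (enum B) (index i (enum A))) else 0.

Definition face_subst A B : R -> R := comp_mpoly [tuple face_map A B i | i < n].

HB.instance Definition _ A B := GRing.RMorphism.on (face_subst A B).

Lemma face_subst_rho f : face_subst F G (face_subst G F f) = rho G f.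
Proof.
pose u : {rmorphism R -> R} := face_subst F G \o face_subst G F.
pose v : {rmorphism R -> R} := rho G.
apply: (mpoly_morph_eq (u := u) (v := v)) => [c|i].
  by rewrite /u/= /v/= rhoC /face_subst !comp_mpolyC.
rewrite /u/= /v/= rhoX {2}/face_subst comp_mpoly_var {1}/face_map.
case: ifP => [/andP[iG iF]|]; last first.
  case: (boolP (i \in G)) => [iG|]; last by rewrite rmorph0.
  move/negbT; rewrite -leqNgt => h; exfalso; move: h; apply/negP; rewrite -ltnNge.
  by apply: leq_trans GF; rewrite cardE index_mem mem_enum.
rewrite iG /face_subst comp_mpoly_var /face_map.
have iF' : (index i (enum G) < size (enum F))%N by rewrite -cardE.
rewrite -mem_enum mem_nth // index_uniq ?enum_uniq //=.
by rewrite cardE index_mem mem_enum iG nth_index // mem_enum.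
Qed.

(** As G is not larger than F, renaming variables makes k[G] a quotient of k[F], and primes are
    pulled back along it. *)
Lemma chain_transport Q l : chain (face_prime G : R -> Prop) Q l ->
  chain (face_prime F : R -> Prop) (fun=> True) l.
Proof.
move=> [q [qp qs]]; exists (fun i f => q i (face_subst F G f)); split=> [i il|i il].
  have [pq Gq _] := qp i il; have iq := primep_ideal pq; split=> //.
    split=> [||a b]; last by rewrite rmorphM; exact: primepM.
      split=> [|a b qa qb|a b qb]; first by rewrite rmorph0; exact: ideal0.
        by rewrite rmorphD; exact: idealD.
      by rewrite rmorphM; exact: idealMl.
    by rewrite rmorph1; exact: primep1.
  move=> f Ff; rewrite -[f]subr0 -Ff.
  apply: (@ideal_sub_rho _ _ (fun f => q i (face_subst F G f))).
    split=> [|a b qa qb|a b qb]; first by rewrite rmorph0; exact: ideal0.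
      by rewrite rmorphD; exact: idealD.
    by rewrite rmorphM; exact: idealMl.
  move=> j jF; rewrite /face_subst comp_mpoly_var /face_map (negbTE jF).
  exact: ideal0.
have [sub [a qa nqa]] := qs i il; split=> [f|]; first exact: sub.
have [pq1 Gq1 _] := qp _ il; have [pq Gq _] := qp _ (ltnW il).
exists (face_subst G F a); rewrite face_subst_rho.
  rewrite -(subKr a (rho G a)); apply: (idealB (primep_ideal pq1)) => //.
  by apply: Gq1; exact: sub_rho.
move=> h; apply: nqa; rewrite -(subrK (rho G a) a).
by apply: (idealD (primep_ideal pq)) => //; apply: Gq; exact: sub_rho.
Qed.

End ChainTransport.

Lemma krull_dim_le (A : comPzRingType) (M N : lmodType A) :
  (forall l, (exists p, prime_chain M l p) -> exists p, prime_chain N l p) ->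
  (krull_dim M <= krull_dim N)%E.
Proof. by move=> h; apply: int_sup_le => l /h; exact: int_sup_ge. Qed.

Lemma prime_chain_of (A : comPzRingType) (M : lmodType A) I Q l : chain I Q l ->
  (forall a, annihilates M a -> I a) -> exists p, prime_chain M l p.
Proof.
move=> [q [qp qs]] MI.
pose p i := if pselect (i <= l)%N is left h then
    let: And3 a b c := qp i h in prime_of a
  else let: And3 a b c := qp 0%N (leq0n l) in prime_of a.
have pE i a : (i <= l)%N -> a \in p i <-> q i a.
  move=> il; rewrite /p; case: pselect => // h.
  by case: (qp i h) => pq _ _; exact: prime_ofE.
exists p; split=> [i a il /MI Ia|i il].
  by apply/pE => //; have [_ Iq _] := qp i il; exact: Iq.
have [sub [a qa nqa]] := qs i il; split=> [x /(pE _ _ (ltnW il)) /sub qx|].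
  exact/pE.
exists a; first exact/pE.
by apply/negP => /(pE _ _ (ltnW il)).
Qed.

Lemma chain_of_prime_chain (A : comPzRingType) (M : lmodType A) l p I :
  prime_chain M l p -> (forall a, I a -> a \in p 0%N) -> chain I (fun=> True) l.
Proof.
move=> [_ pst] Ip; exists (fun i a => a \in p i); split=> [i il|i il].
  split=> //; first exact: prime_ideal_primep.
  move=> a /Ip; elim: i il => [//|i IHi] il /(IHi (ltnW il)).
  by have [sub _] := pst _ il; exact: sub.
have [sub [a pa npa]] := pst _ il; split=> //.
by exists a => //; exact/negP.
Qed.

(** * Unmixedness of S_2 quotients *)

Section Unmixed.
Variables (k : fieldType) (n : nat) (D : simplicial_complex n) (d : nat).
Local Notation R := {mpoly k[n]}.
Local Notation sqf := (squarefree_monomial k).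
Implicit Types (F G : {set 'I_n}).

Definition top_faces : {set {set 'I_n}} := [set F in (D : {set {set 'I_n}}) |
  #|F| == d].

Hypothesis card_face : forall F, F \in (D : {set {set 'I_n}}) -> (#|F| <= d)%N.

Local Notation Itop := (@faces_ideal k n top_faces).

(** F has the maximal size, so its monomial vanishes on every other face. *)
Lemma top_face_colon F f : F \in top_faces -> face_prime F f ->
  faces_ideal (D : {set {set 'I_n}}) (sqf F * f).
Proof.
rewrite inE => /andP[_ /eqP Fd] Ff G GD; have [FG|FG] := boolP (F \subset G).
  have /eqP <- : F == G by rewrite finset.eqEcard FG Fd card_face.
  exact: (idealMl (face_prime_ideal k F)).
by apply: (idealMr (face_prime_ideal k G)); exact: face_prime_sqf.
Qed.

Variable J : R -> Prop.
Hypotheses (iJ : ideal J) (DJ : sub_ideal (faces_ideal (D : {set {set 'I_n}})) J).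
Hypothesis Jtop : sub_ideal J Itop.
Hypothesis S2 : forall Q l, primep Q -> sub_ideal J Q -> (l <= 2)%N ->
  chain J Q l -> has_reg J Q l.
Hypothesis top_nonempty : exists F, F \in top_faces.

Let noethR : noetherian_ring R := @noetherian_mpoly k n.

(** A nonzero element killed by Q means depth 0, and then S_2 leaves only dimension 0. *)
Lemma no_chain1 Q w : primep Q -> sub_ideal J Q ->
  (forall a, Q a -> sat Q J (a * w)) -> ~ sat Q J w -> ~ chain J Q 1.
Proof.
move=> pQ JQ Qw nw /(S2 pQ JQ (isT : (1 <= 2)%N))[[|a [|? ?]] [//= _ [Qa nza _]]].
by apply: nw; apply: nza; exact: Qw.
Qed.

(** Dimension 0 would force Q to be the prime of F; but there the monomial of F is a unit, and it
    kills w, which vanishes on F. *)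
Lemma not_above_top Q w F : primep Q -> sub_ideal J Q ->
  (forall a, Q a -> sat Q J (a * w)) -> ~ sat Q J w -> Itop w ->
  F \in top_faces -> ~ sub_ideal (face_prime F) Q.
Proof.
move=> pQ JQ Qw nw topw Ftop FQ.
have QF : sub_ideal Q (face_prime F).
  move=> a Qa; apply: contrapT => Fa; apply: (no_chain1 pQ JQ Qw nw).
  have JF : sub_ideal J (face_prime F) by move=> f /Jtop; exact.
  apply: (chain_le (leqnn 1)).
  have [q [qp qs]] := chain_cons (face_prime_primep k F) FQ FQ Qa Fa (chain0 pQ
    (fun f h => h)).
  by exists q; split=> // i il; have [? Fq ?] := qp i il; split=> // f /JF/Fq.
apply: nw; exists (sqf F); first by move/QF; exact: face_prime_sqfN.
by apply: DJ; apply: top_face_colon => //; exact: topw.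
Qed.

(** The colon ideal J : Itop, whose zero set is the support of Itop / J. The goal is that this
    support misses the origin. *)
Definition top_colon a : Prop := forall w, Itop w -> J (a * w).
Local Notation L := top_colon.

Lemma top_colon_ideal : ideal L.
Proof.
split=> [w _|a b La Lb w Iw|a b Lb w Iw].
- by rewrite mul0r; exact: ideal0.
- by rewrite mulrDl; apply: idealD => //; [exact: La|exact: Lb].
- by rewrite -mulrA; apply: idealMl => //; exact: Lb.
Qed.

(** An element of both ideals outside J would have a multiple with prime annihilator Q. That
    multiple lies in L, so Q contains Itop and lies above a top face, against [not_above_top]. *)
Lemma top_colon_cap y : Itop y -> L y -> J y.
Proof.
move=> Iy Ly; apply: contrapT => nJy; have iI := faces_ideal_ideal k top_faces.
have [z [[Iz Lz] nJz] pQ] := colon_prime noethR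
  (E := fun y => (Itop y /\ L y) /\ ~ J y) iJ
  (ex_intro _ y (conj (conj Iy Ly) nJy))
  ltac:(by move=> f [])
  ltac:(by move=> a f [[If Lf] _] nJ; split=> //; split;
    [exact: (idealMl iI)|exact: (idealMl top_colon_ideal)]).
have JQ : sub_ideal J (colon J z) by move=> f Jf; exact: idealMr.
have IQ : sub_ideal Itop (colon J z).
  by move=> w Iw; rewrite /colon mulrC; exact: Lz.
have [F Ftop QF] := faces_ideal_alive pQ IQ.
apply: (not_above_top (w := z) pQ JQ) Ftop _ => //.
- by move=> a Qa; exact: sub_sat.
- by case=> u nQu Ju; apply: nQu.
- exact: (face_prime_alive F (primep_ideal pQ)).2.
Qed.

(** Otherwise L lies in the maximal ideal, and the zero sets of Itop and L, which cover the spectrum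
    of R / J, meet. By S_2 they meet in codimension at most one, and there a count of vertices is
    contradictory. *)
Lemma unmixed_at_origin w : Itop w -> sat (face_prime finset.set0) J w.
Proof.
move=> Iw; apply: contrapT => nw; set m := face_prime _ in nw *.
have pm : primep m by exact: face_prime_primep.
have iI := faces_ideal_ideal k top_faces; have iL := top_colon_ideal.
have Lm : sub_ideal L m.
  move=> a La; apply: contrapT => nma; apply: nw; exists a => //; exact: La.
have Im : sub_ideal Itop m.
  have [F Ftop] := top_nonempty; move=> f /(_ F Ftop).
  by apply: face_prime_sub; exact: finset.sub0set.
have iS : ideal (ideal_sum Itop L) by exact: ideal_sum_ideal.
have nS1 : ~ ideal_sum Itop L 1.
  move=> [a [b [/Im ma /Lm mb ab]]]; apply: (primep1 pm); rewrite ab.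
  by apply: (idealD (primep_ideal pm)).
(* P is an associated prime of R / (Itop + L), the ring of the intersection. *)
have [e nSe pP] := colon_prime noethR (E := fun e => ~ ideal_sum Itop L e) iS
  (ex_intro _ 1 nS1) ltac:(by []) ltac:(by []).
set P := colon _ e in pP.
have iP := primep_ideal pP.
have LP : sub_ideal L P.
  by move=> a La; exists 0, (a * e); split;
    [exact: (ideal0 iI)|exact: (idealMr iL)|rewrite add0r].
have IP : sub_ideal Itop P.
  by move=> a Ia; exists (a * e), 0; split;
    [exact: (idealMr iI)|exact: (ideal0 iL)|rewrite addr0].
have JL : sub_ideal J L by move=> a Ja b _; exact: idealMr.
have JP : sub_ideal J P by move=> a /JL/LP.
have [u0 Pu0 u0P] := sat_colon noethR pP iJ.
(* Hartshorne's argument: since Itop and L meet inside J, depth 2 at P is incompatible with P being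
   associated to R / (Itop + L). *)
have no_chain2 : ~ chain J P 2.
  move=> /(S2 pP JP (isT : (2 <= 2)%N))[[|a [|b [|? ?]]] [//= _ [Pa nza [Pb nzb
    _]]]].
  have [sa [la [Isa Lla ae]]] := Pa; have [sb [lb [Isb Llb be]]] := Pb.
  (* From a e = sa + la and b e = sb + lb, the element b sa - sb a lies in Itop and in L, hence in
     J. As b is regular modulo a, locally sa is a multiple of a. *)
  have K1 : sat P (adj (sat P J) a) sa.
    apply: nzb; apply: sub_sat => //; exists sb; apply: sub_sat => //.
    apply: top_colon_cap; first by apply: (idealB iI);
      [exact: (idealMl iI)|exact: (idealMr iI)].
    have -> : b * sa - sb * a = a * lb - b * la.
      have -> : sa = a * e - la by rewrite ae addrK.
      have -> : sb = b * e - lb by rewrite be addrK.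
      by ring.
    by apply: (idealB iL); exact: (idealMl iL).
  have [u Pu [c Kc]] := K1; have {}Kc := u0P _ Kc.
  pose u1 := u0 * u; pose c1 := u0 * c.
  have Pu1 : ~ P u1 by exact: primepNM.
  have {}Kc : J (u1 * sa - c1 * a)
    by have -> : u1 * sa - c1 * a = u0 * (u * sa - c * a) by rewrite /u1 /c1;
    ring.
  (* Now a c1 is in Itop and a (u1 e - c1) in L. Cancelling a in both, up to multipliers outside P,
     puts a multiple of e by an element outside P into Itop + L, against the definition of P. *)
  have Iac : Itop (a * c1).
    rewrite mulrC -[c1 * a](subKr (u1 * sa)); apply: (idealB iI); last exact: Jtop.
    exact: (idealMl iI).
  have Lay : L (a * (u1 * e - c1)).
    have -> : a * (u1 * e - c1) = u1 * la + (u1 * sa - c1 * a).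
      have -> : la = a * e - sa by rewrite ae addrC addKr.
      by ring.
    by apply: (idealD iL); [exact: (idealMl iL)|exact: JL].
  have Ic : Itop (sqf (alive P) * c1).
    apply: faces_ideal_sat => F Ftop PF.
    have FP : sub_ideal (face_prime F) P by exact: (face_prime_alive _ iP).2.
    have pF := face_prime_primep k F.
    (* If a vanished on F, it would kill the monomial of F, so that monomial would be zero at P, a
       being regular there. *)
    have nFa : ~ face_prime F a.
      move=> Fa; apply: (@face_prime_sqfN k n F).
      apply: (sat_primep pF FP); have : sat P J (sqf F).
        apply: nza; apply: sub_sat => //; apply: DJ; rewrite mulrC.
        exact: top_face_colon.
      by apply: sat_sub => f /Jtop; exact.
    by have /(primepM pF)[] := Iac F Ftop.
  have Ly : L (u0 * (u1 * e - c1)).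
    move=> v Iv; rewrite -mulrA; apply: u0P; apply: nza; apply: sub_sat => //.
    by rewrite mulrA; exact: Lay.
  have : P (u0 * sqf (alive P) * u1).
    exists (u0 * (sqf (alive P) * c1)), (sqf (alive P) * (u0 * (u1 * e - c1))).
    by split; [exact: (idealMl iI)|exact: (idealMl iL)|ring].
  by do 2 apply: primepNM => //; exact: sqf_alive.
have [F Ftop PF] := faces_ideal_alive pP IP.
(* As L lies in P, some v in Itop is nonzero at P. A maximal annihilator Q of such elements lies in
   P and, by [not_above_top], above no top face. *)
have [v Iv nv] : exists2 v, Itop v & ~ sat P J v.
  apply: contrapT => h; apply: Pu0; apply: LP => v Iv; apply: u0P.
  by apply: contrapT => nv; apply: h; exists v.
have isatJ : ideal (sat P J) by exact: sat_ideal.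
have [z [Iz nz] pQ] := colon_prime noethR
  (E := fun v => Itop v /\ ~ sat P J v) isatJ (ex_intro _ v (conj Iv nv))
  ltac:(by move=> f [])
  ltac:(by move=> a f [If _] nJ; split=> //; exact: (idealMl iI)).
set Q := colon _ z in pQ; have iQ := primep_ideal pQ.
have QP : sub_ideal Q P.
  move=> a Qa; apply: contrapT => nPa; apply: nz; exact: satM Qa.
have JQ : sub_ideal J Q by move=> f Jf; apply: sub_sat => //; exact: idealMr.
have above G : G \in top_faces -> ~ sub_ideal (face_prime G) Q.
  apply: (not_above_top (w := z)) => //.
  - by move=> a [u Pu Ju]; exists u => // /QP.
  - by case=> u Qu Ju; apply: Qu; exact: sub_sat.
have DQ : sub_ideal (faces_ideal (D : {set {set 'I_n}})) Q by move=> f /DJ/JQ.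
have [G0 G0D QG0] := faces_ideal_alive pQ DQ.
have GD : alive Q \in (D : {set {set 'I_n}}) by exact: face_sub QG0.
have notop G : G \in top_faces -> ~~ (alive Q \subset G).
  by move=> Gtop; apply/negP => QG; apply: (above G Gtop); apply/face_prime_alive.
have PQ : alive P \subset alive Q by exact: alive_sub.
have Ftop' := Ftop; move: Ftop'; rewrite inE => /andP[FD /eqP Fd].
have [j jF jQ] : exists2 j, j \in F & j \notin alive Q.
  apply/subsetPn; apply: contra (notop F Ftop) => FQ.
  have /eqP -> : F == alive Q by rewrite finset.eqEcard FQ Fd card_face.
  exact: subxx.
have PFj : alive P \subset F :\ j.
  apply/fintype.subsetP => i iP'; rewrite !inE (fintype.subsetP PF) // andbT.
  by apply: contraNneq jQ => <-; exact: (fintype.subsetP PQ).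
have FP : sub_ideal (face_prime F) P by exact: (face_prime_alive _ iP).2.
have FjP : sub_ideal (face_prime (F :\ j)) P by exact: (face_prime_alive _ iP).2.
have FFj : sub_ideal (face_prime F : R -> Prop) (face_prime (F :\ j)).
  by apply: face_prime_sub; exact: finset.subsetDl.
have Fjj : face_prime (F :\ j) ('X_j : R) by apply/face_primeX; rewrite !inE eqxx.
have nFj : ~ face_prime F ('X_j : R) by move/face_primeX; rewrite jF.
(* The primes of F and of F minus j already form a chain; if P were strictly larger, the length
   would be 2. *)
have PFj' : sub_ideal P (face_prime (F :\ j)).
  move=> a Pa; apply: contrapT => nFa; apply: no_chain2.
  have c1 := chain_cons (face_prime_primep k (F :\ j)) FjP FjP Pa nFa (chain0 pP
    (fun f h => h)).
  have [q [qp qs]] := chain_cons (face_prime_primep k F) FP FFj Fjj nFj c1.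
  exists q; split=> // i il; have [? Fq ?] := qp i il; split=> // f /Jtop Jf.
  by apply: Fq; exact: Jf.
have FjQ : F :\ j \subset alive Q.
  by apply: fintype.subset_trans PQ; rewrite -(alive_face_prime k (F :\ j));
    exact: alive_sub.
(* F minus j is a proper part of [alive Q], so [alive Q] has d elements and is itself a top face,
   against [notop]. *)
have Qd : #|alive Q| = d.
  apply/eqP; rewrite eqn_leq card_face //= -Fd (cardsD1 j) jF add1n.
  apply: proper_card; rewrite finset.properEneq FjQ andbT; apply/eqP => FQ.
  by case/negP: (notop F Ftop); rewrite -FQ; exact: finset.subsetDl.
by have := notop (alive Q); rewrite inE GD Qd eqxx subxx => /(_ isT).
Qed.

End Unmixed.

(** * Cycles *)

Section Origin.
Variables (k : fieldType) (n : nat).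
Local Notation R := {mpoly k[n]}.
Local Notation m0 := (@face_prime k n finset.set0).

Lemma origin_gen (a : R) : m0 a -> exists al : 'I_n -> R, a = \sum_i al i * 'X_i.
Proof.
move=> ma; pose Q (f : R) := exists al : 'I_n -> R, f = \sum_i al i * 'X_i.
have iQ : ideal Q.
  split=> [|_ _ [al ->] [be ->]|c _ [al ->]].
  - by exists (fun=> 0); rewrite big1 // => i _; rewrite mul0r.
  - by exists (fun i => al i + be i); rewrite -big_split;
    apply: eq_bigr => i _; rewrite mulrDl.
  - by exists (fun i => c * al i); rewrite mulr_sumr; apply: eq_bigr => i _;
    rewrite mulrA.
suff : Q (a - rho finset.set0 a) by rewrite ma subr0.
apply: ideal_sub_rho => // i _; exists (fun j => (j == i)%:R).
by rewrite (bigD1 i) //= eqxx mul1r big1 ?addr0 // => j /negPf ->; rewrite mul0r.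
Qed.

Lemma origin_mcoeff (f : R) : m0 f <-> f@_0 = 0.
Proof.
split=> [mf|f0].
  by have /face_primeP/(_ 0%MM) := mf; apply; apply/fintype.subsetP => i;
    rewrite !inE mnm0E.
apply/face_primeP => m ms; suff -> : m = 0%MM by [].
apply/mnmP => i; rewrite mnm0E; apply/eqP; apply: contraT => mi.
by have := fintype.subsetP ms i; rewrite !inE mi => /(_ isT).
Qed.

Variable J : R -> Prop.
Hypothesis iJ : ideal J.

Let noethR : noetherian_ring R := @noetherian_mpoly k n.
Let pm : primep m0 := face_prime_primep k finset.set0.

Lemma sat_origin_face F : sub_ideal J (face_prime F) ->
  sub_ideal (sat m0 J) (face_prime F).
Proof.
move=> JF; apply: sat_le => //; first exact: face_prime_primep.
by apply: face_prime_sub; exact: finset.sub0set.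
Qed.

(** A function chi constant on the connected components gives the Koszul cocycle chi_i x_i. Depth 2
    makes it a multiple of the vector of the x_i, so chi is constant. *)
Lemma koszul_components (chi : 'I_n -> k) : has_reg J m0 2 ->
  (forall i j, chi i != chi j -> sat m0 J ('X_i * 'X_j)) ->
  forall i j, sub_ideal J (face_prime [set i]) ->
    sub_ideal J (face_prime [set j]) -> chi i = chi j.
Proof.
move=> [[|b [|c [|? ?]]] [//= _ reg]] chiJ i j Ji Jj.
have iK : ideal (sat m0 J) by exact: sat_ideal.
have [|u [t [mu Kut]]] := koszul1 pm origin_gen
  (z := fun i => (chi i)%:MP * 'X_i) iK reg _.
  move=> a l /=; have [->|/chiJ Kal] := eqVneq (chi a) (chi l).
    rewrite [X in sat _ _ X](_ : _ = 0); [exact: ideal0|ring].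
  have -> : 'X_a * ((chi l)%:MP * 'X_l) - 'X_l * ((chi a)%:MP * 'X_a) =
     ((chi l)%:MP - (chi a)%:MP) * ('X_a * 'X_l) :> R by ring.
  exact: (idealMl iK).
(* On the ray of the vertex l the variable x_l cancels from the relation, and what remains is
   evaluated at the origin. *)
have key l : sub_ideal J (face_prime [set l]) -> m0 (u * (chi l)%:MP - t).
  move=> /sat_origin_face/(_ _ (Kut l)).
  have -> : u * ((chi l)%:MP * 'X_l) - 'X_l * t = 'X_l * (u * (chi l)%:MP - t)
    by ring.
  case/(primepM (face_prime_primep k [set l])) => [/face_primeX|];
    first by rewrite !inE eqxx.
  by apply: face_prime_sub; exact: finset.sub0set.
have : m0 (u * (chi i - chi j)%:MP).
  have -> : u * (chi i - chi j)%:MP = (u * (chi i)%:MP - t) - (u * (chi j)%:MP - t).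
    by rewrite mpolyCB; ring.
  by apply: (idealB (primep_ideal pm)); exact: key.
case/(primepM pm) => // /origin_mcoeff; rewrite mcoeffC eqxx mulr1 => /eqP.
by rewrite subr_eq0 => /eqP.
Qed.

(** A simplicial 1-cocycle mu gives the Koszul cocycle mu_ij x_i x_j. Depth 3 makes it a coboundary,
    and comparing coefficients of x_i x_j shows that mu is a coboundary on the edges. *)
Lemma koszul_cocycle (mu : 'I_n -> 'I_n -> k) : has_reg J m0 3 ->
  (forall i j, mu i j = - mu j i) ->
  (forall i j l, mu j l + mu l i + mu i j != 0 -> sat m0 J ('X_i * 'X_j * 'X_l)) ->
  exists nu : 'I_n -> k, forall i j, sub_ideal J (face_prime [set i; j]) ->
    mu i j = nu j - nu i.
Proof.
move=> [[|a [|b [|c [|? ?]]]] [//= _ reg]] muN muJ.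
have iK : ideal (sat m0 J) by exact: sat_ideal.
have [i j|i j l|u [v [mu0 Kuv]]] := koszul2 noethR pm origin_gen
  (m := fun i j => (mu i j)%:MP * ('X_i * 'X_j)) iK reg _ _.
- by rewrite muN mpolyCN mulNr (mulrC 'X_j).
- have -> : 'X_i * ((mu j l)%:MP * ('X_j * 'X_l)) + 'X_j * ((mu l i)%:MP * ('X_l
  * 'X_i)) +
     'X_l * ((mu i j)%:MP * ('X_i * 'X_j)) =
     (mu j l + mu l i + mu i j)%:MP * ('X_i * 'X_j * 'X_l) :> R.
    by rewrite !mpolyCD; ring.
  have [->|/muJ Kx] := eqVneq (mu j l + mu l i + mu i j) 0.
    by rewrite mpolyC0 mul0r; exact: (ideal0 iK).
  exact: (idealMl iK).
have u0 : u@_0 != 0 by apply/eqP => /origin_mcoeff.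
(* In x_i v_j - x_j v_i the coefficient of x_i x_j is that of x_j in v_j minus that of x_i in v_i; u
   contributes its constant term. *)
exists (fun i => (v i)@_U_(i) / u@_0) => i j Jij.
have /face_primeP/(_ (U_(i) + U_(j))%MM) := sat_origin_face Jij (Kuv i j).
have -> : msupport (U_(i) + U_(j))%MM \subset [set i; j].
  apply/fintype.subsetP => l; rewrite !inE mnmDE !mnm1E (eq_sym l i) (eq_sym l j).
  by case: (i == l); case: (j == l).
move=> /(_ isT); rewrite !mcoeffB mul_mpolyC -scalerAr mcoeffZ -mpolyXD.
rewrite -[X in (u * _)@_X]addm0 mcoeffMX (mulrC 'X_i) mcoeffMX.
rewrite (mulrC 'X_j) addmC mcoeffMX => /eqP; rewrite subr_eq0 => /eqP e.
by rewrite -mulrBl -e mulfK.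
Qed.

End Origin.

Section Cycle.
Variable n : nat.
Hypothesis n_ge3 : (3 <= n)%N.

Local Notation Delta := (independence_complex (cycle_graph n)).

Let n_gt0 : (0 < n)%N. Proof. by apply: leq_trans n_ge3. Qed.

Lemma modn_wrap a : (a < n + n)%N -> (a %% n)%N = if (a < n)%N then a else (a - n)%N.
Proof.
move=> an; case: ltnP => [/modn_small //|na].
by rewrite -{1}(subnK na) modnDr modn_small //; lia.
Qed.

Lemma independentP (F : {set 'I_n}) : reflect
  (forall i j, i \in F -> j \in F -> ~~ cycle_edge i j) (F \in (Delta : {set
    {set 'I_n}})).
Proof.
rewrite inE; apply: (iffP idP) => [h i j iF jF|h].
  by have /forall_inP/(_ i iF)/forall_inP/(_ j jF) := h.
by apply/forall_inP => i iF; apply/forall_inP => j jF; exact: h.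
Qed.

Lemma cycle_edgeE (i j : 'I_n) : cycle_edge i j =
  [|| (j == i.+1 :> nat), (i == j.+1 :> nat),
      (i == 0 :> nat) && (j == n.-1 :> nat) |
      (j == 0 :> nat) && (i == n.-1 :> nat)]%N.
Proof.
have := ltn_ord i; have := ltn_ord j; rewrite /cycle_edge -val_eqE /= => hj hi.
rewrite !modn_wrap; [|lia|lia].
by do 2 case: ltnP => ?; apply/idP/idP; lia.
Qed.

Definition gaps (F : {set 'I_n}) : {set 'I_n} :=
  [set v | (v \notin F) && [forall w in F, v != w.+1 %% n :> nat]%N].

Definition omod a : 'I_n := Ordinal (ltn_pmod a n_gt0).

(** Each vertex of F occupies itself and its successor, all these are distinct, and [gaps F] is the
    rest. So a face of size n/2 has no gap for n even and exactly one for n odd. *)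
Lemma card_gaps (F : {set 'I_n}) : F \in (Delta : {set {set 'I_n}}) ->
  (#|F| + #|F| + #|gaps F| = n)%N.
Proof.
move=> /independentP Find; pose F' := (fun w : 'I_n => omod w.+1) @: F.
have cF' : #|F'| = #|F|.
  apply: card_imset => i j /(congr1 val) /=.
  have := ltn_ord i; have := ltn_ord j => hj hi.
  rewrite !modn_wrap; [|lia|lia]; move=> h; apply: val_inj => /=; move: h.
  by do 2 case: ltnP => ?; lia.
have dF : [disjoint F & F'].
  apply/pred0P => i /=; apply/negP => /andP[iF /imsetP[j jF ij]].
  have := Find i j iF jF; rewrite /cycle_edge ij -val_eqE /= eqxx orbT andbT negbK.
  have jn := ltn_ord j; rewrite modn_wrap; last lia.
  by case: ltnP => ?; lia.
have gE : gaps F = ~: (F :|: F').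
  apply/setP => v; rewrite !inE negb_or; congr (_ && _).
  apply/forall_inP/negP => [h /imsetP[w wF vw]|h w wF].
    by have := h w wF; rewrite vw eqxx.
  by apply/eqP => vw; apply: h; apply/imsetP; exists w => //; exact: val_inj.
rewrite gE -{2}cF' -(cardsUI F F') (disjoint_setI0 dF) cards0 addn0.
by rewrite cardsC card_ord.
Qed.

Lemma card_independent (F : {set 'I_n}) : F \in (Delta : {set {set 'I_n}}) ->
  (#|F| <= n./2)%N.
Proof. by move=> /card_gaps; lia. Qed.

(** Without a gap, stepping by two from i stays in F and by parity reaches the predecessor of j, a
    neighbour of j. *)
Lemma gap_between (F : {set 'I_n}) (i j : 'I_n) :
  F \in (Delta : {set {set 'I_n}}) -> i \in F -> j \in F -> (i < j)%N ->
  odd i != odd j -> exists2 v, v \in gaps F & (i < v < j)%N.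
Proof.
move=> /independentP Find iF jF ij oij; apply: contrapT => nogap.
have step t (h : (i + t.*2 < j)%N) : omod (i + t.*2) \in F.
  elim: t h => [|t IHt] h.
    rewrite (_ : omod _ = i) //; apply: val_inj => /=.
    by rewrite double0 addn0 modn_small.
  have jn := ltn_ord j; have {IHt} IHt := IHt ltac:(lia).
  have v2 : omod (i + t.+1.*2) = (i + t.+1.*2)%N :> nat
    by rewrite /= modn_small //; lia.
  have v1 : omod (i + t.*2) = (i + t.*2)%N :> nat by rewrite /= modn_small //; lia.
  apply: contrapT => /negP nF; apply: nogap; exists (omod (i + t.+1.*2)); last first.
    by lia.
  rewrite inE nF andTb; apply/forall_inP => w wF; rewrite v2.
  have := Find _ _ IHt wF; rewrite cycle_edgeE v1; have := ltn_ord w => wn.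
  by rewrite modn_wrap; [case: ltnP => ?; lia|lia].
have jn := ltn_ord j.
pose t := ((j - i).-1)./2.
have tj : (i + t.*2).+1 = j by move: oij; rewrite /t; lia.
have := Find _ _ (step t _) jF; rewrite tj => /(_ (leqnn _)).
by rewrite cycle_edgeE /= modn_small; lia.
Qed.

(** Walks in steps of two; they serve to place single vertices and the pairs s, s + 2 in top
    faces. *)
Definition step_face s : {set 'I_n} := 
  (fun t : 'I_(n./2) => omod (s + t.*2)) @: predT.

Lemma step_face_mem s t : (t < n./2)%N -> omod (s + t.*2) \in step_face s.
Proof. by move=> tn; apply/imsetP; exists (Ordinal tn). Qed.

Lemma step_face_top (s : nat) : (s < n)%N ->
  step_face s \in top_faces Delta n./2.
Proof.
move=> sn; have tn (t : 'I_(n./2)) : (s + t.*2 < n + n)%N by have := ltn_ord t; lia.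
rewrite inE; apply/andP; split.
  apply/independentP => _ _ /imsetP[t _ ->] /imsetP[t' _ ->].
  have := ltn_ord t; have := ltn_ord t' => ht' ht.
  rewrite cycle_edgeE /= !modn_wrap //.
  by do 2 case: ltnP => ?; lia.
rewrite card_imset ?card_ord // => t t' /(congr1 val) /=.
rewrite !modn_wrap // => h; apply: val_inj => /=; move: h.
have := ltn_ord t; have := ltn_ord t' => ht' ht.
by do 2 case: ltnP => ?; lia.
Qed.

Section Depth.
Variable k : fieldType.
Local Notation R := {mpoly k[n]}.
Local Notation m0 := (@face_prime k n finset.set0).
Local Notation Itop := (@faces_ideal k n (top_faces Delta n./2)).

Variable J : R -> Prop.
Hypotheses (iJ : ideal J) (Jtop : sub_ideal J Itop).
Hypothesis topJ : sub_ideal Itop (sat m0 J).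

Lemma sub_step_face s (F : {set 'I_n}) : (s < n)%N -> F \subset step_face s ->
  sub_ideal J (face_prime F).
Proof.
move=> sn Fs f /Jtop/(_ _ (step_face_top sn)); exact: face_prime_sub.
Qed.

(** A top face has no gap, so parity is constant on it, although 0 and 1 both lie in top faces:
    parity is a nonconstant class of degree 0. *)
Lemma even_cycle_depth : ~~ odd n -> ~ has_reg J m0 2.
Proof.
move=> nev reg; have n4 : (4 <= n)%N by lia.
have := koszul_components iJ (chi := fun i => (odd i)%:R) reg.
have J1 s : (s < n)%N -> sub_ideal J (face_prime [set omod s]).
  move=> sn; apply: (sub_step_face sn); rewrite finset.sub1set.
  by rewrite -{1}(addn0 s); apply: (@step_face_mem s 0); lia.
move=> /(_ _ (omod 0) (omod 1) (J1 0%N _) (J1 1%N _)) h.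
have : (0 : k) = 1.
  have := h _ ltac:(lia) ltac:(lia); rewrite /= !modn_small; [|lia|lia].
  apply=> i j; have [->|oij _] := eqVneq (odd i) (odd j); first by rewrite eqxx.
  apply: topJ => F; rewrite inE => /andP[FD /eqP Fd].
  have [iF|iF] := boolP (i \in F); last first.
    by apply: (idealMr (face_prime_ideal k F)); apply/face_primeX.
  have [jF|jF] := boolP (j \in F); last first.
    by apply: (idealMl (face_prime_ideal k F)); apply/face_primeX.
  have cg := card_gaps FD; exfalso.
  have [v vF _] : exists2 v, v \in gaps F & true.
    have [ij|ji|ij] := ltngtP i j.
    - by have [v ? _] := gap_between FD iF jF ij oij; exists v.
    - have [v ? _] := gap_between FD jF iF ji ltac:(by rewrite eq_sym); by exists v.
    - by move: oij; rewrite (val_inj ij) eqxx.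
  have : (0 < #|gaps F|)%N by apply/card_gt0P; exists v.
  by move: cg; rewrite Fd; lia.
by move/eqP; rewrite eq_sym oner_eq0.
Qed.

(** Each change of parity costs a gap, and a top face of an odd cycle has only one. *)
Lemma no_alternation (F : {set 'I_n}) (a b c : 'I_n) : odd n -> F \in top_faces
  Delta n./2 ->
  a \in F -> b \in F -> c \in F -> (a < b)%N -> (b < c)%N ->
  odd a != odd b -> odd b != odd c -> False.
Proof.
move=> nodd; rewrite inE => /andP[FD /eqP Fd] aF bF cF ab bc oab obc.
have [v vF /andP[_ vb]] := gap_between FD aF bF ab oab.
have [w wF /andP[bw _]] := gap_between FD bF cF bc obc.
have : (1 < #|gaps F|)%N.
  by apply/card_gt1P; exists v, w; split=> //;
    rewrite -val_eqE neq_ltn (ltn_trans vb bw).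
have := card_gaps FD; rewrite Fd; lia.
Qed.

Lemma same_side (F : {set 'I_n}) (a b c : 'I_n) : odd n -> F \in top_faces Delta
  n./2 ->
  a \in F -> b \in F -> c \in F -> odd a != odd b -> odd b != odd c ->
  (a < b)%N = (c < b)%N.
Proof.
move=> nodd Ft aF bF cF oab obc.
have : (a != b :> nat)%N by apply: contraNneq oab => ->.
have : (b != c :> nat)%N by apply: contraNneq obc => ->.
rewrite !neq_ltn => bc ab; apply/idP/idP => h.
  case/orP: bc => // bc; case: (no_alternation nodd Ft aF bF cF h bc oab obc).
case/orP: ab => // ba.
by case: (no_alternation nodd Ft cF bF aF h ba); rewrite eq_sym.
Qed.

(* The generator of the first cohomology of the strip of top faces: it counts
   the passages from the odd to the even vertices at 0. *)
Definition winding (i j : 'I_n) : k :=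
  [&& odd i, ~~ odd j & (j < i)%N]%:R - [&& odd j, ~~ odd i & (i < j)%N]%:R.

(** If the parities are not all equal, the two vertices of equal parity lie on the same side of the
    third by [same_side], and their contributions cancel. *)
Lemma winding_cocycle (F : {set 'I_n}) (i j l : 'I_n) : odd n -> F \in top_faces
  Delta n./2 ->
  i \in F -> j \in F -> l \in F ->
  winding j l + winding l i + winding i j = 0.
Proof.
move=> nodd Ft iF jF lF; rewrite /winding.
have s1 := @same_side F i j l nodd Ft iF jF lF.
have s2 := @same_side F j l i nodd Ft jF lF iF.
have s3 := @same_side F l i j nodd Ft lF iF jF.
have lt_flip (a b : 'I_n) : odd a != odd b -> (a < b)%N = ~~ (b < a)%N.
  move=> oab; have ab : (a != b :> nat)%N by apply: contraNneq oab => ->.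
  by rewrite -leqNgt ltn_neqAle ab.
have f1 := lt_flip i j; have f2 := lt_flip j l; have f3 := lt_flip l i.
have -> (x1 x2 x3 y1 y2 y3 : bool) : x1%:R - y1%:R + (x2%:R - y2%:R) + (x3%:R -
  y3%:R) =
  (x1 + x2 + x3)%:R - (y1 + y2 + y3)%:R :> k by rewrite !natrD; ring.
apply/eqP; rewrite subr_eq0; apply/eqP; congr (_%:R); move: s1 s2 s3 f1 f2 f3.
by case: (odd i); case: (odd j); case: (odd l) => /= s1 s2 s3 f1 f2 f3;
  rewrite ?(s1 isT isT) ?(s2 isT isT) ?(s3 isT isT) //; lia.
Qed.

(** Stepping by two passes through all vertices and closes up, so the differences of nu add up to 0,
    while [winding] adds up to 1. *)
Lemma odd_cycle_depth : odd n -> (7 <= n)%N -> ~ has_reg J m0 3.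
Proof.
move=> nodd n7 /(koszul_cocycle iJ (mu := winding))[i j|i j l|nu nuE].
- by rewrite /winding opprB.
- move=> ne; apply: topJ => F Ftop; have pF := face_prime_ideal k F.
  have [iF|iF] := boolP (i \in F); last first.
    by do 2 apply: (idealMr pF); apply/face_primeX.
  have [jF|jF] := boolP (j \in F); last first.
    by apply: (idealMr pF); apply: (idealMl pF); apply/face_primeX.
  have [lF|lF] := boolP (l \in F); last first.
    by apply: (idealMl pF); apply/face_primeX.
  by move: ne; rewrite (winding_cocycle nodd Ftop iF jF lF) eqxx.
have step s : (s < n)%N ->
    winding (omod s) (omod (s + 2)) = nu (omod (s + 2)) - nu (omod s).
  move=> sn; apply: nuE; apply: (sub_step_face sn).
  apply/fintype.subsetP => v; rewrite !inE => /orP[]/eqP ->.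
    by rewrite -{1}(addn0 s); apply: (@step_face_mem s 0); lia.
  by apply: (@step_face_mem s 1); lia.
have same s : (s + 2 < n)%N -> nu (omod (s + 2)) = nu (omod s).
  move=> sn; apply/eqP; rewrite -subr_eq0 -step; last lia.
  rewrite /winding /= !modn_small; [|lia|lia].
  by rewrite oddD addbF; case: (odd s); rewrite /= ?subrr.
have evens t : (t.*2 < n)%N -> nu (omod t.*2) = nu (omod 0).
  elim: t => [//|t IHt] tn; rewrite doubleS -addn2 same ?IHt //; lia.
have odds t : (t.*2.+1 < n)%N -> nu (omod t.*2.+1) = nu (omod 1).
  elim: t => [//|t IHt] tn; rewrite doubleS -addn2 same ?IHt //; lia.
have wrap s : (s < n)%N -> (n <= s + 2)%N -> omod (s + 2) = omod (s + 2 - n).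
  by move=> sn ns; apply: val_inj; rewrite /= -{1}(subnK ns) modnDr.
have n2 := odd_double_half n; rewrite nodd add1n in n2.
(* The step from the even vertex n - 1 to 1 has winding 0, so nu takes the same value on both
   parities. *)
have := step n.-1 ltac:(lia); rewrite wrap; [|lia|lia].
have -> : (n.-1 + 2 - n = 1)%N by lia.
have {1 2}-> : n.-1 = (n./2).*2 by lia.
rewrite evens; last lia.
rewrite {1}/winding /= !modn_small; [|lia|lia].
rewrite odd_double /= ltnNge; have -> : (1 <= (n./2).*2)%N by lia.
rewrite subrr => /esym/eqP; rewrite subr_eq0 => /eqP nu1.
(* The step from the odd vertex n - 2 to 0 is the only one with nonzero winding. *)
have := step n.-2 ltac:(lia); rewrite wrap; [|lia|lia].
have -> : (n.-2 + 2 - n = 0)%N by lia.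
have {1 2}-> : n.-2 = ((n./2).-1).*2.+1 by lia.
rewrite odds; last lia.
rewrite nu1 subrr /winding /= !modn_small; [|lia|lia].
rewrite oddS odd_double /= subr0 => /eqP; rewrite oner_eq0 //.
Qed.

End Depth.
End Cycle.

(** * The two hypotheses on the face ring *)

Lemma pred_ext (T : Type) (p q : T -> Prop) : (forall x, p x <-> q x) -> p = q.
Proof. by move=> pq; apply/funext => x; apply/propext. Qed.

Lemma chain_sub (R : comPzRingType) (I I' Q Q' : R -> Prop) l :
  sub_ideal I' I -> sub_ideal Q Q' -> chain I Q l -> chain I' Q' l.
Proof.
move=> I'I QQ' [q [qp qs]]; exists q; split=> // i il.
by have [? Iq qQ] := qp i il; split=> // f; [move/I'I/Iq|move/qQ/QQ'].
Qed.

Lemma chain_to_origin (k : fieldType) n (F : {set 'I_n}) :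
  chain (face_prime F : {mpoly k[n]} -> Prop) (face_prime finset.set0) #|F|.
Proof.
move: {2}#|F| (erefl #|F|) => d; elim: d F => [|d IHd] F Fd.
  rewrite Fd; move/eqP: Fd; rewrite cards_eq0 => /eqP ->.
  by apply: chain0 => [|f]; first exact: face_prime_primep.
have /card_gt0P[j jF] : (0 < #|F|)%N by rewrite Fd.
have Fj : #|F :\ j| = d by move: Fd; rewrite (cardsD1 j) jF => -[].
rewrite Fd -Fj; apply: (chain_cons (a := 'X_j)) (IHd _ Fj).
- exact: face_prime_primep.
- by apply: face_prime_sub; exact: finset.sub0set.
- by apply: face_prime_sub; exact: finset.subsetDl.
- by apply/face_primeX; rewrite !inE eqxx.
- by move/face_primeX; rewrite jF.
Qed.

(** * The last quotient of a filtration *)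

Section SeqSerre.
Variables (k : fieldType) (n : nat) (D : simplicial_complex n).
Local Notation R := {mpoly k[n]}.
Local Notation M := (face_mod k D).
Local Notation cls := (@quot_class R R^o (@SR_ideal k n D)).
Local Notation ID := (@faces_ideal k n (D : {set {set 'I_n}})).

Lemma cls_scale (f g : R) : f *: (cls g : M) = cls (f * g).
Proof. exact: quot_scaleE. Qed.

Lemma cls0 f : cls f = 0 <-> ID f.
Proof.
rewrite -(SR_idealP D f); have -> : (0 : M) = cls 0.
  by rewrite -[LHS](scale0r (cls 0 : M)) cls_scale mul0r.
by split=> [/quot_classE|h]; [|apply/quot_classE]; rewrite subr0.
Qed.

Section Step.
Variables (A C : submodClosed M).
Local Notation N := (subquotient A C).

Lemma subquotient_elt (m : N) : exists (y : submodule_type A) g,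
  m = quot_class (restr_submod A C) y /\ val y = cls g.
Proof.
have [y ->] := quot_class_surj m; have [g yg] := quot_class_surj (val y).
by exists y, g.
Qed.

Lemma subquotient_scale0 (a : R) (y : submodule_type A) :
  a *: (quot_class (restr_submod A C) y : N) = 0 <-> a *: val y \in C.
Proof.
have -> : a *: (quot_class (restr_submod A C) y : N) =
    quot_class (restr_submod A C) (a *: y) by exact: quot_scaleE.
have -> : (0 : N) = quot_class (restr_submod A C) 0.
  rewrite -[LHS](scale0r (quot_class (restr_submod A C) 0 : N)).
  by rewrite -[RHS](congr1 _ (scale0r 0)); exact: quot_scaleE.
by split=> [/quot_classE|h]; [|apply/quot_classE]; rewrite subr0.
Qed.

Lemma annihilates_subquotient (a : R) : annihilates N a <->
  forall f, cls f \in A -> cls (a * f) \in C.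
Proof.
split=> [ann f fA|h m].
  pose y : submodule_type A := exist _ (cls f) fA.
  by have /subquotient_scale0 := ann (quot_class (restr_submod A C) y);
    rewrite /= cls_scale.
have [y [g [-> yg]]] := subquotient_elt m; apply/subquotient_scale0.
by rewrite yg cls_scale; apply: h; rewrite -yg; exact: (valP y).
Qed.

End Step.

Lemma ID_annihilates (A C : submodClosed M) a : ID a -> annihilates (subquotient
  A C) a.
Proof.
move=> Ia; apply/annihilates_subquotient => f _.
have /cls0 -> : ID (a * f) by exact: (idealMr (faces_ideal_ideal k _)).
exact: rpred0.
Qed.

Section TopQuotient.
Variables (A C : submodClosed M).
Hypothesis Afull : forall x, x \in A.
Local Notation N := (subquotient A C).

(** A is the whole face ring, so the quotient is generated by the class of 1 and is R modulo this
    ideal. *)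
Definition top_ideal (f : R) : Prop := cls f \in C.

Definition top_one : submodule_type A := exist _ (cls 1) (Afull (cls 1)).
Definition top_gen : N := quot_class (restr_submod A C) top_one.

Let phi : {rmorphism R -> R} := idfun.

Let phi_surj (b : R) : exists a, b = phi a. Proof. by exists b. Qed.

Lemma top_gen_span (m : N) : exists b : R, m = b *: top_gen.
Proof.
have [y [g [-> yg]]] := subquotient_elt m; exists g.
have -> : g *: top_gen = quot_class (restr_submod A C) (g *: top_one).
  exact: quot_scaleE.
by congr quot_class; apply: val_inj => /=; rewrite yg cls_scale mulr1.
Qed.

Lemma top_gen_ker : ker_gen phi top_gen = top_ideal.
Proof.
apply: pred_ext => f; rewrite /ker_gen /phi /=.
by rewrite (subquotient_scale0 C f top_one) /= cls_scale mulr1.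
Qed.

Lemma serre_top_ideal r Q l : serre r N -> primep Q -> sub_ideal top_ideal Q ->
  (l <= r)%N -> chain top_ideal Q l -> has_reg top_ideal Q l.
Proof.
move=> sN pQ JQ lr chJ; pose P := prime_of pQ.
have QE : contraction phi P = Q by apply: pred_ext => f; exact: prime_ofE.
have := @has_reg_of_depth _ _ phi phi_surj N top_gen top_gen_span P l.
rewrite top_gen_ker QE; apply=> //.
apply: le_trans (sN P); rewrite le_min lee_fin lez_nat lr /=.
by apply: (@dim_at_ge _ _ phi phi_surj N top_gen P l); rewrite top_gen_ker QE.
Qed.

Lemma serre_of_reg r : (forall Q l, primep Q -> sub_ideal top_ideal Q ->
  chain top_ideal Q l -> has_reg top_ideal Q l) -> serre r N.
Proof.
move=> regs P; have pQ := contraction_primep phi P.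
have dge := @depth_at_ge _ _ phi phi_surj N top_gen top_gen_span P.
have doo := @depth_at_oo _ _ phi phi_surj N top_gen top_gen_span P.
rewrite top_gen_ker in dge doo.
have [JQ|/doo ->] := pselect (sub_ideal top_ideal (contraction phi P));
  last exact: leey.
rewrite ge_min; apply/orP; right.
apply: (@dim_at_le _ _ phi phi_surj N top_gen top_gen_span) => l.
by rewrite top_gen_ker => /(regs _ _ pQ JQ); exact: dge.
Qed.

End TopQuotient.

Variable d : nat.
Hypothesis card_face : forall F, F \in (D : {set {set 'I_n}}) -> (#|F| <= d)%N.

(* A top-dimensional component cannot die before the last step: the step in
   which it dies already has the maximal possible dimension. *)
Lemma seq_serre_top_ideal r : complex_seq_serre k D r ->
  exists J : R -> Prop, [/\ ideal J, sub_ideal ID J,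
    sub_ideal J (faces_ideal (top_faces D d)) &
    forall Q l, primep Q -> sub_ideal J Q -> (l <= r)%N ->
      chain J Q l -> has_reg J Q l].
Proof.
move=> [t [F [[F0 Ft] _ Fmono Fserre Fdim]]].
have n1 : ~ ID 1.
  by move=> /(_ finset.set0 (face0 D));
    exact: (primep1 (face_prime_primep k finset.set0)).
case: t Ft Fmono Fserre Fdim => [|t] Ft Fmono Fserre Fdim.
  by case: n1; apply/cls0/F0; exact: Ft.
exists (top_ideal (F t)); split.
- rewrite /top_ideal; split=> [|a b Ja Jb|a b Jb].
  + have /cls0 -> := ideal0 (faces_ideal_ideal k (D : {set {set 'I_n}})).
    exact: rpred0.
  + have -> : cls (a + b) = (cls a : M) + cls b by exact: quot_classD.
    exact: rpredD.
  + by rewrite -cls_scale rpredZ.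
- by move=> f /cls0; rewrite /top_ideal => ->; exact: rpred0.
- move=> f Jf E Etop; apply: contrapT => nEf.
  have ex : exists i, `[< exists2 g, cls g \in F i & ~ face_prime E g >].
    by exists t; apply/asboolP; exists f.
  (* The first member of the filtration that does not vanish on E; because of f it has index at most
     t, so a further step follows it. *)
  case: (ex_minnP ex) => i /asboolP[g gF nEg] imin.
  have it : (i <= t)%N by apply: imin; apply/asboolP; exists f.
  move: Etop; rewrite inE => /andP[ED /eqP Ed].
  case: i gF imin it => [/F0/cls0/(_ E ED)//|i] gF imin it.
  have FiE h : cls h \in F i -> face_prime E h.
    move=> hF; apply: contrapT => nEh; have : (i.+1 <= i)%N.
      by apply: imin; apply/asboolP; exists h.
    by rewrite ltnn.
  (* The prime of E contains the annihilator of the quotient in which g appears. A chain for the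
     next quotient lies over the prime of some face, which is no larger than E, and is transported
     to E; so the dimension does not increase. *)
  have := Fdim i it; rewrite ltNge => /negP; apply.
  apply: krull_dim_le => l [p pch].
  have [q [qp qs]] := chain_of_prime_chain pch (fun a Ia =>
    pch.1 0%N a (leq0n l) (@ID_annihilates _ _ a Ia)).
  have [pq Iq _] := qp 0%N (leq0n l).
  have [G GD qG] := faces_ideal_alive pq Iq.
  have GE : (#|G| <= #|E|)%N by rewrite Ed; exact: card_face.
  have chG : chain (face_prime G : R -> Prop) (fun=> True) l.
    exists q; split=> // j jl; have [pqj _ _] := qp j jl; split=> // h Gh.
    have Gq0 : sub_ideal (face_prime G) (q 0%N).
      exact: (face_prime_alive _ (primep_ideal pq)).2.
    elim: j jl {pqj} => [|j IHj] jl; first exact: Gq0.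
    by have [sub _] := qs j jl; apply: sub; apply: IHj; exact: ltnW.
  apply: prime_chain_of (chain_transport GE chG) _ => a.
  move/annihilates_subquotient => /(_ g gF) /FiE.
  by case/(primepM (face_prime_primep k E)).
- by move=> Q l; exact: serre_top_ideal (Fserre t (ltnSn t)).
Qed.

End SeqSerre.

(** * Cohen-Macaulay face rings at the origin *)

Section CohenMacaulay.
Variables (k : fieldType) (n : nat) (D : simplicial_complex n).
Local Notation R := {mpoly k[n]}.
Local Notation B := (face_ring k D).
Local Notation cls := (@quot_class R R^o (@SR_ideal k n D) : R -> B).
Local Notation ID := (@faces_ideal k n (D : {set {set 'I_n}})).
Local Notation m0 := (@face_prime k n finset.set0).

Definition face_class : R -> B := cls.

Lemma face_class_add : {morph face_class : x y / x + y}.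
Proof. by move=> x y; exact: (@quot_classD R R^o (@SR_ideal k n D)). Qed.

Lemma face_class_monoid : monoid_morphism face_class.
Proof.
split=> [|x y]; first by [].
exact: (esym (quot_ring_mulE (@SR_ideal k n D) x y)).
Qed.

Lemma face_class0 f : face_class f = 0 <-> ID f.
Proof. exact: cls0. Qed.

HB.instance Definition _ := GRing.isNmodMorphism.Build R B face_class
  (conj ((face_class0 0).2 (ideal0 (faces_ideal_ideal k _))) face_class_add).

HB.instance Definition _ := GRing.isMonoidMorphism.Build R B face_class
  face_class_monoid.

Lemma face_class_surj (b : B) : exists a, b = face_class a.
Proof. exact: (@quot_class_surj R R^o (@SR_ideal k n D) b). Qed.

Lemma face_ring_gen (m : B^o) : exists b : B, m = b *: (1 : B^o).
Proof. by exists m; rewrite /GRing.scale/= mulr1. Qed.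

Lemma face_ring_ker : ker_gen face_class (1 : B^o) = ID.
Proof.
by apply: pred_ext => f; rewrite -face_class0 /ker_gen /GRing.scale/= mulr1.
Qed.

Lemma contraction_ID (P : prime_ideal B) : sub_ideal ID (contraction face_class P).
Proof.
by move=> f /face_class0; rewrite /contraction /= => ->;
  exact: (rpred0 (prime_ideal_submod P)).
Qed.

Definition origin_pred : B -> Prop := fun x => exists2 f, m0 f & x = face_class f.

Lemma origin_predE f : origin_pred (face_class f) <-> m0 f.
Proof.
have pm := face_prime_primep k (n := n) finset.set0.
split=> [[g mg fg]|mf]; last by exists f.
apply: (ideal_congr (primep_ideal pm)) mg.
have /(_ finset.set0 (face0 D)) : ID (f - g); last by [].
by apply/face_class0; rewrite rmorphB /= fg subrr.
Qed.

Lemma origin_pred_primep : primep origin_pred.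
Proof.
have pm := face_prime_primep k (n := n) finset.set0; have im := primep_ideal pm.
split=> [||a b].
- split=> [|_ _ [f mf ->] [g mg ->]|a _ [g mg ->]].
  + by rewrite -(rmorph0 face_class); apply/origin_predE; exact: ideal0.
  + by rewrite -rmorphD; apply/origin_predE; exact: idealD.
  + have [f ->] := face_class_surj a.
    by rewrite -rmorphM; apply/origin_predE; exact: idealMl.
- by rewrite -(rmorph1 face_class) => /origin_predE; exact: primep1.
- have [f ->] := face_class_surj a; have [g ->] := face_class_surj b.
  by rewrite -rmorphM => /origin_predE/(primepM pm)[] h; [left|right];
    apply/origin_predE.
Qed.

Definition origin_prime : prime_ideal B := prime_of origin_pred_primep.

Lemma origin_contraction : contraction face_class origin_prime = m0.
Proof.
apply: pred_ext => f; rewrite -origin_predE; exact: prime_ofE.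
Qed.

Lemma origin_maximal : maximal_ideal origin_prime.
Proof.
move=> I mI I1 x xI; have [f xf] := face_class_surj x.
rewrite xf in xI *; apply/prime_ofE/origin_predE/origin_mcoeff.
apply: contrapT => /eqP f0; move/negP: I1; apply.
have -> : (1 : B^o) = face_class (f@_0)^-1%:MP *: (face_class (f@_0)%:MP : B^o).
  by rewrite /GRing.scale/= -rmorphM -mpolyCM mulVf // rmorph1.
apply: rpredZ; have -> : face_class (f@_0)%:MP =
    (face_class f : B^o) + (-1 : B) *: (face_class (f - (f@_0)%:MP) : B^o).
  by rewrite /GRing.scale/= mulN1r -rmorphB opprB addrC subrK.
apply: (rpredD (S := I)) => //; apply: rpredZ; apply: mI;
  apply/prime_ofE/origin_predE/origin_mcoeff.
by rewrite mcoeffB mcoeffC eqxx mulr1 subrr.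
Qed.

Variable d : nat.
Hypothesis top_nonempty : exists F, F \in top_faces D d.

Lemma sub_face_prime F : F \in (D : {set {set 'I_n}}) -> sub_ideal ID (face_prime F).
Proof. by move=> FD f /(_ F FD). Qed.

(** The monomial of a facet F vanishes on all other faces, so its annihilator is the prime of F. *)
Lemma face_prime_assp Q F : primep Q -> F \in (D : {set {set 'I_n}}) ->
  (forall G, G \in (D : {set {set 'I_n}}) -> F \subset G -> F = G) ->
  sub_ideal (face_prime F) Q -> assp (sat Q ID) (face_prime F).
Proof.
move=> pQ FD Fmax FQ; split; first exact: face_prime_primep.
exists (squarefree_monomial k F) => a; split=> [Fa|].
  apply: sub_sat => // G GD; have [/(Fmax _ GD) <-|FG] := boolP (F \subset G).
    exact: (idealMr (face_prime_ideal k F)).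
  by apply: (idealMl (face_prime_ideal k G)); exact: face_prime_sqf.
move/(sat_sub (sub_face_prime FD)) => /(sat_primep (face_prime_primep k F) FQ).
by case/(primepM (face_prime_primep k F)) => // /face_prime_sqfN.
Qed.

Lemma maximal_face F : F \in (D : {set {set 'I_n}}) -> exists G,
  [/\ G \in (D : {set {set 'I_n}}), F \subset G &
    forall G', G' \in (D : {set {set 'I_n}}) -> G \subset G' -> G = G'].
Proof.
move=> FD; have [G /maxsetP[GD Gmax] FG] := maxset_exists FD.
by exists G; split=> // G' G'D GG'; rewrite (Gmax G').
Qed.

Lemma cohen_macaulay_origin : complex_cohen_macaulay k D -> has_reg ID m0 d.
Proof.
move=> /(_ _ origin_maximal) CM.
have surj := face_class_surj; have gen := face_ring_gen.
have Im : sub_ideal ID m0 by exact: sub_face_prime (face0 D).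
have nz : exists x : loc_mod origin_prime B^o, x <> 0.
  exists (frac (face_class 1 *: (1 : B^o)) (denom1 origin_prime)).
  move/(frac_eq0 surj); rewrite face_ring_ker origin_contraction.
  move/(sat_sub Im)/(sat_self (face_prime_primep k _)).
  exact: (primep1 (face_prime_primep k finset.set0)).
have [F Ftop] := top_nonempty; move: Ftop; rewrite inE => /andP[FD /eqP Fd].
have := @has_reg_of_depth _ _ face_class surj _ _ gen origin_prime d.
rewrite face_ring_ker origin_contraction; apply=> //; rewrite CM //.
apply: (@dim_at_ge _ _ face_class surj _ (1 : B^o) origin_prime);
  rewrite face_ring_ker origin_contraction -Fd.
by apply: chain_sub (chain_to_origin k F) => //; exact: sub_face_prime.
Qed.

Lemma cohen_macaulay_pure : complex_cohen_macaulay k D ->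
  (forall F, F \in (D : {set {set 'I_n}}) -> (#|F| <= d)%N) ->
  sub_ideal (faces_ideal (top_faces D d)) ID.
Proof.
move=> /cohen_macaulay_origin reg card_face f ftop F /maximal_face[G [GD FG Gmax]].
apply: (face_prime_sub FG); apply: ftop; rewrite inE GD eqn_leq card_face //=.
have pm := face_prime_primep k (n := n) finset.set0.
have Gm : sub_ideal (face_prime G : R -> Prop) m0.
  by apply: face_prime_sub; exact: finset.sub0set.
apply: (@chain_face_prime_le k n G m0).
apply: (has_reg_chain (@noetherian_mpoly k n) pm (faces_ideal_ideal k _)) reg => //.
exact: face_prime_assp.
Qed.

End CohenMacaulay.

(** * Regular sequences on face rings *)

Lemma chain_snoc (R : comPzRingType) (I Q Q' : R -> Prop) l a :
  primep Q' -> sub_ideal Q Q' -> Q' a -> ~ Q a -> chain I Q l -> chain I Q' l.+1.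
Proof.
move=> pQ' QQ' Q'a nQa [q [qp qs]].
exists (fun i => if (i <= l)%N then q i else Q'); split=> [i|i] /=.
  rewrite leq_eqVlt ltnS => /orP[/eqP ->|il].
    rewrite ltnn; split=> // f If; have [_ Iq qQ] := qp l (leqnn l).
    by apply: QQ'; apply: qQ; exact: Iq.
  by rewrite il; have [? ? qQ] := qp i il; split=> // f /qQ/QQ'.
rewrite ltnS leq_eqVlt => /orP[/eqP ->|il]; last by rewrite il orbT; exact: qs.
rewrite eqxx ltnn; have [_ _ qQ] := qp l (leqnn l).
by split=> [f /qQ/QQ'|]; last by exists a => // /qQ.
Qed.

Section FaceRingDepth.
Variables (k : fieldType) (n : nat) (D : simplicial_complex n).
Local Notation R := {mpoly k[n]}.
Local Notation sqf := (squarefree_monomial k).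
Local Notation ID := (@faces_ideal k n (D : {set {set 'I_n}})).
Implicit Types (F G T : {set 'I_n}) (Q : R -> Prop) (S : {set {set 'I_n}}).

Lemma alive_face Q : primep Q -> sub_ideal ID Q -> alive Q \in (D : {set {set
  'I_n}}).
Proof. by move=> pQ /(faces_ideal_alive pQ)[G GD]; exact: face_sub. Qed.

(** The first prime of the chain contains the prime of a face, which replaces the face ring by a
    single polynomial ring. *)
Lemma chain_alive Q l : chain ID Q l -> exists T,
  [/\ T \in (D : {set {set 'I_n}}), alive Q \subset T &
      exists q : nat -> R -> Prop, [/\ T = alive (q 0%N),
  (forall i, (i <= l)%N ->
     [/\ primep (q i), sub_ideal (face_prime T) (q i) & sub_ideal (q i) Q]) &
  (forall i, (i < l)%N -> sub_ideal (q i) (q i.+1) /\ exists2 a, q i.+1 a & ~ q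
    i a)]].
Proof.
move=> [q [qp qs]]; have [pq Iq qQ] := qp 0%N (leq0n l).
exists (alive (q 0%N)); split; [exact: alive_face|exact: alive_sub|].
exists q; split=> // i il; have [pqi _ qiQ] := qp i il; split=> //.
have sub0 : sub_ideal (face_prime (alive (q 0%N))) (q 0%N).
  exact: (face_prime_alive _ (primep_ideal pq)).2.
elim: i il {pqi qiQ} => [|i IHi] il f Tf; first exact: sub0.
by have [sub _] := qs i il; apply: sub; apply: IHi => //; exact: ltnW.
Qed.

(** Depth is at most dimension: any facet containing [alive Q] provides an associated prime. *)
Lemma has_reg_chain_faces Q r : primep Q -> sub_ideal ID Q -> has_reg ID Q r ->
  chain ID Q r.
Proof.
move=> pQ IQ reg; have [F [FD TF Fmax]] := maximal_face (alive_face pQ IQ).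
have FQ : sub_ideal (face_prime F) Q
  by exact: (face_prime_alive _ (primep_ideal pQ)).2.
have := has_reg_chain (@noetherian_mpoly k n) pQ (faces_ideal_ideal k _)
  (face_prime_assp pQ FD Fmax FQ) FQ reg.
by apply: chain_sub => //; exact: sub_face_prime.
Qed.

(* Near Q the face ring is cut out by the faces of S. *)
Definition local_faces Q S : Prop :=
  [/\ S \subset (D : {set {set 'I_n}}), forall F, F \in S -> alive Q \subset F &
   forall G, G \in (D : {set {set 'I_n}}) -> alive Q \subset G ->
     exists2 F, F \in S & G \subset F].

Lemma local_faces_sub Q S f : local_faces Q S -> ID f -> faces_ideal S f.
Proof. by move=> [/fintype.subsetP SD _ _] If F /SD; exact: If. Qed.

Lemma local_faces_sat Q S f : local_faces Q S -> faces_ideal S f ->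
  ID (sqf (alive Q) * f).
Proof.
move=> [_ _ cov] Sf G GD; have [TG|TG] := boolP (alive Q \subset G).
  have [F FS GF] := cov G GD TG; apply: (idealMl (face_prime_ideal k G)).
  by apply: face_prime_sub GF _ _; exact: Sf.
by apply: (idealMr (face_prime_ideal k G)); exact: face_prime_sqf.
Qed.

Lemma local_nzd Q S a : primep Q -> local_faces Q S ->
  (forall F, F \in S -> ~ face_prime F a) -> nzd_mod (sat Q ID) a.
Proof.
move=> pQ SQ aS f [u Qu Iuaf]; exists (sqf (alive Q)); first exact: sqf_alive.
apply: (local_faces_sat SQ) => F FS; have pF := face_prime_primep k F.
have [_ SA _] := SQ; have FQ : sub_ideal (face_prime F) Q.
  by apply: (face_prime_alive _ (primep_ideal pQ)).2; exact: SA.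
have := local_faces_sub SQ Iuaf FS.
by case/(primepM pF) => [/FQ//|/(primepM pF)[/(aS F FS)|]].
Qed.

(** Only the half of regularity that concerns b; that of a is checked face by face in
    [local_nzd]. *)
Definition regular_pair (K : R -> Prop) a b : Prop :=
  forall f, adj K a (b * f) -> adj K a f.

Lemma local_regular_pair Q S a b : primep Q -> local_faces Q S -> Q a -> Q b ->
  (forall F, F \in S -> ~ face_prime F a) -> regular_pair (faces_ideal S) a b ->
  has_reg ID Q 2.
Proof.
move=> pQ SQ Qa Qb aS ab; exists [:: a; b]; split=> //=; split=> //.
  exact: (local_nzd pQ SQ).
split=> // f [u Qu [c [v Qv If]]].
have [c' Sc'] : adj (faces_ideal S) a (v * u * f).
  apply: ab; exists (v * c).
  have -> : b * (v * u * f) - v * c * a = v * (u * (b * f) - c * a) by ring.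
  exact: (local_faces_sub SQ If).
exists (v * u); first exact: primepNM.
exists c', (sqf (alive Q)); first exact: sqf_alive.
exact: (local_faces_sat SQ Sc').
Qed.

(* Gluing along faces: sections of the restrictions to F and to S that agree on
   their intersection come from a global one. *)
Lemma regular_pair_glue F S a b :
  (forall G, G \in S -> exists2 G', G' \in S &
     (G :&: F \subset G' :&: F) /\ ~ face_prime (G' :&: F) a) ->
  regular_pair (face_prime F) a b -> regular_pair (faces_ideal S) a b ->
  regular_pair (faces_ideal (F |: S)) a b.
Proof.
move=> FS abF abS f [c Kc]; have iS := faces_ideal_ideal k S.
have [h1 Sh1] : adj (faces_ideal S) a f.
  by apply: abS; exists c => G GS; apply: Kc; rewrite in_setU1 GS orbT.
have [h2 Fh2] : adj (face_prime F) a f.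
  by apply: abF; exists c; apply: Kc; rewrite in_setU1 eqxx.
(* The correction h2 - h1 vanishes where F meets S, so its extension from F by zero changes nothing
   on S. Where a itself is zero and cannot be cancelled, the larger intersection with G' is used. *)
have Sd : faces_ideal S (rho F (h2 - h1)).
  move=> G GS; have [G' G'S [GG' nG'a]] := FS G GS.
  rewrite /face_prime rho_rho; apply: (face_prime_sub GG').
  have : face_prime (G' :&: F) ((h2 - h1) * a).
    have -> : (h2 - h1) * a = (f - h1 * a) - (f - h2 * a) by ring.
    apply: (idealB (face_prime_ideal k _)).
      exact: face_prime_sub (finset.subsetIl G' F) _ (Sh1 _ G'S).
    exact: face_prime_sub (finset.subsetIr G' F) _ Fh2.
  by case/(primepM (face_prime_primep k (G' :&: F))) => [|/nG'a].
exists (h1 + rho F (h2 - h1)) => G; rewrite in_setU1 => /orP[/eqP ->|GS].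
  have -> : f - (h1 + rho F (h2 - h1)) * a =
    (f - h2 * a) + (h2 - h1 - rho F (h2 - h1)) * a by ring.
  apply: (idealD (face_prime_ideal k F)) => //.
  apply: (idealMr (face_prime_ideal k F)); exact: sub_rho.
have -> : f - (h1 + rho F (h2 - h1)) * a = (f - h1 * a) - rho F (h2 - h1) * a by
  ring.
by apply: (idealB (face_prime_ideal k G));
  [exact: Sh1|apply: (idealMr (face_prime_ideal k G)); exact: Sd].
Qed.

Lemma regular_pair_congr F a b a' b' : rho F a = rho F a' -> rho F b = rho F b' ->
  regular_pair (face_prime F) a' b' -> regular_pair (face_prime F) a b.
Proof.
move=> aa' bb' ab f [c Fc]; have iF := face_prime_ideal k F.
have congr x y : rho F x = rho F y -> face_prime F (x - y).
  by move=> xy; rewrite /face_prime rmorphB /= xy subrr.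
have [c' Fc'] : adj (face_prime F) a' f.
  apply: ab; exists c; apply: (ideal_congr iF _ Fc).
  have -> : b' * f - c * a' - (b * f - c * a) = (b' - b) * f - c * (a' - a) by ring.
  by apply: (idealB iF); [apply: (idealMr iF)|apply: (idealMl iF)]; exact: congr.
exists c'; apply: (ideal_congr iF _ Fc').
have -> : f - c' * a - (f - c' * a') = c' * (a' - a) by ring.
by apply: (idealMl iF); exact: congr.
Qed.

Lemma regular_pair_set1 F a b : regular_pair (face_prime F) a b ->
  regular_pair (faces_ideal [set F]) a b.
Proof.
move=> ab f [c Kc]; have [c' h] : adj (face_prime F) a f.
  by apply: ab; exists c; apply: Kc; rewrite inE.
by exists c' => G; rewrite inE => /eqP ->.
Qed.

(** A member of Q that is nonzero on the face [alive Q] is nonzero on all faces above it. If there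
    is none, Q is the prime of [alive Q]; by the chain this is no facet, and the sum of the other
    variables is nonzero on every facet above it. *)
Lemma has_reg1 Q : primep Q -> chain ID Q 1 -> has_reg ID Q 1.
Proof.
move=> pQ ch; have [G [GD TG [q [GE qp qs]]]] := chain_alive ch.
set T := alive Q in TG *.
pose S := [set F in (D : {set {set 'I_n}}) | (T \subset F) &&
  [forall G in (D : {set {set 'I_n}}), (F \subset G) ==> (F == G)]].
have SQ : local_faces Q S.
  split=> [|F|E ED TE].
  - by apply/fintype.subsetP => F; rewrite inE => /andP[].
  - by rewrite inE => /and3P[].
  - have [F [FD EF Fmax]] := maximal_face ED; exists F => //.
    rewrite inE FD (fintype.subset_trans TE EF) /=.
    by apply/forall_inP => H HD; apply/implyP => FH; rewrite (Fmax H).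
suff [a Qa aS] : exists2 a, Q a & forall F, F \in S -> ~ face_prime F a.
  by exists [:: a]; split=> //=; split=> //; exact: (local_nzd pQ SQ).
have [QT|] := pselect (sub_ideal Q (face_prime T)); last first.
  move=> QT; have [a Qa nTa] : exists2 a, Q a & ~ face_prime T a.
    apply: contrapT => h; apply: QT => a Qa; apply: contrapT => nTa.
    by apply: h; exists a.
  exists a => // F; rewrite inE => /and3P[_ TF _] Fa; apply: nTa.
  exact: face_prime_sub Fa.
have GT : G != T.
  apply/eqP => GT; have [_ [a qa nqa]] := qs 0%N isT.
  have [_ _ qQ] := qp 1%N isT; have [_ Gq _] := qp 0%N isT.
  by apply: nqa; apply: Gq; rewrite GT; apply: QT; exact: qQ.
exists (\sum_(i | i \notin T) 'X_i).
  apply: ideal_sumr; first exact: primep_ideal.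
  by move=> i; exact: notin_alive.
move=> F; rewrite inE => /and3P[FD TF /forall_inP Fmax].
have [j jF jT] : exists2 j, j \in F & j \notin T.
  apply/subsetPn; apply/negP => FT; have FET : F = T.
    by apply/eqP; rewrite finset.eqEsubset FT.
  have := Fmax G GD; rewrite FET TG => /= /eqP TGE.
  by move: GT; rewrite -TGE eqxx.
exact: (face_prime_sum_neq0 (P := fun i => i \notin T)) jF jT.
Qed.

End FaceRingDepth.

(** * The pentagon *)

(** A monic polynomial is regular modulo a constant x. With q and r from the division of c by h, h
    (f - q x) = r x, and degrees force f = q x. *)
Lemma monic_constant_regular (A : idomainType) (h f c : {poly A}) (x : A) :
  h \is monic -> x != 0 -> h * f = c * x%:P -> exists q, f = q * x%:P.
Proof.
move=> hm x0 hf; exists (Pdiv.Ring.rdivp c h).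
set q := Pdiv.Ring.rdivp c h; pose r := Pdiv.Ring.rmodp c h.
have cE : c = q * h + r by exact: Pdiv.RingMonic.rdivp_eq.
apply/eqP; rewrite -subr_eq0; apply: contraT => d0.
have rE : h * (f - q * x%:P) = r * x%:P by rewrite mulrBr hf cE; ring.
have : (size (h * (f - q * x%:P))%R <= size r)%N.
  rewrite rE; apply: leq_trans (size_polyMleq _ _) _.
  by rewrite size_polyC x0 addn1.
rewrite size_monicM // => le.
have := Pdiv.Ring.ltn_rmodpN0 c (monic_neq0 hm); rewrite -/r => lt.
have := leq_ltn_trans le lt; have := d0; rewrite -size_poly_gt0.
move: (size h) (size (f - _)) => a b; lia.
Qed.

Section TwoVariables.
Variables (k : fieldType) (n : nat).
Local Notation R := {mpoly k[n]}.

Lemma rho_horner (F : {set 'I_n}) i (g : {poly k}) : i \in F ->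
  rho F (map_poly (@mpolyC n k) g).['X_i] = (map_poly (@mpolyC n k) g).['X_i].
Proof.
move=> iF; rewrite -horner_map /= rhoX iF -map_poly_comp; congr (_.[_]).
by apply: eq_map_poly => c /=; rewrite rhoC.
Qed.

Section Pair.
Variables u v : 'I_n.
Hypothesis uv : u != v.
Local Notation F := [set u; v].

(** The ring of the face {u, v} as k[x_u][x_v]: polynomials in x_u are constants, and polynomials in
    x_v can be monic. *)
Definition to_poly2 : R -> {poly {poly k}} :=
  mmap (polyC \o polyC) (fun i =>
    if i == u then 'X%:P else if i == v then 'X else 0).

HB.instance Definition _ := GRing.RMorphism.on to_poly2.

Definition of_poly2 : {poly {poly k}} -> R :=
  horner_morph (fun x : {poly k} =>
    mulrC 'X_v (horner_morph (fun c => mulrC ('X_u : R) (@mpolyC n k c)) x)).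

HB.instance Definition _ := GRing.RMorphism.on of_poly2.

Lemma to_poly2X i : to_poly2 'X_i = if i == u then 'X%:P else if i == v then 'X
  else 0.
Proof. by rewrite /to_poly2 mmapX mmap1U. Qed.

Lemma to_poly2C c : to_poly2 c%:MP = c%:P%:P.
Proof. exact: mmapC. Qed.

Lemma to_poly2K f : of_poly2 (to_poly2 f) = rho F f.
Proof.
pose a : {rmorphism R -> R} := of_poly2 \o to_poly2.
pose b : {rmorphism R -> R} := rho F.
apply: (mpoly_morph_eq (u := a) (v := b)) => [c|i]; rewrite /a /b /=.
  by rewrite to_poly2C rhoC /of_poly2 horner_morphC /= horner_morphC.
rewrite to_poly2X rhoX !inE; case: eqVneq => [->|iu] /=.
  by rewrite /of_poly2 horner_morphC /= horner_morphX.
by case: eqVneq => [->|iv]; [rewrite /of_poly2 horner_morphX|rewrite rmorph0].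
Qed.

Lemma to_poly2_u g : to_poly2 (map_poly (@mpolyC n k) g).['X_u] = g%:P.
Proof.
rewrite -horner_map /= to_poly2X eqxx -map_poly_comp.
rewrite (eq_map_poly (g := polyC \o polyC)) => [|c /=]; last exact: to_poly2C.
by rewrite map_poly_comp horner_map /= -/(g \Po 'X) comp_polyXr.
Qed.

Lemma to_poly2_v g : to_poly2 (map_poly (@mpolyC n k) g).['X_v] = map_poly polyC g.
Proof.
rewrite -horner_map /= to_poly2X eqxx eq_sym (negbTE uv) -map_poly_comp.
rewrite (eq_map_poly (g := polyC \o polyC)) => [|c /=]; last exact: to_poly2C.
by rewrite map_poly_comp -/(map_poly polyC g \Po 'X) comp_polyXr.
Qed.

Lemma regular_pair_two_variables g h : g != 0 -> h \is monic ->
  regular_pair (face_prime F : R -> Prop) (map_poly (@mpolyC n k) g).['X_u]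
    (map_poly (@mpolyC n k) h).['X_v].
Proof.
move=> g0 hm f [c Fc]; set gu := (map_poly (@mpolyC n k) g).['X_u] in Fc *;
  set hv := (map_poly (@mpolyC n k) h).['X_v] in Fc.
have E : map_poly polyC h * to_poly2 f = to_poly2 c * g%:P.
  rewrite -to_poly2_v -to_poly2_u -!rmorphM; apply/eqP;
    rewrite -subr_eq0 -rmorphB /= -/gu -/hv.
  have -> : to_poly2 (hv * f - c * gu) = to_poly2 (rho F (hv * f - c * gu));
    last first.
    by rewrite Fc rmorph0.
  pose a : {rmorphism R -> {poly {poly k}}} := to_poly2.
  pose b : {rmorphism R -> {poly {poly k}}} := to_poly2 \o rho F.
  apply: (mpoly_morph_eq (u := a) (v := b)) => [d|i]; rewrite /a /b /=.
    by rewrite rhoC.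
  rewrite rhoX !inE; case: ifP => // /norP[iu iv].
  by rewrite to_poly2X (negbTE iu) (negbTE iv) rmorph0.
have [|q fE] := monic_constant_regular _ g0 E; first exact: monic_map.
exists (of_poly2 q); rewrite /face_prime rmorphB /=.
have -> : rho F f = rho F (of_poly2 (to_poly2 f)).
  by rewrite to_poly2K rho_rho finset.setIid.
rewrite fE rmorphM /= -to_poly2_u to_poly2K rmorphM /= rho_rho finset.setIid.
by rewrite rmorphM /= subrr.
Qed.

End Pair.

Lemma regular_pair_mul (K : R -> Prop) a b b' :
  regular_pair K a b -> regular_pair K a b' -> regular_pair K a (b * b').
Proof. by move=> rb rb' f h; apply: rb'; apply: rb; rewrite mulrA. Qed.

(** If x_v f = c a, then c a = 0 on {w}, where x_v vanishes. So c vanishes on {w}, is a multiple of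
    x_v on the face, and x_v cancels. *)
Lemma regular_pair_variable (w v : 'I_n) a : w != v ->
  ~ face_prime [set w] a -> regular_pair (face_prime [set w; v] : R -> Prop) a 'X_v.
Proof.
move=> wv nwa f [c Fc]; set F := [set w; v] in Fc *.
have pF := face_prime_primep k F; have iF := primep_ideal pF.
have iv : ideal (adj (face_prime F : R -> Prop) 'X_v) by exact: adj_ideal.
have wc : face_prime [set w] c.
  have : face_prime [set w] (c * a).
    rewrite -[c * a](subKr ('X_v * f)).
    apply: (idealB (face_prime_ideal k _)).
      apply: (idealMr (face_prime_ideal k _)); apply/face_primeX.
      by rewrite inE eq_sym.
    by apply: face_prime_sub Fc; rewrite finset.sub1set !inE eqxx.
  by case/(primepM (face_prime_primep k [set w])).
have [c' Fc'] : adj (face_prime F : R -> Prop) 'X_v c.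
  rewrite -(subr0 c) -wc; apply: ideal_sub_rho => // i; rewrite inE => iw.
  have [->|iv'] := eqVneq i v; first by exists 1; rewrite mul1r subrr; exact: ideal0.
  by apply: sub_adj => //; apply/face_primeX; rewrite !inE negb_or iw.
exists c'; have : face_prime F ('X_v * (f - c' * a)).
  have -> : 'X_v * (f - c' * a) = ('X_v * f - c * a) + (c - c' * 'X_v) * a by ring.
  by apply: (idealD iF) => //; exact: (idealMr iF).
by case/(primepM pF) => // /face_primeX; rewrite !inE eqxx orbT.
Qed.

End TwoVariables.

Section Pentagon.
Variable k : fieldType.
Local Notation R := {mpoly k[5]}.
Local Notation vx := (@omod 5 isT).
Local Notation Delta := (independence_complex (cycle_graph 5)).
Local Notation ID := (@faces_ideal k 5 (Delta : {set {set 'I_5}})).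

Definition diagonal s : {set 'I_5} := [set vx s; vx (s + 2)].

Lemma vxE s : nat_of_ord (vx s) = (s %% 5)%N. Proof. by []. Qed.

Lemma in_diagonal s (i : 'I_5) :
  (i \in diagonal s) = (nat_of_ord i == s %% 5)%N || (nat_of_ord i == (s + 2) %%
    5)%N.
Proof. by rewrite !inE -!val_eqE. Qed.

Lemma edge5 (i j : 'I_5) : cycle_edge i j =
  (nat_of_ord j == i.+1 %% 5)%N || (nat_of_ord i == j.+1 %% 5)%N.
Proof.
rewrite /cycle_edge -val_eqE /=; have := ltn_ord i; have := ltn_ord j.
move: (nat_of_ord i) (nat_of_ord j) => a b; lia.
Qed.

Lemma diagonal_face s : diagonal s \in (Delta : {set {set 'I_5}}).
Proof.
apply/independentP => i j; rewrite !in_diagonal edge5.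
move: (nat_of_ord i) (nat_of_ord j) => a b; lia.
Qed.

Lemma face_diagonal (G : {set 'I_5}) (i : 'I_5) :
  G \in (Delta : {set {set 'I_5}}) -> i \in G ->
  (G \subset diagonal i) || (G \subset diagonal (i + 3)).
Proof.
move=> /independentP Gind iG; have [jG|jG] := boolP (vx (i + 3) \in G).
  apply/orP; right; apply/fintype.subsetP => l lG; rewrite in_diagonal.
  have := Gind _ _ iG lG; have := Gind _ _ jG lG; rewrite !edge5 vxE.
  have := ltn_ord i; have := ltn_ord l.
  move: (nat_of_ord i) (nat_of_ord l) => a b; lia.
apply/orP; left; apply/fintype.subsetP => l lG; rewrite in_diagonal.
have : nat_of_ord l != ((i + 3) %% 5)%N.
  by apply: contraNneq jG => li; rewrite (_ : vx _ = l) //; apply: val_inj.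
have := Gind _ _ iG lG; rewrite !edge5; have := ltn_ord i; have := ltn_ord l.
move: (nat_of_ord i) (nat_of_ord l) => a b; lia.
Qed.

End Pentagon.

Section PentagonDepth.
Variable k : fieldType.
Local Notation R := {mpoly k[5]}.
Local Notation vx := (@omod 5 isT).
Local Notation Delta := (independence_complex (cycle_graph 5)).
Local Notation ID := (@faces_ideal k 5 (Delta : {set {set 'I_5}})).

Lemma vx_inj_diag s : vx s != vx (s + 2).
Proof. by rewrite -val_eqE /=; lia. Qed.

(** One pair for all five edges: its restrictions are the elementary symmetric functions of the two
    variables, over any field. The product is regular modulo the sum because each variable is. *)
Lemma regular_pair_diagonal s : regular_pair (face_prime (diagonal s) : R -> Prop)
  (\sum_i 'X_i) (\sum_i 'X_i * 'X_(vx (i + 2))).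
Proof.
have uv := vx_inj_diag s; have vu := uv; rewrite eq_sym in vu.
apply: (@regular_pair_congr _ _ _ _ _ ('X_(vx s) + 'X_(vx (s + 2))) ('X_(vx s) *
  'X_(vx (s + 2)))).
- rewrite (bigD1 (vx s)) //= (bigD1 (vx (s + 2))) //= addrA rmorphD /=.
  rewrite rmorph_sum big1 ?addr0 // => i /andP[iu iv].
  by rewrite /= rhoX !inE (negbTE iu) (negbTE iv).
- rewrite (bigD1 (vx s)) //= rmorphD /= rmorph_sum big1 ?addr0 => [|i iu].
    congr (rho _ (_ * 'X_ _)); apply: val_inj => /=; lia.
  rewrite rmorphM /= !rhoX !in_diagonal /=.
  move: iu; rewrite -val_eqE /=; have := ltn_ord i; move: (nat_of_ord i) => a.
  case: ifP => // h1; rewrite ?mul0r //; case: ifP => // h2; rewrite ?mulr0 // => *.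
  exfalso; lia.
- apply: regular_pair_mul.
    rewrite /diagonal finset.setUC; apply: regular_pair_variable => //.
    by rewrite /face_prime rmorphD /= !rhoX !inE (negbTE uv) eqxx add0r;
      apply/eqP/mpolyX_neq0.
  apply: regular_pair_variable => //.
  by rewrite /face_prime rmorphD /= !rhoX !inE (negbTE vu) eqxx addr0;
    apply/eqP/mpolyX_neq0.
Qed.

(** The sum of the variables is nonzero on every nonempty face, so only empty intersections need a
    replacement, and the common vertex i with G provides it. *)
Lemma glue_diagonal s (S : {set {set 'I_5}}) G i : G \in S -> i \in G ->
  i \in diagonal s -> let a := \sum_i 'X_i : R in let b := \sum_i 'X_i * 'X_(vx
    (i + 2)) in
  regular_pair (faces_ideal S) a b -> regular_pair (faces_ideal (diagonal s |:
    S)) a b.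
Proof.
move=> GS iG si a b; apply: regular_pair_glue; last exact: regular_pair_diagonal.
have nonempty (F : {set 'I_5}) j : j \in F -> ~ face_prime F a.
  by move=> jF; apply: (@face_prime_sum_neq0 k 5 _ predT j).
move=> E ES; have [->|/set0Pn[j jE]] := eqVneq (E :&: diagonal s) finset.set0.
  exists G => //; split; first exact: finset.sub0set.
  by apply: (nonempty _ i); rewrite inE iG.
by exists E => //; split; [exact: subxx|exact: nonempty jE].
Qed.

Lemma pentagon_origin (Q : R -> Prop) : primep Q -> sub_ideal ID Q ->
  alive Q = finset.set0 -> has_reg ID Q 2.
Proof.
move=> pQ IQ T0; have QX i : Q 'X_i by apply: notin_alive; rewrite T0 inE.
have iQ := primep_ideal pQ.
(* The order of a path: read from the right, each edge shares a vertex with the one before it. *)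
pose S := diagonal 0 |: (diagonal 2 |: (diagonal 4 |: (diagonal 1 |: [set
  diagonal 3]))).
have inS s : (s < 5)%N -> diagonal s \in S.
  by case: s => [|[|[|[|[|s]]]]] // _; rewrite !inE eqxx ?orbT.
have Sdiag F : F \in S -> exists s, F = diagonal s.
  by rewrite !inE => /orP[|/orP[|/orP[|/orP[]]]] /eqP ->; eexists.
apply: (local_regular_pair (S := S) (a := \sum_i 'X_i) (b := \sum_i 'X_i *
  'X_(vx (i + 2)))) => //.
- split=> [|F _|G GD _].
  + by apply/fintype.subsetP => F /Sdiag[s ->]; exact: diagonal_face.
  + by rewrite T0 finset.sub0set.
  + have [->|/set0Pn[i iG]] := eqVneq G finset.set0.
      by exists (diagonal 0); [exact: inS|exact: finset.sub0set].
    have := ltn_ord i; case/orP: (face_diagonal GD iG) => Gi i5.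
      by exists (diagonal i) => //; exact: inS.
    exists (diagonal ((i + 3) %% 5)); first by apply: inS; rewrite ltn_mod.
    apply: fintype.subset_trans Gi _; apply/fintype.subsetP => l.
    by rewrite !in_diagonal; lia.
- by apply: ideal_sumr.
- by apply: ideal_sumr => // i _; exact: idealMl.
- move=> F /Sdiag[s ->]; apply: (@face_prime_sum_neq0 k 5 _ predT (vx s)) => //.
  by rewrite /diagonal !inE eqxx.
have d s : vx (s + 2) \in diagonal s by rewrite !inE eqxx orbT.
have d' s : vx s \in diagonal s by rewrite !inE eqxx.
apply: (@glue_diagonal _ _ (diagonal 2) (vx 2));
  [by rewrite !inE eqxx|exact: d'|exact: d|].
apply: (@glue_diagonal _ _ (diagonal 4) (vx 4));
  [by rewrite !inE eqxx|exact: d'|exact: d|].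
apply: (@glue_diagonal _ _ (diagonal 1) (vx 1));
  [by rewrite !inE eqxx|exact: d'|by rewrite in_diagonal|].
apply: (@glue_diagonal _ _ (diagonal 3) (vx 3));
  [by rewrite !inE eqxx|exact: d'|exact: d|].
by apply: regular_pair_set1; exact: regular_pair_diagonal.
Qed.

(** Near Q there are the two edges at w, glued along w. The first parameter is a member of Q that is
    nonzero on w; the second, x + y, restricts to a variable on each edge. *)
Lemma pentagon_vertex (Q : R -> Prop) w : primep Q -> sub_ideal ID Q ->
  alive Q = [set w] -> ~ sub_ideal Q (face_prime [set w]) -> has_reg ID Q 2.
Proof.
move=> pQ IQ Tw QT; have iQ := primep_ideal pQ.
have [a Qa na] : exists2 a, Q a & ~ face_prime [set w] a.
  apply: contrapT => h; apply: QT => a Qa; apply: contrapT => na; apply: h.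
  by exists a.
pose x := vx (w + 2); pose y := vx (w + 3).
have xw : x != w by rewrite -val_eqE /=; have := ltn_ord w; lia.
have yw : y != w by rewrite -val_eqE /=; have := ltn_ord w; lia.
have xy : x != y by rewrite -val_eqE /=; have := ltn_ord w; lia.
have Ex : diagonal w = [set w; x].
  by rewrite /diagonal; congr [set _; _]; apply: val_inj; rewrite /= modn_small.
have Ey : diagonal (w + 3) = [set w; y].
  rewrite /diagonal finset.setUC; congr [set _; _]; apply: val_inj => /=.
  by have := ltn_ord w; lia.
pose S := [set w; x] |: [set [set w; y]].
have aS F : F \in S -> w \in F.
  by rewrite !inE => /orP[]/eqP ->; rewrite !inE eqxx.
have nF (F : {set 'I_5}) : w \in F -> ~ face_prime F a.
  by move=> wF Fa; apply: na; apply: face_prime_sub Fa; rewrite finset.sub1set.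
apply: (local_regular_pair (S := S) (a := a) (b := 'X_x + 'X_y)) => //.
- split=> [|F /aS wF|G GD].
  + apply/fintype.subsetP => F; rewrite !inE => /orP[]/eqP ->.
      by have := diagonal_face w; rewrite Ex inE.
    by have := diagonal_face (w + 3); rewrite Ey inE.
  + by rewrite Tw finset.sub1set.
  + rewrite Tw finset.sub1set => wG; case/orP: (face_diagonal GD wG) => GE.
      by exists [set w; x]; rewrite -?Ex // !inE -Ex eqxx.
    by exists [set w; y]; rewrite -?Ey // !inE -Ey eqxx orbT.
- by apply: (idealD iQ); apply: notin_alive; rewrite Tw inE.
- by move=> F /aS; exact: nF.
apply: regular_pair_glue.
- move=> G; rewrite inE => /eqP ->; exists [set w; y]; first by rewrite inE.
  by split; [exact: subxx|apply: nF; rewrite !inE eqxx].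
- apply: (@regular_pair_congr _ _ _ _ _ a 'X_x) => //; last first.
    by apply: regular_pair_variable => //; rewrite eq_sym.
  by rewrite rmorphD /= !rhoX !inE eqxx orbT (negbTE yw) eq_sym (negbTE xy) addr0.
- apply: regular_pair_set1; apply: (@regular_pair_congr _ _ _ _ _ a 'X_y) => //.
    by rewrite rmorphD /= !rhoX !inE eqxx orbT (negbTE xw) (negbTE xy) add0r.
  by apply: regular_pair_variable => //; rewrite eq_sym.
Qed.

(** Near Q there is one edge, and Q ends a chain of length 2 in its polynomial ring, so both
    variables are algebraic modulo Q. Monic equations for them, one per variable, form the
    sequence. *)
Lemma pentagon_edge (Q : R -> Prop) : primep Q -> sub_ideal ID Q ->
  #|alive Q| = 2 -> chain ID Q 2 -> has_reg ID Q 2.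
Proof.
move=> pQ IQ T2 ch; have TD := alive_face pQ IQ; set T := alive Q in T2 TD.
have card2 F : F \in (Delta : {set {set 'I_5}}) -> T \subset F -> F = T.
  move=> FD TF; apply/eqP; rewrite eq_sym finset.eqEcard TF T2.
  exact: (card_independent (n := 5) isT FD).
have [G [GD TG [q [_ qp qs]]]] := chain_alive ch.
have GT := card2 G GD TG; rewrite GT in qp.
have alg i : exists2 g : {poly k}, g \is monic & Q (map_poly (@mpolyC 5 k) g).['X_i].
  have [g g0 qg] := chain_algebraic 'X_i qp qs (eq_leq T2).
  exists ((lead_coef g)^-1 *: g).
    by rewrite monicE lead_coefZ mulVf // lead_coef_eq0.
  rewrite T2 in qg; have [pq _ qQ] := qp 2%N isT; apply: qQ.
  by rewrite map_polyZ hornerZ; apply: (idealMl (primep_ideal pq)).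
have /cards2P[u [v [uv Tuv]]] : #|T| == 2 by rewrite T2.
have [g gm Qg] := alg u; have [h hm Qh] := alg v.
apply: (local_regular_pair (S := [set T])) Qg Qh _ _ => //.
- split=> [|F|F FD TF]; first by rewrite finset.sub1set.
    by rewrite inE => /eqP ->; exact: subxx.
  by exists T; rewrite ?inE // (card2 F FD TF) ?subxx.
- move=> F; rewrite inE => /eqP ->; rewrite /face_prime rho_horner.
    move/(congr1 (to_poly2 u v)); rewrite to_poly2_u rmorph0 => /eqP.
    by rewrite polyC_eq0 (negbTE (monic_neq0 gm)).
  by rewrite Tuv !inE eqxx.
- apply: regular_pair_set1; rewrite Tuv.
  by apply: regular_pair_two_variables => //; exact: monic_neq0.
Qed.

End PentagonDepth.

(** * The theorem *)

Section DepthEqualsDimension.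
Variables (k : fieldType) (n : nat) (D : simplicial_complex n).
Local Notation R := {mpoly k[n]}.
Local Notation M := (face_mod k D).
Local Notation ID := (@faces_ideal k n (D : {set {set 'I_n}})).

Hypothesis reg_of_chain : forall (Q : R -> Prop) l, primep Q -> sub_ideal ID Q ->
  chain ID Q l -> has_reg ID Q l.

Definition zero_pred : {pred M} := fun x => x == 0.
Definition full_pred : {pred M} := predT.

Lemma zero_pred_closed : submod_closed zero_pred.
Proof.
split=> [|a x y /eqP -> /eqP ->]; first by rewrite unfold_in.
by rewrite unfold_in scaler0 addr0.
Qed.

Lemma full_pred_closed : submod_closed full_pred.
Proof. by []. Qed.

HB.instance Definition _ := GRing.isSubmodClosed.Build R M zero_pred
  zero_pred_closed.
HB.instance Definition _ := GRing.isSubmodClosed.Build R M full_pred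
  full_pred_closed.

Lemma face_mod_seq_serre r : complex_seq_serre k D r.
Proof.
(* The filtration has a single step, since the face ring itself satisfies S_r. *)
pose F i : submodClosed M := if i is 0%N then zero_pred : submodClosed M else
  full_pred.
exists 1%N, F; split.
- by split=> // x; split=> [/eqP|->] //; exact: eqxx.
- case=> [|i] _ x; first by move=> /eqP ->; exists [::]; rewrite big_nil.
  move=> _; have [f ->] := quot_class_surj x.
  exists [seq quot_class (@SR_ideal k n D) (f@_m *: 'X_[m]) | m <- msupp f].
  split=> [y /mapP[m _ ->]|].
    split=> //; exists (Posz (mdeg m)); exists (f@_m *: 'X_[m]) => //=.
    by apply: dhomogZ; rewrite dhomogX.
  rewrite big_map {1}[f]mpolyE; elim: (msupp f) => [|m s IHs].
    rewrite !big_nil; exact/cls0/(ideal0 (faces_ideal_ideal k _)).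
  by rewrite !big_cons -IHs; exact: quot_classD.
- by case.
- case=> // _; have full x : x \in F 1%N by [].
  apply: (serre_of_reg full) => Q l.
  have -> : top_ideal (F 0%N) = ID.
    by apply: pred_ext => f; rewrite -cls0; split=> [/eqP|/eqP].
  exact: reg_of_chain.
- by [].
Qed.

Lemma face_ring_cohen_macaulay : complex_cohen_macaulay k D.
Proof.
move=> P _ _; have surj := @face_class_surj k n D; have gen := @face_ring_gen k n D.
have pQ := contraction_primep (@face_class k n D) P.
have IQ := @contraction_ID k n D P; have ker := face_ring_ker k D.
apply/eqP; rewrite eq_le; apply/andP; split.
  apply: (@depth_at_le _ _ _ surj _ _ gen); rewrite ker // => r reg.
  apply: (@dim_at_ge _ _ _ surj _ (1 : (face_ring k D)^o)); rewrite ker.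
  exact: has_reg_chain_faces.
apply: (@dim_at_le _ _ _ surj _ _ gen); rewrite ker => l ch.
by apply: (@depth_at_ge _ _ _ surj _ _ gen); rewrite ker; exact: reg_of_chain.
Qed.

End DepthEqualsDimension.

Section Cycles.
Variables (k : fieldType) (n : nat).
Hypothesis n_ge3 : (3 <= n)%N.
Local Notation R := {mpoly k[n]}.
Local Notation Delta := (independence_complex (cycle_graph n)).
Local Notation ID := (@faces_ideal k n (Delta : {set {set 'I_n}})).
Local Notation m0 := (@face_prime k n finset.set0).

Lemma cycle_chain_length (Q : R -> Prop) l : chain ID Q l -> (l <= n./2)%N.
Proof.
move=> /chain_alive[T [TD _ [q [_ qp qs]]]].
apply: leq_trans (card_independent n_ge3 TD).
by apply: (@chain_face_prime_le k n T Q); exists q.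
Qed.

(** Common to both hypotheses: J belongs to the last quotient or to the face ring, and min(3, n/2)
    is the depth that S_3 guarantees at the origin. *)
Lemma no_top_depth (J : R -> Prop) : ideal J ->
  sub_ideal J (faces_ideal (top_faces Delta n./2)) ->
  sub_ideal (faces_ideal (top_faces Delta n./2)) (sat m0 J) ->
  has_reg J m0 (minn 3 n./2) -> n = 3%N \/ n = 5%N.
Proof.
move=> iJ Jtop topJ reg; have [n6|n6] := leqP 6 n.
  have reg3 : has_reg J m0 3 by move: reg; have -> : minn 3 n./2 = 3%N by lia.
  have [nodd|nev] := boolP (odd n).
    by case: (odd_cycle_depth n_ge3 iJ Jtop topJ nodd _ reg3); lia.
  by case: (even_cycle_depth n_ge3 iJ Jtop topJ nev); exact: has_reg_le reg3.
have [n4|] := eqVneq n 4%N; last by move: n_ge3; lia.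
have reg2 : has_reg J m0 2 by move: reg; have -> : minn 3 n./2 = 2%N by lia.
by case: (even_cycle_depth n_ge3 iJ Jtop topJ _ reg2); rewrite n4.
Qed.

Let top_nonempty : exists F, F \in top_faces Delta n./2.
Proof. by exists (step_face n_ge3 0); apply: step_face_top;
  apply: leq_trans n_ge3. Qed.

Lemma seq_serre_cycle : graph_seq_serre k 3 (cycle_graph n) -> n = 3%N \/ n = 5%N.
Proof.
move=> /(seq_serre_top_ideal (@card_independent n n_ge3))[J [iJ DJ Jtop JS]].
have [F Ftop] := top_nonempty; have := Ftop; rewrite inE => /andP[_ /eqP Fd].
have Jm : sub_ideal J m0.
  move=> f /Jtop/(_ _ Ftop); apply: face_prime_sub; exact: finset.sub0set.
apply: (no_top_depth iJ Jtop) => [w topw|].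
  apply: (unmixed_at_origin (@card_independent n n_ge3) iJ DJ Jtop _
    top_nonempty topw).
  by move=> Q l pQ JQ l2; apply: JS => //; exact: leq_trans l2 _.
apply: JS => //; first exact: face_prime_primep.
  exact: geq_minl.
apply: (chain_le (geq_minr _ _)); rewrite -Fd.
by apply: chain_sub (chain_to_origin k F) => // f /Jtop; exact.
Qed.

Lemma cohen_macaulay_cycle : graph_cohen_macaulay k (cycle_graph n) -> n = 3%N
  \/ n = 5%N.
Proof.
move=> CM; have card := @card_independent n n_ge3.
have topI := cohen_macaulay_pure top_nonempty CM card.
have reg := cohen_macaulay_origin top_nonempty CM.
apply: (no_top_depth (faces_ideal_ideal k _)) (has_reg_le (geq_minr _ _) reg).
  by move=> f If F; rewrite inE => /andP[FD _]; exact: If.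
move=> f /topI; apply: sub_sat; exact: face_prime_primep.
Qed.

End Cycles.

(** Chains have length at most n/2 <= 2, and length 2 occurs only for the pentagon, where the cases
    are the sizes 0, 1, 2 of [alive Q]. *)
Lemma has_reg_good_cycle (k : fieldType) n (Q : {mpoly k[n]} -> Prop) l :
  n = 3%N \/ n = 5%N -> primep Q ->
  sub_ideal (faces_ideal (independence_complex (cycle_graph n) : {set {set
    'I_n}})) Q ->
  chain (faces_ideal (independence_complex (cycle_graph n) : {set {set 'I_n}}))
    Q l ->
  has_reg (faces_ideal (independence_complex (cycle_graph n) : {set {set
    'I_n}})) Q l.
Proof.
move=> n35 pQ IQ ch; have n3 : (3 <= n)%N by lia.
have := cycle_chain_length n3 ch.
case: l ch => [|[|[|l]]] ch ln; [exact: has_reg0|exact: has_reg1| |lia].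
have n5 : n = 5%N by lia.
subst n; have TD := alive_face pQ IQ.
have := card_independent n3 TD.
case Tc: #|alive Q| => [|[|[|t]]] // _.
- by apply: pentagon_origin => //; apply/eqP; rewrite -cards_eq0 Tc.
(* If Q lay in the prime of w, the origin, which contains x_w, would prolong the chain to length 3
   over a face with at most two vertices. *)
- have /eqP/cards1P[w Tw] := Tc; apply: (pentagon_vertex (w := w)) => // Qw.
  have [G [GD TG [q [_ qp qs]]]] := chain_alive ch.
  have chG : chain (face_prime G : {mpoly k[5]} -> Prop) Q 2 by exists q.
  have : (3 <= #|G|)%N.
    apply: (@chain_face_prime_le k 5 G (face_prime finset.set0)).
    apply: (chain_snoc (a := 'X_w)) chG.
    + exact: face_prime_primep.
    + by move=> f /Qw; apply: face_prime_sub; exact: finset.sub0set.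
    + by apply/face_primeX; rewrite inE.
    + by apply/aliveP; rewrite Tw inE.
  by rewrite leqNgt ltnS (card_independent n3 GD).
- exact: pentagon_edge.
Qed.

Theorem proposition4p2 (k : fieldType) (n : nat) (hn : (3 <= n)%N) :
  (graph_seq_serre k 3 (cycle_graph n) <-> n = 3%N \/ n = 5%N) /\
  (graph_seq_serre k 3 (cycle_graph n) <->
   graph_cohen_macaulay k (cycle_graph n)).
Proof.
have SC : n = 3%N \/ n = 5%N -> graph_seq_serre k 3 (cycle_graph n).
  by move=> n35; apply: face_mod_seq_serre => Q l; exact: has_reg_good_cycle.
have CM : n = 3%N \/ n = 5%N -> graph_cohen_macaulay k (cycle_graph n).
  by move=> n35; apply: face_ring_cohen_macaulay => Q l; exact: has_reg_good_cycle.
split; split=> //; first exact: seq_serre_cycle.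
  by move/(seq_serre_cycle hn).
by move/(cohen_macaulay_cycle hn).
Qed.
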